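(* Let $D\subset\mathbb R^N$ be a fixed bounded set and let $\Omega_\varepsilon$, $\varepsilon>0$, and $\Omega$ be domains contained in $D$. Assume that the sets $\Omega_\varepsilon$ compactly converge to $\Omega$ as $\varepsilon\to0$ and that $\Omega$ is stable. Let $f_\varepsilon\in H^1(\Omega_\varepsilon)$ and $f\in H^1(\Omega)$. If the data $f_\varepsilon$ converge to $f$ in the sense that $$\|f_\varepsilon-f_0\|_{L^2(\Omega_\varepsilon)}\to0,\qquad \|\nabla f_\varepsilon-(\nabla f)_0\|_{L^2(\Omega_\varepsilon)}\to0\qquad\text{as }\varepsilon\to0,$$ then the solutions $u_\varepsilon$ of the Navier problems $\Delta^2u_\varepsilon=0$ in $\Omega_\varepsilon$, $u_\varepsilon=0$ and $\Delta u_\varepsilon=f_\varepsilon$ on $\partial\Omega_\varepsilon$ converge to the solution $u$ of the Navier problem $\Delta^2u=0$ in $\Omega$, $u=0$ and $\Delta u=f$ on $\partial\Omega$, in the sense that $$\|u_\varepsilon-u_0\|_{L^2(\Omega_\varepsilon)}\to0,\quad \|\nabla u_\varepsilon-(\nabla u)_0\|_{L^2(\Omega_\varepsilon)}\to0,\quad \|\Delta u_\varepsilon-(\Delta u)_0\|_{L^2(\Omega_\varepsilon)}\to0\qquad\text{as }\varepsilon\to0 .$$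
   Context: A domain is a connected open set. For a function $v$, $v_0$ denotes its extension by zero outside its natural domain of definition. $H(\Delta,\Omega)=\{u\in L^2(\Omega):\Delta u\in L^2(\Omega)\}$, $\Delta u$ being the distributional Laplacian. The Navier problem $\Delta^2u=0$ in $\Omega$, $u=0$ and $\Delta u=f$ on $\partial\Omega$, with datum $f\in H^1(\Omega)$, is understood in the weak sense: $u\in H(\Delta,\Omega)\cap H^1_0(\Omega)$ and $$\int_\Omega\Delta u\,\Delta\varphi\,dx=\int_\Omega(f\Delta\varphi+\nabla f\cdot\nabla\varphi)\,dx\qquad\text{for all }\varphi\in H(\Delta,\Omega)\cap H^1_0(\Omega)$$ (there is a unique solution); the same with $\Omega_\varepsilon,f_\varepsilon$. The domains $\Omega_\varepsilon$ compactly converge to $\Omega$ as $\varepsilon\to0$ if for every compact $K\subset\Omega\cup(\mathbb R^N\setminus\overline\Omega)$ there is $\varepsilon_K>0$ such that $K\subset\Omega_\varepsilon\cup(\mathbb R^N\setminus\overline{\Omega_\varepsilon})$ for all $\varepsilon\in(0,\varepsilon_K)$, in the Keldysh sense (compact subsets of $\Omega$ are eventually contained in $\Omega_\varepsilon$ and compact subsets of $\mathbb R^N\setminus\overline\Omega$ are eventually contained in $\mathbb R^N\setminus\overline{\Omega_\varepsilon}$). $\Omega$ is stable if every function in $H^1(\mathbb R^N)$ vanishing a.e. on $\mathbb R^N\setminus\overline\Omega$ belongs to $H^1_0(\Omega)$. *)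

(* Defs.v *)
From HB Require Import structures.
From mathcomp Require Import all_boot all_order all_algebra.
From mathcomp Require Import all_classical all_reals all_analysis.

Set Implicit Arguments.
Unset Strict Implicit.
Unset Printing Implicit Defensive.

Import Order.TTheory GRing.Theory Num.Theory.
Import numFieldNormedType.Exports.

Local Open Scope classical_set_scope.
Local Open Scope ring_scope.

(* R^n is 'rV[R]_n.  Its sigma-algebra is generated by the coordinates, as the
   library does for n.-tuple; this is the Borel sigma-algebra. *)
Definition rV_display : measure_display. Proof. by constructor. Qed.

Section measurable_rV.
Context {R : realType} (n : nat).

Definition rV_coord (i : 'I_n) (x : 'rV[R]_n) : measurableTypeR R := x ord0 i.

Let rV_set0 : g_sigma_preimage rV_coord set0.
Proof. exact: sigma_algebra0. Qed.

Let rV_setC A : g_sigma_preimage rV_coord A -> g_sigma_preimage rV_coord (~` A).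
Proof. exact: sigma_algebraC. Qed.

Let rV_bigcup (F : (set 'rV[R]_n)^nat) :
  (forall i, g_sigma_preimage rV_coord (F i)) ->
  g_sigma_preimage rV_coord (\bigcup_i (F i)).
Proof. exact: sigma_algebra_bigcup. Qed.

HB.instance Definition _ := @isMeasurable.Build rV_display 'rV[R]_n
  (g_sigma_preimage rV_coord) rV_set0 rV_setC rV_bigcup.

End measurable_rV.

Lemma measurable_rV_coord (R : realType) n (i : 'I_n) :
  measurable_fun [set: 'rV[R]_n] (rV_coord i).
Proof.
move=> _ Y mY; rewrite setTI; apply: sub_sigma_algebra => /=.
rewrite -bigcup_seq/=; exists i => /=; first by rewrite mem_index_enum.
by exists Y => //; rewrite setTI.
Qed.

Lemma measurable_fun_rV (R : realType) d (T : measurableType d) n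
    (f : T -> 'rV[R]_n) :
  (forall i, measurable_fun [set: T] (rV_coord i \o f)) ->
  measurable_fun [set: T] f.
Proof.
move=> mf _ A mA.
have : preimage_set_system [set: T] f (g_sigma_preimage (@rV_coord R n))
    `<=` measurable.
  rewrite -g_sigma_preimage_comp.
  apply: smallest_sub; first exact: sigma_algebra_measurable.
  case: n => [|n] in f mf A mA *; first by rewrite big_ord0.
  rewrite -bigcup_mkord_ord; apply: bigcup_sub => i Ii.
  by move=> B [C mC <-]; exact: mf.
by apply; exists A.
Qed.

Section cons_rV_measure.
Context {R : realType} (n : nat).

Definition cons_rV (p : measurableTypeR R * 'rV[R]_n) : 'rV[R]_n.+1 :=
  row_mx (p.1%:M : 'rV[R]_1) p.2.

Definition uncons_rV (x : 'rV[R]_n.+1) : measurableTypeR R * 'rV[R]_n :=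
  (x ord0 ord0, \row_i x ord0 (lift ord0 i)).

Lemma cons_rV0 p : cons_rV p ord0 ord0 = p.1.
Proof.
transitivity (row_mx (p.1%:M : 'rV[R]_1) p.2 ord0 (lshift n ord0)).
  by congr (_ _); exact: val_inj.
by rewrite row_mxEl mxE eqxx mulr1n.
Qed.

Lemma cons_rVS p i : cons_rV p ord0 (lift ord0 i) = p.2 ord0 i.
Proof.
transitivity (row_mx (p.1%:M : 'rV[R]_1) p.2 ord0 (rshift 1 i)).
  by congr (_ _); exact: val_inj.
by rewrite row_mxEr.
Qed.

Lemma cons_rVK : cancel cons_rV uncons_rV.
Proof.
move=> [a y]; congr pair; first by rewrite cons_rV0.
by apply/rowP => i; rewrite mxE cons_rVS.
Qed.

Lemma measurable_cons_rV : measurable_fun [set: _] cons_rV.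
Proof.
apply: measurable_fun_rV => i.
have [j ->|->] := unliftP ord0 i.
  rewrite (_ : _ \o _ = rV_coord j \o snd).
    by apply: measurableT_comp => //; exact: measurable_rV_coord.
  by apply/funext => p; rewrite /= /rV_coord cons_rVS.
rewrite (_ : _ \o _ = fst)//.
by apply/funext => p; rewrite /= /rV_coord cons_rV0.
Qed.

Lemma measurable_uncons_rV : measurable_fun [set: _] uncons_rV.
Proof.
apply: measurable_fun_pair; first exact: (measurable_rV_coord ord0).
apply: measurable_fun_rV => i.
rewrite (_ : _ \o _ = rV_coord (lift ord0 i)); first exact: measurable_rV_coord.
by apply/funext => x; rewrite /= /rV_coord mxE.
Qed.

Variable m : {sigma_finite_measure set 'rV[R]_n -> \bar R}.

Definition cons_measure : set 'rV[R]_n.+1 -> \bar R :=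
  pushforward (@lebesgue_measure R \x m)%E cons_rV.

Let cons_measure0 : cons_measure set0 = 0%E.
Proof. by rewrite /cons_measure /pushforward preimage_set0 measure0. Qed.

Let cons_measure_ge0 A : (0 <= cons_measure A)%E.
Proof. by rewrite /cons_measure /pushforward measure_ge0. Qed.

Let cons_measure_sigma_additive : semi_sigma_additive cons_measure.
Proof.
move=> F mF tF mUF; rewrite /cons_measure /pushforward preimage_bigcup.
apply: measure_semi_sigma_additive.
- by move=> k; rewrite -[X in measurable X]setTI; exact: measurable_cons_rV.
- apply/trivIsetP => /= i j _ _ ij; rewrite -preimage_setI.
  by move/trivIsetP : tF => /(_ _ _ _ _ ij) ->//; rewrite preimage_set0.
- rewrite -preimage_bigcup -[X in measurable X]setTI.
  exact: measurable_cons_rV.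
Qed.

HB.instance Definition _ := isMeasure.Build _ _ _ cons_measure
  cons_measure0 cons_measure_ge0 cons_measure_sigma_additive.

Let cons_measure_sigma_finite : sigma_finite [set: 'rV[R]_n.+1] cons_measure.
Proof.
have /sigma_finiteP[F [FT ndF Foo]] := sigma_finiteT (@lebesgue_measure R).
have /sigma_finiteP[G [GT ndG Goo]] := sigma_finiteT m.
exists (fun k => uncons_rV @^-1` (F k `*` G k)).
  rewrite -preimage_bigcup; apply/seteqP; split=> // x _.
  have [i _ Fi] : (\bigcup_i F i) (uncons_rV x).1 by rewrite -FT.
  have [j _ Gj] : (\bigcup_i G i) (uncons_rV x).2 by rewrite -GT.
  exists (maxn i j) => //; split.
    by move: Fi; exact/subsetPset/ndF/leq_maxl.
  by move: Gj; exact/subsetPset/ndG/leq_maxr.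
move=> k; have [mF Fk] := Foo k; have [mG Gk] := Goo k; split.
  rewrite -[X in measurable X]setTI.
  by apply: measurable_uncons_rV => //; exact: measurableX.
rewrite /cons_measure /pushforward -comp_preimage.
rewrite (_ : _ \o _ = id) ?preimage_id; last exact/funext/cons_rVK.
by rewrite product_measure1E// lte_mul_pinfty// ge0_fin_numE.
Qed.

HB.instance Definition _ := @Measure_isSigmaFinite.Build _ _ _ cons_measure
  cons_measure_sigma_finite.

End cons_rV_measure.

(* Lebesgue measure on R^n: the product of n copies of the Lebesgue measure on
   the line. *)
Fixpoint lebesgue_rV {R : realType} n :
    {sigma_finite_measure set 'rV[R]_n -> \bar R} :=
  match n with
  | 0 => \d_ (0 : 'rV[R]_0)
  | n'.+1 => cons_measure (lebesgue_rV n')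
  end.

Lemma lebesgue_rV_box (R : realType) n (A : 'I_n -> set (measurableTypeR R)) :
  (forall i, measurable (A i)) ->
  lebesgue_rV n [set x | forall i, A i (x ord0 i)] =
  (\prod_(i < n) lebesgue_measure (A i))%E.
Proof.
elim: n => [|n IHn] in A *=> mA.
  rewrite big_ord0 /= diracE mem_set//= => -[].
  by case.
have mB : measurable [set x : 'rV[R]_n | forall i, A (lift ord0 i) (x ord0 i)].
  rewrite (_ : mkset _ =
      \big[setI/setT]_(i < n) (rV_coord i @^-1` A (lift ord0 i))).
    apply: bigsetI_measurable => i _; rewrite -[X in measurable X]setTI.
    exact: measurable_rV_coord.
  rewrite -bigcap_seq; apply/seteqP; split=> [x Ax i _|x Ax i]; first exact: Ax.
  by apply: Ax; rewrite /= mem_index_enum.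
rewrite big_ord_recl -IHn//= /cons_measure /pushforward.
rewrite -product_measure1E//.
congr (_ _); apply/seteqP; split=> [[a y] Aay|[a y] [/= Aa Ay] i] /=.
  split=> [|i] /=; first by have := Aay ord0; rewrite cons_rV0.
  by have := Aay (lift ord0 i); rewrite cons_rVS.
by have [j ->|->] := unliftP ord0 i; rewrite ?cons_rVS ?cons_rV0.
Qed.

Section sobolev.
Context {R : realType} {n : nat}.
Local Notation E := 'rV[R]_n.
Implicit Types (Om : set E) (u v f g phi : E -> R) (G : E -> E).

Definition dot (x y : E) : R := \sum_(i < n) x ord0 i * y ord0 i.

(* Functions on an open set Om are represented by total functions on R^n; no
   definition below depends on the values taken outside Om. *)

Definition ext0 {V : zmodType} Om (h : E -> V) : E -> V := patch (fun=> 0) Om h.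

Definition L2 Om u : Prop := ext0 Om u \in Lfun (lebesgue_rV n) 2%:E.

Definition L2norm Om u : \bar R :=
  'N[lebesgue_rV n]_2%:E[EFin \o ext0 Om u]%E.

Definition L2_vec Om G : Prop := forall i, L2 Om (fun x => G x ord0 i).

(* L^2 norm of a vector field, with the Euclidean norm (the library norm on
   'rV[R]_n is the sup norm). *)
Definition L2norm_vec Om G : \bar R :=
  L2norm Om (fun x => Num.sqrt (dot (G x) (G x))).

Definition partial (i : 'I_n) phi : E -> R := 'D_(delta_mx ord0 i) phi.

Definition partials (s : seq 'I_n) phi : E -> R := foldr partial phi s.

Definition grad phi : E -> E := fun x => \row_i partial i phi x.

Definition laplacian phi : E -> R :=
  fun x => \sum_(i < n) partials [:: i; i] phi x.

Definition smooth phi : Prop := forall s : seq 'I_n,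
  continuous (partials s phi) /\
  forall (i : 'I_n) (x : E), derivable (partials s phi) x (delta_mx ord0 i).

Definition supp phi : set E := closure [set x | phi x != 0].

Definition test_function Om phi : Prop :=
  [/\ smooth phi, compact (supp phi) & supp phi `<=` Om].

Definition is_weak_grad Om u G : Prop :=
  forall phi, test_function Om phi -> forall i : 'I_n,
    \int[lebesgue_rV n]_(x in Om) (u x * partial i phi x) =
    - \int[lebesgue_rV n]_(x in Om) (G x ord0 i * phi x).

Definition is_distr_lap Om u g : Prop :=
  forall phi, test_function Om phi ->
    \int[lebesgue_rV n]_(x in Om) (u x * laplacian phi x) =
    \int[lebesgue_rV n]_(x in Om) (g x * phi x).

Definition H1 Om u : Prop :=
  L2 Om u /\ exists G, L2_vec Om G /\ is_weak_grad Om u G.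

Definition HDelta Om u : Prop :=
  L2 Om u /\ exists g, L2 Om g /\ is_distr_lap Om u g.

(* A representative in L^2 of the weak gradient (resp. of the distributional
   Laplacian); it is unique up to a null subset of Om.  The default value 0 is only used
   outside of H1 Om (resp. HDelta Om). *)
Definition weak_grad Om u : E -> E :=
  xget (fun=> 0) [set G | L2_vec Om G /\ is_weak_grad Om u G].

Definition distr_lap Om u : E -> R :=
  xget (fun=> 0) [set g | L2 Om g /\ is_distr_lap Om u g].

(* The closure of the test functions in H1 Om; the weak gradient of a test
   function is its classical gradient. *)
Definition H10 Om u : Prop :=
  H1 Om u /\ forall e : R, 0 < e -> exists phi,
    [/\ test_function Om phi, (L2norm Om (u \- phi)%R < e%:E)%E
      & (L2norm_vec Om (weak_grad Om u \- grad phi)%R < e%:E)%E].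

Definition domain Om : Prop := open Om /\ connected Om.

Definition navier_solution Om f u : Prop :=
  [/\ HDelta Om u, H10 Om u & forall phi, HDelta Om phi -> H10 Om phi ->
    \int[lebesgue_rV n]_(x in Om) (distr_lap Om u x * distr_lap Om phi x) =
    \int[lebesgue_rV n]_(x in Om)
      (f x * distr_lap Om phi x + dot (weak_grad Om f x) (weak_grad Om phi x))].

Definition compactly_converge (Om_ : R -> set E) Om : Prop :=
  (forall K, compact K -> K `<=` Om ->
    \forall e \near 0^'+, K `<=` Om_ e) /\
  (forall K, compact K -> K `<=` ~` closure Om ->
    \forall e \near 0^'+, K `<=` ~` closure (Om_ e)).

Lemma compactly_convergeU (Om_ : R -> set E) Om K : open Om ->
  compactly_converge Om_ Om -> compact K -> K `<=` Om `|` ~` closure Om ->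
  \forall e \near 0^'+, K `<=` Om_ e `|` ~` closure (Om_ e).
Proof.
move=> oOm [cin cout] cK KOm.
have cKin : compact (K `&` closure Om).
  by apply: compact_closedI => //; exact: closed_closure.
have cKout : compact (K `&` ~` Om).
  by apply: compact_closedI => //; exact: open_closedC.
have /(cin _ cKin) Hin : K `&` closure Om `<=` Om by move=> x [/KOm[]].
have /(cout _ cKout) Hout : K `&` ~` Om `<=` ~` closure Om.
  by move=> x [/KOm[]].
apply: filterS2 Hin Hout => e Kin Kout x Kx.
have [xOm|xOm] := pselect (Om x); last by right; exact: Kout.
by left; apply: Kin; split => //; exact: subset_closure.
Qed.

(* H10 Om is identified with a subspace of H^1(R^n) through extension by 0. *)
Definition stable Om : Prop := forall v, H1 [set: E] v ->
  {ae lebesgue_rV n, forall x, ~ closure Om x -> v x = 0} ->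
  exists2 w, H10 Om w & {ae lebesgue_rV n, forall x, v x = ext0 Om w x}.

End sobolev.

(* Main.v *)
(* Let w in H10(Om) solve (grad w, grad psi) = (grad f, grad psi) for all test
   functions psi.  Testing the Navier problem against Dirichlet solutions gives
   Lap u = f - w, so u and w both solve Dirichlet problems, the one for w with
   right-hand side grad f and the one for u with right-hand side f - w.  It thus
   suffices that Dirichlet solutions p_e on Om_e converge to the solution p on Om
   when the functionals L_e converge to L.  Comparing p_e with a test function
   close to p, whose support lies in Om_e for small e, reduces this to
   M = L - (grad p, grad .) having small norm on the test functions of Om_e,
   which are test functions of the 1/(k+1)-neighbourhood of Om.  The Riesz
   representatives of M on these decreasing neighbourhoods form a Cauchy
   sequence; its limit vanishes outside the closure of Om, hence is in H10(Om) by
   stability, where M vanishes; so the norms of M tend to 0. *)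
Require Import Defs.
From HB Require Import structures.
From mathcomp Require Import all_boot all_order all_algebra.
From mathcomp Require Import all_classical all_reals all_analysis.
From mathcomp Require Import measurable_realfun ring lra.

Set Implicit Arguments.
Unset Strict Implicit.
Unset Printing Implicit Defensive.

Import Order.TTheory GRing.Theory Num.Theory.
Import numFieldNormedType.Exports.

Local Open Scope classical_set_scope.
Local Open Scope ring_scope.

(** * Semi-inner products and approximate Riesz representatives *)

Section semi_inner_product.
Context {R : realType} {V : lmodType R}.
Implicit Types (S W : set V) (B : V -> V -> R) (u v w : V) (a e : R).

(** No boundary regularity is available, so [f] has no trace with which Lap u could be compared.
    Subtracting [w] leaves the weakly harmonic part f - w of [f]; with the test function v in H10
    such that Lap v = Lap u - f + w, the weak formulation becomes |Lap u - f + w|^2 = 0.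

    In the Dirichlet problems the obstacle is that [Om_ e] may stick out of [Om]: a test function of
    [Om_ e] need not be one of [Om], and compact convergence only confines it to a small
    neighbourhood. Hence a Riesz argument over a decreasing sequence of spaces, whose limit is known
    only to vanish outside the closure, which is where stability applies.

    H10 is never built as a Hilbert space. Minimization stays among test functions, with
    near-minimizers in place of minimizers, and the only completeness used is that of L^2. One box
    contains all the domains, so the Poincare constant does not depend on e. *)

Definition subspace S := S 0 /\ forall a u v, S u -> S v -> S (a *: u + v).

(** Only semi-definite, because functions equal almost everywhere are not identified; the laws are
    required on [S] only, because integrals are additive on integrable functions only. *)
Definition semi_inner S B := [/\ subspace S,
  forall u v, S u -> S v -> B u v = B v u,
  forall a u v w, S u -> S v -> S w -> B (a *: u + v) w = a * B u w + B v w
  & forall u, S u -> 0 <= B u u].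

Definition semi_norm B u := Num.sqrt (B u u).

Section theory.
Variables (S : set V) (B : V -> V -> R).
Hypothesis SB : semi_inner S B.

Lemma subspaceZ W a u : subspace W -> W u -> W (a *: u).
Proof. by move=> [W0 WD] Wu; rewrite -[_ *: _]addr0; exact: WD. Qed.

Lemma subspaceD W u v : subspace W -> W u -> W v -> W (u + v).
Proof. by move=> [W0 WD] Wu Wv; rewrite -[u]scale1r; exact: WD. Qed.

Lemma subspaceB W u v : subspace W -> W u -> W v -> W (u - v).
Proof. by move=> [W0 WD] Wu Wv; rewrite addrC -scaleN1r; exact: WD. Qed.

Let Ssub : subspace S. Proof. by case: SB. Qed.
Let sym u v : S u -> S v -> B u v = B v u. Proof. by case: SB => _ + _ _; exact. Qed.
Let lin a u v w : S u -> S v -> S w -> B (a *: u + v) w = a * B u w + B v w.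
Proof. by case: SB => _ _ + _; exact. Qed.

Lemma semi_ge0 u : S u -> 0 <= B u u. Proof. by case: SB => _ _ _; exact. Qed.

Lemma semi_innerDl u v w : S u -> S v -> S w -> B (u + v) w = B u w + B v w.
Proof. by move=> Su Sv Sw; rewrite -[u]scale1r lin// scale1r mul1r. Qed.

Lemma semi_innerBl u v w : S u -> S v -> S w -> B (u - v) w = B u w - B v w.
Proof. by move=> Su Sv Sw; rewrite addrC -scaleN1r lin//; ring. Qed.

Lemma semi_innerDr u v w : S u -> S v -> S w -> B w (u + v) = B w u + B w v.
Proof.
move=> Su Sv Sw; have Suv : S (u + v) by exact: subspaceD.
by rewrite sym// semi_innerDl// (sym Su)// (sym Sv).
Qed.

Lemma semi_innerBr u v w : S u -> S v -> S w -> B w (u - v) = B w u - B w v.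
Proof.
move=> Su Sv Sw; have Suv : S (u - v) by exact: subspaceB.
by rewrite sym// semi_innerBl// (sym Su)// (sym Sv).
Qed.

Lemma semi_innerZl a u w : S u -> S w -> B (a *: u) w = a * B u w.
Proof.
move=> Su Sw; have S0 : S 0 by case: Ssub.
have B0 : B 0 w = 0.
  have := lin 1 S0 S0 Sw; rewrite scale1r addr0 mul1r => /eqP.
  by rewrite -subr_eq subrr => /eqP <-.
by rewrite -[_ *: _]addr0 lin// B0 addr0.
Qed.

Lemma semi_innerDZ a u v : S u -> S v ->
  B (a *: u + v) (a *: u + v) = a ^+ 2 * B u u + 2 * a * B u v + B v v.
Proof.
move=> Su Sv; have Sau : S (a *: u) by exact: subspaceZ.
have Sauv : S (a *: u + v) by exact: subspaceD.
rewrite semi_innerDl// !semi_innerDr// !semi_innerZl// (sym Sv)// semi_innerZl//.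
by rewrite (sym Su Sau) semi_innerZl//; ring.
Qed.

Lemma sqr_semi_norm u : S u -> semi_norm B u ^+ 2 = B u u.
Proof. by move=> Su; rewrite sqr_sqrtr// semi_ge0. Qed.

Lemma semi_norm_ge0 u : 0 <= semi_norm B u. Proof. exact: sqrtr_ge0. Qed.

(** A quadratic in [t] bounded below by [- (d ^+ 2)] yields a discriminant condition. With [d] the
    norm of the other vector this is Cauchy-Schwarz; with [d ^+ 2] a minimization error it makes a
    near-minimizer nearly critical. *)
Lemma quadratic_bound (x y : R) (d : R) : 0 <= y -> 0 <= d ->
  (forall t, - (d ^+ 2) <= 2 * t * x + t ^+ 2 * y ^+ 2) -> `|x| <= d * y.
Proof.
move=> y0 d0 H; have [y_eq0|y_neq0] := eqVneq y 0.
  rewrite y_eq0 mulr0 normr_le0; apply: contraT => x0.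
  (* For y = 0 the bound is linear in [t], and this [t] gives it the value - d^2 - 1. *)
  have := H (- (d ^+ 2 + 1) / (2 * x)); rewrite y_eq0.
  have -> : 2 * (- (d ^+ 2 + 1) / (2 * x)) * x = - (d ^+ 2 + 1) by field.
  by rewrite expr0n mulr0 addr0; lra.
have y2 : 0 < y ^+ 2 by rewrite exprn_gt0// lt_neqAle eq_sym y_neq0.
(* The vertex of the parabola. *)
have := H (- x / y ^+ 2).
have -> : 2 * (- x / y ^+ 2) * x + (- x / y ^+ 2) ^+ 2 * y ^+ 2 =
   - (x ^+ 2 / y ^+ 2) by field.
rewrite lerN2 ler_pdivrMr// -exprMn -ler_sqrt ?exprn_ge0 ?mulr_ge0//.
by rewrite !sqrtr_sqr (ger0_norm (mulr_ge0 _ _)).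
Qed.

Lemma cauchy_schwarz u v : S u -> S v ->
  `|B u v| <= semi_norm B u * semi_norm B v.
Proof.
move=> Su Sv; rewrite mulrC; apply: quadratic_bound; rewrite ?semi_norm_ge0//.
move=> t; rewrite !sqr_semi_norm//.
by have := semi_ge0 (subspaceD Ssub (subspaceZ t Ssub Su) Sv);
  rewrite semi_innerDZ//; lra.
Qed.

Lemma semi_normD u v : S u -> S v ->
  semi_norm B (u + v) <= semi_norm B u + semi_norm B v.
Proof.
move=> Su Sv; have Suv := subspaceD Ssub Su Sv.
rewrite -ler_sqr ?nnegrE ?addr_ge0 ?semi_norm_ge0// sqr_semi_norm//.
have := semi_innerDZ 1 Su Sv; rewrite scale1r => ->.
rewrite sqrrD !sqr_semi_norm//.
by have := le_trans (ler_norm _) (cauchy_schwarz Su Sv); lra.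
Qed.

Lemma semi_normZ a u : S u -> semi_norm B (a *: u) = `|a| * semi_norm B u.
Proof.
move=> Su; have Sau := subspaceZ a Ssub Su.
rewrite /semi_norm semi_innerZl// (sym Su)// semi_innerZl// mulrA -expr2.
by rewrite sqrtrM ?sqr_ge0// sqrtr_sqr.
Qed.

Lemma semi_norm_distC u v : S u -> S v -> semi_norm B (u - v) = semi_norm B (v - u).
Proof.
move=> Su Sv; have -> : u - v = -1 *: (v - u) by rewrite scaleN1r opprB.
by rewrite semi_normZ ?normrN1 ?mul1r//; exact: subspaceB.
Qed.

Lemma semi_norm_triangle w u v : S u -> S v -> S w ->
  semi_norm B (u - v) <= semi_norm B (u - w) + semi_norm B (w - v).
Proof.
move=> Su Sv Sw; have -> : u - v = (u - w) + (w - v) by rewrite addrA subrK.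
by apply: semi_normD; exact: subspaceB.
Qed.

(* Approximate Riesz representatives phi k of M on W k: minimize
   B u u - 2 M u up to 1 / (k + 1)^2; the parallelogram identity and the
   monotonicity of the infima make them a Cauchy sequence. *)
Lemma riesz_decreasing (W : nat -> set V) (M : V -> R) (C : R) :
  (forall k, subspace (W k)) -> (forall k, W k `<=` S) ->
  (forall k, W k.+1 `<=` W k) ->
  (forall a u v, S u -> S v -> M (a *: u + v) = a * M u + M v) ->
  (forall u, S u -> `|M u| <= C * semi_norm B u) ->
  exists phi : nat -> V, [/\ forall k, W k (phi k),
    forall k psi, W k psi ->
      `|B (phi k) psi - M psi| <= k.+1%:R^-1 * semi_norm B psi
    & forall e, 0 < e -> exists K, forall j k, (K <= j)%N -> (K <= k)%N ->
       semi_norm B (phi j - phi k) < e].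
Proof.
move=> Wsub WS Wdec Mlin Mbnd; pose J u := B u u - 2 * M u.
have M0 : M 0 = 0.
  have S0 : S 0 by case: Ssub.
  have := Mlin 1 _ _ S0 S0; rewrite scale1r addr0 mul1r => /eqP.
  by rewrite -subr_eq subrr => /eqP <-.
(* |u|^2 - 2 C |u| = (|u| - C)^2 - C^2. *)
have Jlb u : S u -> - (C ^+ 2) <= J u.
  move=> Su; have := Mbnd u Su; rewrite /J -sqr_semi_norm//.
  move/(le_trans (ler_norm _)).
  by have := sqr_ge0 (semi_norm B u - C); rewrite sqrrB => H1 H2; nra.
pose A k := J @` W k.
have A0 k : A k !=set0 by have [W0 _] := Wsub k; exists (J 0), 0.
have Alb k : has_inf (A k).
  by split => //; exists (- (C ^+ 2)) => _ [u /WS Su <-]; exact: Jlb.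
have infle k u : W k u -> inf (A k) <= J u.
  by move=> Wu; apply: ge_inf; [exact: (Alb k).2|exists u].
have mono j k : (j <= k)%N -> W k `<=` W j.
  elim: k => [|k IH]; first by rewrite leqn0 => /eqP ->.
  rewrite leq_eqVlt => /orP[/eqP ->//|]; rewrite ltnS => /IH kj u /Wdec.
  exact: kj.
have infmono j k : (j <= k)%N -> inf (A j) <= inf (A k).
  move=> jk; apply: lb_le_inf => //_ [u Wu <-]; apply: infle.
  exact: mono jk _ Wu.
have eta0 k : 0 < (k.+1%:R^-1 : R) ^+ 2 by rewrite exprn_gt0// invr_gt0.
have /boolp.choice[phi Hphi] : forall k, exists u,
    W k u /\ J u < inf (A k) + k.+1%:R^-1 ^+ 2.
  move=> k; have [_ [u Wu <-] Ju] := inf_adherent (eta0 k) (Alb k).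
  by exists u.
have Jphi k : J (phi k) < inf (A k) + k.+1%:R^-1 ^+ 2 by have [] := Hphi k.
have Wphi k : W k (phi k) by have [] := Hphi k.
have Sphi k : S (phi k) by exact: WS (Wphi k).
exists phi; split => //.
  (* Moving from [phi k] along [psi] lowers [J] by less than (k+1)^-2, so [quadratic_bound] applies
     with d = 1/(k+1); this is why the error is a square. *)
  move=> k psi Wpsi; have Spsi := WS _ _ Wpsi.
  apply: quadratic_bound; rewrite ?semi_norm_ge0 ?invr_ge0// => t.
  have Wt : W k (t *: psi + phi k) by apply: (Wsub k).2.
  have := infle _ _ Wt; rewrite /J semi_innerDZ// Mlin//.
  have := Jphi k; rewrite /J sqr_semi_norm// (sym (Sphi k) Spsi).
  by move: (k.+1%:R^-1) (inf _) (B psi psi) (B psi (phi k)) (B (phi k) _) (M psi) (M (phi k)) => *; lra.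
(* The infima grow because the spaces shrink, and they are bounded by J 0 = 0. *)
have infcvg : cvgn (fun k => inf (A k)).
  apply: nondecreasing_is_cvgn; first by move=> j k; exact: infmono.
  exists 0 => _ [k _ <-]; rewrite (le_trans (infle k 0 _))//; last first.
    by rewrite /J -[X in B X _](scale0r 0) semi_innerZl ?mul0r ?M0 ?mulr0 ?subr0//;
      case: Ssub.
  by case: (Wsub k).
(* |a - b|^2 = 2 J a + 2 J b - 4 J ((a + b) / 2). As [phi k] also lies in [W j], the midpoint
   competes for the infimum over [W j]. *)
have par j k : (j <= k)%N -> B (phi j - phi k) (phi j - phi k) <=
    2 * (inf (A k) - inf (A j)) + 2 * (j.+1%:R^-1 ^+ 2 + k.+1%:R^-1 ^+ 2).
  move=> jk; have Wjk : W j (phi k) by exact: mono jk _ (Wphi k).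
  have Sm : S (phi j + phi k) by exact: subspaceD.
  have Wm : W j (2^-1 *: (phi j + phi k)).
    by apply: subspaceZ => //; exact: subspaceD.
  have := infle _ _ Wm; have := Jphi j; have := Jphi k.
  have MD : M (2^-1 *: (phi j + phi k)) = 2^-1 * (M (phi j) + M (phi k)).
    rewrite -[_ *: _]addr0 Mlin//; last by case: Ssub.
    by rewrite M0 addr0 -[X in M (X + _)]scale1r Mlin// mul1r.
  rewrite /J MD semi_innerZl//; last exact: subspaceZ.
  rewrite (sym Sm) ?semi_innerZl//; last exact: subspaceZ.
  have := semi_innerDZ 1 (Sphi j) (Sphi k); rewrite scale1r => ->.
  have := semi_innerDZ (-1) (Sphi k) (Sphi j); rewrite scaleN1r [- _ + _]addrC => ->.
  rewrite (sym (Sphi k) (Sphi j)).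
  move: (j.+1%:R^-1) (k.+1%:R^-1) (inf (A j)) (inf (A k)) (B (phi k) (phi k)) (B (phi j) (phi j)) (B (phi j) (phi k)) (M (phi j)) (M (phi k)) => *; lra.
have main e : 0 < e -> exists K, forall j k, (K <= j)%N -> (j <= k)%N ->
    semi_norm B (phi j - phi k) < e.
  (* Infima within e^2/8 of their limit contribute at most e^2/2 to [par], and so do squared errors
     below e^2/8. *)
  move=> e0; have e20 : 0 < e ^+ 2 / 8 by rewrite divr_gt0// exprn_gt0.
  have [K1 _ HK1] : \forall k \near \oo, `|limn (fun k => inf (A k)) - inf (A k)|
      < e ^+ 2 / 8 by have /cvgrPdist_lt := infcvg; apply.
  (* The minimum with 1 makes the square of 1/(k+1) no larger than 1/(k+1) itself. *)
  have [K2 _ HK2] : \forall k \near \oo, `|0 - harmonic k| < Num.min 1 (e ^+ 2 / 8) :> R.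
    have /cvgrPdist_lt := @cvg_harmonic R; apply.
    by rewrite lt_min ltr01 e20.
  have sq k : (K2 <= k)%N -> (k.+1%:R^-1 : R) ^+ 2 < e ^+ 2 / 8.
    move=> /HK2; rewrite /= sub0r normrN gtr0_norm ?invr_gt0// lt_min => /andP[h1 h2].
    apply: le_lt_trans h2; rewrite expr2 ler_piMr ?invr_ge0//; exact: ltW.
  exists (maxn K1 K2) => j k; rewrite geq_max => /andP[K1j K2j] jk.
  have K1k := leq_trans K1j jk; have K2k := leq_trans K2j jk.
  rewrite -ltr_sqr ?nnegrE ?semi_norm_ge0 ?(ltW e0)// sqr_semi_norm; last exact: subspaceB.
  apply: le_lt_trans (par j k jk) _.
  have := HK1 _ K1j; have := HK1 _ K1k; have := sq _ K2j; have := sq _ K2k.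
  rewrite /= !ltr_norml.
  move: (j.+1%:R^-1 ^+ 2) (k.+1%:R^-1 ^+ 2) (inf (A j)) (inf (A k)) (limn _).
  by move=> ? ? ? ? ? h1 h2 /andP[h3 h4] /andP[h5 h6]; lra.
move=> e /main[K HK]; exists K => j k Kj Kk.
have [jk|/ltnW kj] := leqP j k; first exact: HK.
by rewrite semi_norm_distC//; exact: HK.
Qed.

End theory.
End semi_inner_product.

(** * Square-integrable functions and the completeness of L^2 *)

Section square_integrable.
Context {d : measure_display} {T : measurableType d} {R : realType}.
Variable mu : {measure set T -> \bar R}.
Implicit Types f g h : T -> R.

Definition sqint : set (T -> R) := [set f | f \in Lfun mu 2%:E].

Definition ip f g : R := \int[mu]_x (f x * g x).

Lemma sqint_measurable f : sqint f -> measurable_fun [set: T] f.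
Proof. by rewrite /sqint/= inE => /andP[]; rewrite inE. Qed.

Lemma Lnorm2E f : measurable_fun [set: T] f ->
  'N[mu]_2%:E[EFin \o f]%E = ((\int[mu]_x (f x ^+ 2)%:E) `^ (2^-1))%E.
Proof.
move=> mf; rewrite unlock; congr (_ `^ _)%E; apply: eq_integral => x _ /=.
by rewrite powR_mulrn// real_normK// num_real.
Qed.

Lemma sqintP f : sqint f <-> measurable_fun [set: T] f /\
  mu.-integrable [set: T] (EFin \o (fun x => f x ^+ 2)).
Proof.
split=> [sf|[mf /integrableP[_ intf]]].
  by split; [exact: sqint_measurable|exact: Lfun2_integrable_sqr].
rewrite /sqint/= inE; apply/andP; split; rewrite inE//= /finite_norm Lnorm2E//.
rewrite poweR_lty//; apply: le_lt_trans intf.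
rewrite le_eqVlt; apply/orP; left; apply/eqP; apply: eq_integral => x _ /=.
by rewrite ger0_norm// sqr_ge0.
Qed.

Lemma sqint_integrableM f g : sqint f -> sqint g ->
  mu.-integrable [set: T] (EFin \o (fun x => f x * g x)).
Proof. by move=> sf sg; apply/Lfun1_integrable; exact: Lfun2_mul_Lfun1. Qed.

Lemma sqint_le f g : measurable_fun [set: T] f -> sqint g ->
  (forall x, `|f x| <= `|g x|) -> sqint f.
Proof.
move=> mf sg fg; apply/sqintP; split => //.
have [mg ig] := (sqintP g).1 sg; apply: le_integrable ig => //.
  by apply/measurable_EFinP; exact: measurable_funX.
by move=> x _ /=; rewrite lee_fin !normrX lerXn2r ?nnegrE.
Qed.

Lemma sqint_subspace : subspace sqint.
Proof.
have [L0 LD] := @Lfun_submod_closed _ T R mu 2%:E (lee1n 2).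
by split => // a u v; exact: LD.
Qed.

Lemma semi_inner_ip : semi_inner sqint ip.
Proof.
split; first exact: sqint_subspace.
- by move=> f g _ _; apply: eq_Rintegral => x _; rewrite mulrC.
- move=> a f g h sf sg sh; rewrite /ip -RintegralZl//; last exact: sqint_integrableM.
  rewrite -RintegralD//; first last.
  - exact: sqint_integrableM.
  - rewrite (_ : _ \o _ = (fun x => a%:E * (f x * h x)%:E)%E)//.
    by apply: integrableZl => //; exact: sqint_integrableM.
  by apply: eq_Rintegral => x _; rewrite /= mulrDl -mulrA.
- by move=> f _; apply: Rintegral_ge0 => x _; rewrite -expr2 sqr_ge0.
Qed.

Definition nrm2 : (T -> R) -> R := semi_norm ip.

Lemma nrm2_ge0 f : 0 <= nrm2 f. Proof. exact: semi_norm_ge0. Qed.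

Lemma EFin_nrm2 f : sqint f -> (nrm2 f ^+ 2)%:E = (\int[mu]_x (f x ^+ 2)%:E)%E.
Proof.
move=> sf; rewrite (sqr_semi_norm semi_inner_ip)//.
have [_ If] := (sqintP f).1 sf.
by rewrite /ip /Rintegral fineK//; exact: integrable_fin_num If.
Qed.

Lemma Lnorm2_nrm2 f : sqint f -> 'N[mu]_2%:E[EFin \o f]%E = (nrm2 f)%:E.
Proof.
move=> sf; rewrite Lnorm2E; last exact: sqint_measurable.
rewrite -EFin_nrm2// poweR_EFin -powR_mulrn ?nrm2_ge0// -powRrM.
by rewrite divff// powRr1// nrm2_ge0.
Qed.

Lemma le_nrm2 f g : measurable_fun [set: T] f -> sqint g ->
  (forall x, `|f x| <= `|g x|) -> nrm2 f <= nrm2 g.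
Proof.
move=> mf sg fg; have sf := sqint_le mf sg fg.
rewrite -ler_sqr ?nnegrE ?nrm2_ge0// -lee_fin !EFin_nrm2//.
apply: ge0_le_integral => //.
- by move=> x _; exact: sqr_ge0.
- by apply/measurable_EFinP; exact: measurable_funX.
- by apply/measurable_EFinP; apply: measurable_funX; exact: sqint_measurable.
- move=> x _; rewrite lee_fin.
  by rewrite -(real_normK (num_real (f x))) -(real_normK (num_real (g x))) lerXn2r ?nnegrE.
Qed.

Lemma nrm2_eq0 f : sqint f -> nrm2 f = 0 -> {ae mu, forall x, f x = 0}.
Proof.
move=> sf f0; have mf := sqint_measurable sf.
have : 'N[mu]_2%:E[EFin \o f]%E = 0%E by rewrite Lnorm2_nrm2// f0.
move/Lnorm_eq0_eq0 => /(_ _ (ltr0n _ 2)).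
have mEf : measurable_fun [set: T] (EFin \o f) by exact/measurable_EFinP.
by move=> /(_ mEf); apply: filterS => x /(_ I) [].
Qed.

Lemma ae_eq_ip f f' g g' : sqint f -> sqint f' -> sqint g -> sqint g' ->
  {ae mu, forall x, f x = f' x} -> {ae mu, forall x, g x = g' x} ->
  ip f g = ip f' g'.
Proof.
move=> sf sf' sg sg' ff' gg'; congr fine; apply: ae_eq_integral => //.
- by apply/measurable_EFinP; apply: measurable_funM; exact: sqint_measurable.
- by apply/measurable_EFinP; apply: measurable_funM; exact: sqint_measurable.
by apply: filterS2 ff' gg' => x /= -> -> _.
Qed.

Lemma ae_eq_nrm2 f g : sqint f -> sqint g -> {ae mu, forall x, f x = g x} ->
  nrm2 f = nrm2 g.
Proof. by move=> sf sg fg; rewrite /nrm2 /semi_norm (ae_eq_ip sf sg sf sg). Qed.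

(** The increments are at most sqrt(c) 2^-k, so the telescoping series is dominated by a geometric
    one. *)
Lemma is_cvg_sum_geometric (u : R^nat) (c : R) :
  (forall k, (4 ^+ k) * (u k.+1 - u k) ^+ 2 <= c) -> cvgn u.
Proof.
move=> uc; have c0 : 0 <= c by apply: le_trans (uc 0%N); rewrite mulr_ge0// ?sqr_ge0 ?exprn_ge0.
suff : cvgn (series (telescope u)).
  have uE : u = (fun n => u 0%N + series (telescope u) n).
    by apply/funext => n; exact: eq_sum_telescope.
  by move=> cu; rewrite uE; apply: is_cvgD => //; exact: is_cvg_cst.
apply: normed_cvg; apply: (@series_le_cvg _ _ (geometric (Num.sqrt c) 2^-1)).
- by move=> n; exact: normr_ge0.
- by move=> n; rewrite /= mulr_ge0 ?sqrtr_ge0// exprn_ge0// invr_ge0.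
- move=> n; rewrite /= /telescope/= exprVn ler_pdivlMr ?exprn_gt0//.
  rewrite -ler_sqr ?nnegrE ?mulr_ge0 ?sqrtr_ge0 ?exprn_ge0//.
  rewrite sqr_sqrtr// exprMn real_normK ?num_real// -exprM mulnC exprM mulrC.
  by rewrite -natrX; exact: uc.
- by apply: is_cvg_geometric_series; rewrite gtr0_norm ?invr_gt0// invf_lt1// ltr1n.
Qed.

(* Along a subsequence h with |h_(k+1) - h_k|^2 <= 8^-k the sum of
   4^k |h_(k+1) - h_k|^2 has a finite integral, so h converges a.e.; Fatou
   then gives the convergence in norm. *)
Lemma sqint_complete (f : nat -> T -> R) : (forall k, sqint (f k)) ->
  (forall e, 0 < e -> exists K, forall j k, (K <= j)%N -> (K <= k)%N ->
    nrm2 (f j - f k) < e) ->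
  exists2 g, sqint g & forall e, 0 < e -> exists K, forall k, (K <= k)%N ->
    nrm2 (f k - g) < e.
Proof.
move=> sf cauchy_f.
have sB u v : sqint u -> sqint v -> sqint (u - v).
  exact: subspaceB sqint_subspace.
have /boolp.choice[s0 Hs0] : forall k : nat, exists K, forall i j,
    (K <= i)%N -> (K <= j)%N -> nrm2 (f i - f j) < 8 ^- k.
  by move=> k; apply: cauchy_f; rewrite invr_gt0 exprn_gt0.
(* Partial sums of the thresholds are monotone and dominate [s0 k]; the successors make them
   dominate [k] too. *)
pose s k := (\sum_(i < k.+1) (s0 i).+1)%N.
have s0s k : (s0 k <= s k)%N by rewrite /s big_ord_recr/= (leq_trans (leqnSn _))// leq_addl.
have s_ge k : (k <= s k)%N.
  elim: k => // k IH; rewrite /s big_ord_recr/= -[X in (X < _)%N]addn0 -addnS.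
  exact: leq_add.
have smono j k : (j <= k)%N -> (s j <= s k)%N.
  move=> /subnK <-; elim: (k - j)%N => // n /leq_trans; apply; rewrite addSn.
  by rewrite {2}/s big_ord_recr/= leq_addr.
pose h k := f (s k); have sh k : sqint (h k) by exact: sf.
have mh k := sqint_measurable (sh k).
have hd k : nrm2 (h k.+1 - h k) < 8 ^- k.
  apply: Hs0; last exact: s0s.
  by rewrite (leq_trans (s0s k))// smono.
pose F k x := (4 ^+ k * (h k.+1 x - h k x) ^+ 2)%:E.
have F0 k x : (0 <= F k x)%E by rewrite lee_fin mulr_ge0 ?sqr_ge0 ?exprn_ge0.
have mF k : measurable_fun [set: T] (F k).
  apply/measurable_EFinP; apply: measurable_funM => //.
  by apply: measurable_funX; exact: measurable_funB.
pose S x := (\sum_(k <oo) F k x)%E.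
have mS : measurable_fun [set: T] S by exact: ge0_emeasurable_sum.
have IS : (\int[mu]_x S x < +oo)%E.
  rewrite integral_nneseries//.
  (* The k-th term is at most 4^k 8^-k = 2^-k, written here in the shape of
     [cvg_geometric_eseries_half]; the sum is 2. *)
  apply: (@le_lt_trans _ _ (\sum_(k <oo) (1 / (2 ^ (k + 1))%:R * 2)%:E)%E).
    apply: lee_nneseries => [k _ _|k _]; first exact: integral_ge0.
    under eq_integral do rewrite /F EFinM.
    rewrite ge0_integralZl_EFin ?exprn_ge0//; first last.
    - apply/measurable_EFinP; apply: measurable_funX; exact: measurable_funB.
    - by move=> x _; rewrite lee_fin sqr_ge0.
    have -> : (\int[mu]_x ((h k.+1 x - h k x) ^+ 2)%:E)%E = (nrm2 (h k.+1 - h k) ^+ 2)%:E.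
      by rewrite EFin_nrm2//; exact: sB.
    rewrite -EFinM lee_fin; have := hd k; have := nrm2_ge0 (h k.+1 - h k).
    move: (nrm2 _) => y y0 y8.
    have -> : 1 / (2 ^ (k + 1))%:R * 2 = 2 ^- k :> R.
      by rewrite addn1 expnS natrM natrX; field; rewrite expf_neq0.
    have y2 : y ^+ 2 <= 8 ^- k.
      rewrite expr2 (le_trans _ (ltW y8))// ler_piMr//.
      rewrite (le_trans (ltW y8))// invf_le1 ?exprn_gt0//.
      by rewrite exprn_ege1// ler1n.
    rewrite -ler_pdivlMl ?exprn_gt0// (le_trans y2)//.
    by rewrite -invfM -exprMn -natrM.
  have := @cvg_geometric_eseries_half R 2 0.
  rewrite expr0 divr1 => /cvg_lim; under eq_fun do rewrite addn1.
  move=> H; rewrite (_ : limn _ = 2%:E) ?ltry//.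
  rewrite -[RHS]H//; congr (limn _); apply/funext => n.
  by rewrite /eseries /=; apply: eq_bigr => i _; rewrite addn1 mul1r mulrC.
pose A := [set x | (S x < +oo)%E].
have mA : measurable A.
  by rewrite -[A]setTI; exact: measurable_lte.
have S0 x : (0 <= S x)%E by apply: nneseries_ge0.
have IntS : mu.-integrable [set: T] S.
  apply/integrableP; split => //; apply: le_lt_trans IS.
  by rewrite le_eqVlt; apply/orP; left; apply/eqP; apply: eq_integral => x _; rewrite gee0_abs.
have muA : mu (~` A) = 0%E.
  have : mu.-negligible (~` A).
    have := integrable_ae measurableT IntS.
    apply: negligibleS => x /= nA; apply: contra_not nA => /(_ I).
    by rewrite ge0_fin_numE.
  by move/negligibleP; apply; exact: measurableC.
have cvgA x : A x -> cvgn (h ^~ x).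
  move=> Ax; apply: (@is_cvg_sum_geometric _ (fine (S x))) => k.
  rewrite -lee_fin fineK ?ge0_fin_numE//.
  rewrite /S (nneseries_split 0 k.+1)// add0n big_nat_recr//= -addeA addeCA.
  by rewrite leeDl// adde_ge0//; [exact: sume_ge0|exact: nneseries_ge0].
(* The value 0 is taken outside [A], whose complement is null. *)
pose g := (fun x => limn (h ^~ x)) \_ A.
have mgA : measurable_fun A (fun x => limn (h ^~ x)).
  apply: (@measurable_fun_cvg _ _ _ _ h) => [m|x Ax]; first exact: measurable_funS (mh m).
  exact: cvgA.
have mg : measurable_fun [set: T] g.
  by apply/(measurable_restrictT _ mA).
have key e : 0 < e -> exists K, forall k, (K <= k)%N ->
    mu.-integrable [set: T] (EFin \o (fun x => (h k x - g x) ^+ 2)) /\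
    (\int[mu]_x ((h k x - g x) ^+ 2)%:E <= (e ^+ 2)%:E)%E.
  move=> e0; have [K HK] := cauchy_f e e0; exists K => k Kk.
  have mG : measurable_fun [set: T] (fun x => ((h k x - g x) ^+ 2)%:E).
    by apply/measurable_EFinP; apply: measurable_funX; exact: measurable_funB.
  have le_int : (\int[mu]_x ((h k x - g x) ^+ 2)%:E <= (e ^+ 2)%:E)%E.
    have -> : (\int[mu]_x ((h k x - g x) ^+ 2)%:E =
        \int[mu]_(x in A) ((h k x - g x) ^+ 2)%:E)%E.
      rewrite (ge0_negligible_integral _ _ _ _ muA)//; last 2 first.
      - exact: measurableC.
      - by move=> x _; rewrite lee_fin sqr_ge0.
      by rewrite setDE setCK setTI.
    have mFj j : measurable_fun A (fun x => ((h k x - h j x) ^+ 2)%:E).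
      apply/measurable_EFinP; apply: measurable_funX.
      by apply: measurable_funB; exact: measurable_funS (mh _).
    (* Fatou in j with k fixed: on [A] the integrands tend to (h k - g)^2, and their integrals are
       below e^2 once k and s j pass the Cauchy threshold [K]. *)
    have := @fatou _ _ _ mu A mA (fun j x => ((h k x - h j x) ^+ 2)%:E) mFj.
    move=> /(_ (fun n x _ => sqr_ge0 _)) fat.
    apply: (@le_trans _ _ (\int[mu]_(x in A) limn_einf (fun j => ((h k x - h j x) ^+ 2)%:E))%E).
      rewrite le_eqVlt; apply/orP; left; apply/eqP; apply: eq_integral => x.
      rewrite inE => Ax; have cv : (fun j => ((h k x - h j x) ^+ 2)%:E) @ \oo --> ((h k x - g x) ^+ 2)%:E.
        apply: cvg_EFin; first exact: nearW.
        rewrite /g patchE mem_set//; apply: (@cvg_comp _ _ _ _ (fun z => z ^+ 2)).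
          by apply: cvgB; [exact: cvg_cst|exact: cvgA].
        exact: exprn_continuous.
      rewrite is_cvg_limn_einfE; last by apply/cvg_ex; eexists; exact: cv.
      by rewrite (cvg_lim _ cv).
    apply: (le_trans fat).
    rewrite limn_einf_lim; apply: lime_le; first exact: is_cvg_einfs.
    near=> n; apply: (@le_trans _ _ (\int[mu]_(x in A) ((h k x - h n x) ^+ 2)%:E)%E).
      by apply: ereal_inf_lbound; exists n => /=.
    apply: (@le_trans _ _ (\int[mu]_x ((h k x - h n x) ^+ 2)%:E)%E).
      apply: ge0_subset_integral => //.
        by apply/measurable_EFinP; apply: measurable_funX; exact: measurable_funB.
      by move=> x _; rewrite lee_fin sqr_ge0.
    have := EFin_nrm2 (sB _ _ (sh k) (sh n)); rewrite /= => <-.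
    rewrite lee_fin ler_sqr ?nnegrE ?nrm2_ge0 ?(ltW e0)//; apply/ltW/HK.
      exact: leq_trans Kk (s_ge _).
    by apply: leq_trans (s_ge _); near: n; exact: nbhs_infty_ge.
  split => //; apply/integrableP; split => //.
  apply: le_lt_trans (ltry (e ^+ 2)); apply: le_trans le_int.
  rewrite le_eqVlt; apply/orP; left; apply/eqP; apply: eq_integral => x _ /=.
  by rewrite ger0_norm// sqr_ge0.
have [K1 HK1] := key 1 ltr01.
have shg k : (K1 <= k)%N -> sqint (h k - g).
  by move=> /HK1[Ig _]; apply/sqintP; split => //; exact: measurable_funB.
have sg : sqint g.
  by rewrite -[g](subKr (h K1)); apply: sB => //; exact: shg.
exists g => // e e0; have e20 : 0 < e / 2 by rewrite divr_gt0.
have [K2 HK2] := cauchy_f _ e20; have e40 : 0 < e / 4 by rewrite divr_gt0.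
have [K3 HK3] := key _ e40; exists K2 => k K2k; pose m := maxn K2 K3.
apply: le_lt_trans (semi_norm_triangle semi_inner_ip (sf k) sg (sh m)) _.
have h1 : nrm2 (f k - h m) < e / 2.
  by apply: HK2 => //; rewrite (leq_trans _ (s_ge m))// leq_maxl.
have h2 : nrm2 (h m - g) <= e / 4.
  rewrite -ler_sqr ?nnegrE ?nrm2_ge0 ?(ltW e40)// -lee_fin EFin_nrm2; last exact: sB.
  by apply: (HK3 m _).2; rewrite leq_maxr.
by move: h1 h2; rewrite /nrm2; lra.
Unshelve. all: by end_near. Qed.

End square_integrable.

(** * Rational boxes and the Borel sets of R^n *)

Section rV_topology.
Context {R : realType} {n : nat}.
Local Notation E := 'rV[R]_n.
Implicit Types (x y c : E) (e r M : R) (U : set E).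

Lemma ball_rV x e y : ball x e y <-> 0 < e /\ forall i, `|x ord0 i - y ord0 i| < e.
Proof.
split=> [[e0 H]|[e0 H]]; split => // i; first exact: (H ord0 i).
by move=> j; rewrite (ord1 i); exact: H.
Qed.

Lemma continuous_rV (T : topologicalType) (F : T -> E) :
  (forall i, continuous (fun t => F t ord0 i)) -> continuous F.
Proof.
move=> cF t; apply/cvg_ballP => e e0.
have : \forall s \near t, forall i : 'I_n, `|F t ord0 i - F s ord0 i| < e.
  apply: (@filter_forall _ _ (fun i s => `|F t ord0 i - F s ord0 i| < e)) => i.
  by have /cvgrPdist_lt := cF i t; apply.
by apply: filterS => s H; apply/ball_rV.
Qed.

Definition box c r : set E := [set x | forall i, `|c ord0 i - x ord0 i| < r].

Lemma measurable_cylinder (A : 'I_n -> set (measurableTypeR R)) :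
  (forall i, measurable (A i)) -> measurable [set x : E | forall i, A i (x ord0 i)].
Proof.
move=> mA; rewrite (_ : mkset _ = \big[setI/setT]_(i < n) (rV_coord i @^-1` A i)).
  apply: bigsetI_measurable => i _; rewrite -[X in measurable X]setTI.
  exact: measurable_rV_coord.
rewrite -bigcap_seq; apply/seteqP; split=> [x Ax i _|x Ax i]; first exact: Ax.
by apply: Ax; rewrite /= mem_index_enum.
Qed.

Lemma measurable_box c r : measurable (box c r).
Proof.
rewrite (_ : box c r = [set x | forall i, `]c ord0 i - r, c ord0 i + r[%classic (x ord0 i)]).
  by apply: (@measurable_cylinder (fun i => `]c ord0 i - r, c ord0 i + r[%classic)) => i;
    exact: measurable_itv.
by apply/seteqP; split => x H i; have := H i; rewrite /= in_itv/= ltr_distlC.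
Qed.

(** Indexing by a countable type serves twice: to make open sets measurable, and to collect
    countably many null sets in the fundamental lemma. The closed version provides compact
    supports. *)
Definition rat_box (p : 'rV[rat]_n * nat) : set E :=
  box (\row_i ratr (p.1 ord0 i)) p.2.+1%:R^-1.

Definition closed_rat_box (p : 'rV[rat]_n * nat) : set E :=
  [set x | forall i, `|ratr (p.1 ord0 i) - x ord0 i| <= p.2.+1%:R^-1].

Lemma rat_box_closed p : rat_box p `<=` closed_rat_box p.
Proof. by move=> x px i; have := px i; rewrite mxE => /ltW. Qed.

Lemma open_rat_box U x : open U -> U x ->
  exists2 p, rat_box p x & closed_rat_box p `<=` U.
Proof.
move=> oU Ux; have /nbhs_ballP[e e0 eU] : nbhs x U by exact: open_nbhs_nbhs.
(* Two points of the closed box are each within the radius of its centre, hence half of [e]. *)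
have [k ke] : exists k : nat, k.+1%:R^-1 < e / 2.
  have e20 : 0 < e / 2 by rewrite divr_gt0.
  by have [k _ Hk] := near_infty_natSinv_lt (PosNum e20); exists k; apply: (Hk k) => /=.
have k0 : 0 < k.+1%:R^-1 :> R by rewrite invr_gt0.
have /boolp.choice[q Hq] : forall i, exists q : rat, `|ratr q - x ord0 i| < k.+1%:R^-1.
  move=> i; have : x ord0 i - k.+1%:R^-1 < x ord0 i + k.+1%:R^-1.
    by rewrite ltrD2l (lt_trans _ k0)// oppr_lt0.
  by move=> /rat_in_itvoo[q]; rewrite in_itv/= -ltr_distlC distrC; exists q.
exists (\row_i q i, k) => [i|y Hy]; first by rewrite !mxE.
apply/eU/ball_rV; split => // i; have := Hy i; have := Hq i; rewrite !mxE /=.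
move: (ratr _) k.+1%:R^-1 ke => a b ke; rewrite ltr_norml ler_norml ltr_norml.
by move=> /andP[? ?] /andP[? ?]; apply/andP; split; lra.
Qed.

Lemma open_bigcup_rat_box U : open U ->
  U = \bigcup_(p in [set p | closed_rat_box p `<=` U]) rat_box p.
Proof.
move=> oU; apply/seteqP; split=> [x Ux|x [p pU /rat_box_closed]]; last exact: pU.
by have [p px pU] := open_rat_box oU Ux; exists p.
Qed.

(** The sigma-algebra is generated by the coordinates and the topology comes from the norm; second
    countability reconciles them. *)
Lemma open_measurable_rV U : open U -> measurable U.
Proof.
move=> oU; rewrite (open_bigcup_rat_box oU) bigcup_mkcond.
apply: countable_bigcupT_measurable => [|p]; first exact: countableP.
by case: ifP => // _; exact: measurable_box.
Qed.

Lemma continuous_measurable_rV (f : E -> R) : continuous f ->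
  measurable_fun [set: E] f.
Proof.
move=> /continuousP cf; apply: (measurability _ (RGenOpens.measurableE R)) => //.
move=> _ [_ [a [b ->] <-]]; rewrite setTI; apply: open_measurable_rV.
exact/cf/interval_open.
Qed.

Lemma norm_coord_le x i : `|x ord0 i| <= `|x|.
Proof.
rewrite [leRHS]/Num.norm/= mx_normrE.
exact: (le_bigmax _ (fun ij => `|x ij.1 ij.2|) (ord0, i)).
Qed.

End rV_topology.

(** * Integrability of bounded functions carried by a box *)

Section rV_measure.
Context {R : realType} {n : nat}.
Local Notation E := 'rV[R]_n.
Local Notation mu := (lebesgue_rV n : {sigma_finite_measure set E -> \bar R}).

Lemma box_lty (c : E) r : (mu (box c r) < +oo)%E.
Proof.
rewrite (_ : box c r = [set x | forall i, `]c ord0 i - r, c ord0 i + r[%classic (x ord0 i)]); last first.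
  by apply/seteqP; split => x H i; have := H i; rewrite /= in_itv/= ltr_distlC.
rewrite (@lebesgue_rV_box _ _ (fun i => `]c ord0 i - r, c ord0 i + r[%classic)); last first.
  by move=> i; exact: measurable_itv.
suff /andP[] : (0 <= \prod_(i < n) lebesgue_measure (`](c ord0 i - r)%R, (c ord0 i + r)%R[%classic : set R) < +oo)%E by [].
apply: (big_ind (fun z => (0 <= z < +oo)%E)) => [|x y /andP[x0 xy] /andP[y0 yy]|i _].
- by rewrite lee01 ltry.
- by rewrite mule_ge0//= lte_mul_pinfty// ge0_fin_numE.
- by rewrite measure_ge0/= lebesgue_measure_itv/=; case: ifP => _; rewrite ?ltry// -EFinB ltry.
Qed.

Lemma integrable_box (f : E -> R) M C : measurable_fun [set: E] f ->
  (forall x, `|f x| <= C) -> (forall x, ~ box 0 M x -> f x = 0) ->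
  mu.-integrable [set: E] (EFin \o f).
Proof.
move=> mf fC f0; have mB := measurable_box (0 : E) M.
have Ic : mu.-integrable [set: E] (EFin \o ((cst C : E -> R) \_ (box 0 M))).
  rewrite -restrict_EFin -integrable_mkcond//.
  apply/integrableP; split; first exact/measurable_EFinP.
  by rewrite (eq_integral (cst `|C|%:E))// integral_cst// lte_mul_pinfty// box_lty.
apply: le_integrable Ic => //; first exact/measurable_EFinP.
move=> x _ /=; rewrite lee_fin patchE; case: ifPn => [_|].
  by rewrite (le_trans (fC x))// ler_norm.
by rewrite notin_setE => /f0 ->; rewrite !normr0.
Qed.

Lemma sqint_box (f : E -> R) M C : measurable_fun [set: E] f ->
  (forall x, `|f x| <= C) -> (forall x, ~ box 0 M x -> f x = 0) -> sqint mu f.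
Proof.
move=> mf fC f0; apply/sqintP; split => //; apply: (@integrable_box _ M (C ^+ 2)).
- exact: measurable_funX.
- move=> x; rewrite normrX lerXn2r ?nnegrE//; exact: le_trans (fC x).
- by move=> x /f0 ->; rewrite expr0n.
Qed.

Lemma bounded_set_box (A : set E) : bounded_set A -> exists2 M, 0 < M & A `<=` box 0 M.
Proof.
move=> /ex_strict_bound_gt0 [M M0 AM]; exists M => // x Ax i; rewrite mxE sub0r normrN.
by apply: le_lt_trans (norm_coord_le x i) _; exact: AM.
Qed.

Lemma continuous_bounded_box (f : E -> R) M : continuous f ->
  (forall x, ~ box 0 M x -> f x = 0) -> exists2 C, 0 <= C & forall x, `|f x| <= C.
Proof.
move=> cf f0; pose K : set E := [set x | forall i, `[- M, M]%classic (x ord0 i)].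
have cK : compact K by apply: (@rV_compact _ _ (fun=> `[- M, M]%classic)) => i; exact: segment_compact.
have : bounded_set (f @` K).
  by apply: compact_bounded; apply: continuous_compact => //; exact: continuous_subspaceT.
move=> /ex_strict_bound_gt0[C C0 HC]; exists C; first exact: ltW.
move=> x; have [/HC/ltW|nK] := pselect ((f @` K) (f x)); first exact.
rewrite f0 ?normr0 ?ltW// => Bx; apply: nK; exists x => // i.
by have := Bx i; rewrite /= in_itv/= mxE sub0r normrN => /ltW; rewrite ler_norml.
Qed.

End rV_measure.

(** * Splitting off the first coordinate *)

Section slices.
Context {R : realType} {n : nat}.

Lemma integrable_cons_rV (f : 'rV[R]_n.+1 -> \bar R) :
  (lebesgue_rV n.+1).-integrable [set: _] f ->
  (@lebesgue_measure R \x lebesgue_rV n)%E.-integrable [set: _] (f \o @cons_rV R n).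
Proof.
move=> /integrableP[mf intf]; have mc := @measurable_cons_rV R n.
apply/integrableP; split; first exact: measurableT_comp.
move: intf; rewrite /= /cons_measure ge0_integral_pushforward//.
by apply: measurableT_comp.
Qed.

Lemma integral_cons_rV (f : 'rV[R]_n.+1 -> \bar R) :
  (lebesgue_rV n.+1).-integrable [set: _] f ->
  (\int[lebesgue_rV n.+1]_x f x =
   \int[@lebesgue_measure R \x lebesgue_rV n]_p f (cons_rV p))%E.
Proof.
move=> intf; have [mf _] := integrableP _ _ _ intf.
rewrite /= /cons_measure integral_pushforward//.
- exact: measurable_cons_rV.
- exact: integrable_cons_rV.
Qed.

Lemma cons_rV_scale0 (y : 'rV[R]_n) (s a : R) :
  s *: delta_mx ord0 ord0 + cons_rV (a, y) = cons_rV (s + a, y).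
Proof.
apply/rowP => i; rewrite [LHS]mxE [X in X + _]mxE [X in _ * X + _]mxE eqxx/=.
have [j ->|->] := unliftP ord0 i; first by rewrite !cons_rVS/= mulr0 add0r.
by rewrite !cons_rV0/= mulr1.
Qed.

Lemma cons_rV_scaleS (y : 'rV[R]_n) (s a : R) i :
  s *: delta_mx ord0 (lift ord0 i) + cons_rV (a, y) =
  cons_rV (a, s *: delta_mx ord0 i + y).
Proof.
apply/rowP => k; rewrite [LHS]mxE [X in X + _]mxE [X in _ * X + _]mxE eqxx/=.
have [j ->|->] := unliftP ord0 k; last by rewrite !cons_rV0/= mulr0 add0r.
by rewrite !cons_rVS/= !mxE (inj_eq lift_inj).
Qed.

Lemma continuous_cons_rV0 (y : 'rV[R]_n) : continuous (fun a : R => cons_rV (a, y)).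
Proof.
apply: continuous_rV => i; have [j ->|->] := unliftP ord0 i.
  rewrite (_ : (fun _ => _) = cst (y ord0 j)); first by move=> a; exact: cvg_cst.
  by apply/funext => a; rewrite cons_rVS.
rewrite (_ : (fun _ => _) = id); first by move=> a; exact: cvg_id.
by apply/funext => a; rewrite cons_rV0.
Qed.

Lemma continuous_cons_rVS (a : R) : continuous (fun y : 'rV[R]_n => cons_rV (a, y)).
Proof.
apply: continuous_rV => i; have [j ->|->] := unliftP ord0 i.
  rewrite (_ : (fun _ => _) = (fun y : 'rV[R]_n => y ord0 j)).
    exact: coord_continuous.
  by apply/funext => y; rewrite cons_rVS.
rewrite (_ : (fun _ => _) = cst a); first exact: cst_continuous.
by apply/funext => y; rewrite cons_rV0.
Qed.

(** The two difference quotients are the same function of the increment, so both derivability and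
    the value transfer. *)
Lemma derive_cons_rV0 (f : 'rV[R]_n.+1 -> R) (a : R) y :
  (derivable f (cons_rV (a, y)) (delta_mx ord0 ord0) ->
   derivable (fun a => f (cons_rV (a, y)) : R) a 1) /\
  'D_1 (fun a => f (cons_rV (a, y)) : R) a = partial ord0 f (cons_rV (a, y)).
Proof.
rewrite /derivable /partial /derive.
have -> : (fun h : R => h^-1 *: ((f \o shift (cons_rV (a, y))) (h *: delta_mx ord0 ord0) - f (cons_rV (a, y)))) =
   (fun h : R => h^-1 *: (((fun a => f (cons_rV (a, y)) : R) \o shift a) (h *: 1) - f (cons_rV (a, y)))).
  apply/funext => h; have E : h *: (1 : R) = h by exact: mulr1.
  by rewrite /= E cons_rV_scale0.
by split.
Qed.

Lemma derive_cons_rVS (f : 'rV[R]_n.+1 -> R) (a : R) y i :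
  (derivable f (cons_rV (a, y)) (delta_mx ord0 (lift ord0 i)) ->
   derivable (fun y => f (cons_rV (a, y)) : R) y (delta_mx ord0 i)) /\
  partial i (fun y => f (cons_rV (a, y)) : R) y = partial (lift ord0 i) f (cons_rV (a, y)).
Proof.
rewrite /derivable /partial /derive.
have -> : (fun h : R => h^-1 *: ((f \o shift (cons_rV (a, y))) (h *: delta_mx ord0 (lift ord0 i)) - f (cons_rV (a, y)))) =
   (fun h : R => h^-1 *: (((fun y => f (cons_rV (a, y)) : R) \o shift y) (h *: delta_mx ord0 i) - f (cons_rV (a, y)))).
  by apply/funext => h /=; rewrite cons_rV_scaleS.
by split.
Qed.

End slices.

(** * Partial derivatives of compactly supported functions have integral 0 *)

Section divergence.
Context {R : realType}.

Lemma integral_derive0 (g : R -> R) (M : R) : (forall t, derivable g t 1) ->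
  continuous ('D_1 g) -> (forall t, M <= `|t| -> g t = 0) ->
  (forall t, M <= `|t| -> 'D_1 g t = 0) ->
  (\int[@lebesgue_measure R]_t ('D_1 g t)%:E = 0)%E.
Proof.
(* [M] may be negative; this [L] is positive and at least [M], so [g] vanishes at both ends of a
   nondegenerate interval. *)
move=> dg cg g0 dg0; pose L := `|M| + 1.
have ML : M <= L by rewrite /L (le_trans (ler_norm _))// lerDl.
have L0 : 0 < L by rewrite /L ltr_wpDl.
have cvg_g : continuous g by move=> t; apply: differentiable_continuous; exact/derivable1_diffP.
transitivity (\int[@lebesgue_measure R]_(t in `[(- L)%R, L]) ('D_1 g t)%:E)%E.
  rewrite [RHS]integral_mkcond; apply: eq_integral => t _; rewrite patchE.
  case: ifPn => //; rewrite notin_setE/= in_itv/= => /negP tL; rewrite dg0//.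
  by apply: (le_trans ML); rewrite leNgt; apply: contra tL => /ltW; rewrite ler_norml.
rewrite (@continuous_FTC2 _ _ g).
- rewrite !g0 ?subee// ?normrN; apply: (le_trans ML); exact: ler_norm.
- by rewrite (lt_trans _ L0)// oppr_lt0.
- exact: continuous_subspaceT.
- split => [t _||]; first exact: dg.
  + by apply: cvg_at_right_filter; exact: cvg_g.
  + by apply: cvg_at_left_filter; exact: cvg_g.
- by move=> t _; rewrite derive1E.
Qed.

(** Induction on the dimension through Fubini. For the first coordinate the inner integral is
    one-dimensional and vanishes by the fundamental theorem of calculus; for another one the first
    coordinate is frozen and the induction hypothesis applies to the slice. *)
Lemma integral_partial0 n (i : 'I_n) (f : 'rV[R]_n -> R) (M : R) :
  (forall x, derivable f x (delta_mx ord0 i)) -> continuous (partial i f) ->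
  (forall x, ~ box 0 M x -> f x = 0) ->
  (forall x, ~ box 0 M x -> partial i f x = 0) ->
  (\int[lebesgue_rV n]_x (partial i f x)%:E = 0)%E.
Proof.
elim: n i f => [[]//|n IH] i f df cf f0 pf0.
have Ip : (lebesgue_rV n.+1).-integrable [set: _] (EFin \o partial i f).
  have [C _ HC] := continuous_bounded_box cf pf0.
  apply: (@integrable_box _ _ _ M C) => //; exact: continuous_measurable_rV.
rewrite (integral_cons_rV Ip); have Ip2 := integrable_cons_rV Ip.
have [j ij|i0] := unliftP ord0 i; last first.
  rewrite -integral21_prod_meas1// -[RHS](integral0 (lebesgue_rV n) setT).
  apply: eq_integral => y _; rewrite /fubini_G/=.
  pose g : R -> R := fun a => f (cons_rV (a, y)).
  have gE a : 'D_1 g a = partial i f (cons_rV (a, y)).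
    by rewrite i0; exact: (derive_cons_rV0 _ _ _).2.
  have out (a : R) : M <= `|a| -> ~ box 0 M (cons_rV (a, y)).
    move=> Ma /(_ ord0); rewrite mxE sub0r normrN cons_rV0/=.
    by rewrite ltNge Ma.
  transitivity (\int[@lebesgue_measure R]_t ('D_1 g t)%:E)%E.
    by apply: eq_integral => a _; rewrite gE.
  apply: (@integral_derive0 g M).
  - by move=> a; apply: (derive_cons_rV0 _ _ _).1; rewrite -i0.
  - rewrite (_ : 'D_1 g = partial i f \o (fun a => cons_rV (a, y))); last exact/funext.
    by move=> a; apply: continuous_comp; [exact: continuous_cons_rV0|exact: cf].
  - by move=> t /out /f0.
  - by move=> t /out /pf0; rewrite gE.
rewrite -integral12_prod_meas1// -[RHS](integral0 (@lebesgue_measure R) setT).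
apply: eq_integral => a _; rewrite /fubini_F/=.
pose g : 'rV[R]_n -> R := fun y => f (cons_rV (a, y)).
have gE y : partial j g y = partial i f (cons_rV (a, y)).
  by rewrite ij; exact: (derive_cons_rVS _ _ _ _).2.
have out y : ~ box 0 M y -> ~ box 0 M (cons_rV (a, y)).
  apply: contra_not => H k; have := H (lift ord0 k).
  by rewrite cons_rVS [X in X - _]mxE [X in _ -> `|X - _| < _]mxE.
transitivity (\int[lebesgue_rV n]_t (partial j g t)%:E)%E.
  by apply: eq_integral => y _; rewrite gE.
apply: IH.
- by move=> y; apply: (derive_cons_rVS _ _ _ _).1; rewrite -ij.
- rewrite (_ : partial j g = partial i f \o (fun y => cons_rV (a, y))); last exact/funext.
  by move=> y; apply: continuous_comp; [exact: continuous_cons_rVS|exact: cf].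
- by move=> y /out /f0.
- by move=> y /out /pf0; rewrite gE.
Qed.

End divergence.

(** * The function exp(-1/t) and its derivatives *)

Section flat_function.
Context {R : realType}.
Implicit Types (p : {poly R}) (t s : R).

Lemma is_derive_comp1 (f g : R -> R) t (df dg : R) :
  is_derive t 1 g dg -> is_derive (g t) 1 f df ->
  is_derive t 1 (f \o g) (df * dg).
Proof.
move=> [dg1 <-] [df1 <-]; apply: DeriveDef.
  apply/derivable1_diffP; apply: (@differentiable_comp _ _ _ _ g f t).
    exact: (derivable1_diffP _ _).1 dg1.
  exact: (derivable1_diffP _ _).1 df1.
by rewrite -derive1E (derive1_comp dg1 df1) !derive1E.
Qed.

(* p(1/t) exp(-1/t) for t > 0, extended by 0; this class of functions is stable
   under derivation, which makes exp(-1/t) smooth. *)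
Definition flat p t : R := if 0 < t then p.[t^-1] * expR (- t^-1) else 0.

(** With s = 1/t, exp(s) >= s^(i+1) / (i+1)! gives s^i exp(-s) <= (i+1)! t. A bound linear in t is
    what the derivative at 0 requires. *)
Lemma flat_bound p : exists2 C, 0 <= C & forall t, `|flat p t| <= C * `|t|.
Proof.
exists (\sum_(i < size p) `|p`_i| * i.+1`!%:R).
  by apply: sumr_ge0 => i _; rewrite mulr_ge0.
move=> t; rewrite /flat; case: ifPn => [t0|_]; last first.
  by rewrite normr0 mulr_ge0// sumr_ge0// => i _; rewrite mulr_ge0.
rewrite horner_coef normrM (gtr0_norm t0) (ger0_norm (expR_ge0 _)).
apply: (@le_trans _ _ ((\sum_(i < size p) `|p`_i| * t^-1 ^+ i) * expR (- t^-1))).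
  rewrite ler_wpM2r ?expR_ge0// (le_trans (ler_norm_sum _ _ _))// ler_sum// => i _.
  by rewrite normrM normrX (@gtr0_norm _ t^-1) ?invr_gt0.
rewrite !mulr_suml; apply: ler_sum => i _; rewrite -!mulrA ler_wpM2l//.
have si : 0 <= t^-1 by rewrite invr_ge0 ltW.
have := expR_ge1Dxn i si; rewrite expRN => h.
have f0 : 0 < i.+1`!%:R :> R by rewrite ltr0n fact_gt0.
rewrite ler_pdivrMr ?expR_gt0// mulrAC.
have -> : t^-1 ^+ i = t^-1 ^+ i.+1 * t by rewrite exprSr mulrVK// unitfE gt_eqF.
rewrite ler_wpM2r ?(ltW t0)// -ler_pdivrMl// mulrC.
by apply: le_trans h; rewrite lerDr.
Qed.

(** For t > 0 the inner derivatives produce the factor t^-2, hence ['X^2]. At 0 the difference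
    quotient of [flat p] is [flat ('X * p)], which tends to 0 by [flat_bound]. *)
Lemma is_derive_flat p t : is_derive t 1 (flat p) (flat ('X^2 * (p - p^`())) t).
Proof.
have [t0|t0|->] := ltgtP t 0.
- have -> : flat ('X^2 * (p - p^`())) t = 0 by rewrite /flat ltNge (ltW t0).
  apply: (near_eq_is_derive (f := cst 0)) => //.
  near=> s; have s0 : s < 0 by near: s; exact: lt_nbhsl.
  by rewrite /flat /cst ltNge (ltW s0).
- have tn0 : t != 0 by rewrite gt_eqF.
  have dV : is_derive t 1 (fun s : R => s^-1) (- t ^- 2).
    apply: DeriveDef; first exact: derivableV.
    by rewrite (@deriveV _ _ id)// derive_id /GRing.scale/= mulr1.
  have dN : is_derive t 1 (fun s : R => - s^-1) (t ^- 2).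
    by apply: is_derive_eq (is_deriveN dV) _; rewrite opprK.
  have d1 := is_derive_comp1 dV (is_derive_poly p t^-1).
  have d2 := is_derive_comp1 dN (is_derive_expR (- t^-1)).
  have d3 := is_deriveM d1 d2.
  apply: (near_eq_is_derive _ (is_derive_eq d3 _)).
    near=> s; have s0 : 0 < s by near: s; exact: lt_nbhsr.
    by rewrite /flat s0.
  rewrite /flat t0 /GRing.scale/= !hornerE/=.
  by rewrite exprVn; ring.
have -> : flat ('X^2 * (p - p^`())) 0 = 0 by rewrite /flat ltxx.
have H : (fun h : R => h^-1 *: ((flat p \o shift 0) (h *: 1) - flat p 0)) @ 0^' --> (0 : R).
  have [C C0 HC] := flat_bound ('X * p).
  apply/cvgrPdist_le => e e0; near=> h; rewrite sub0r normrN.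
  have h0 : h != 0 by near: h; exact: nbhs_dnbhs_neq.
  have -> : h^-1 *: ((flat p \o shift 0) (h *: 1) - flat p 0) = flat ('X * p) h.
    have E : h *: (1 : R) = h by exact: mulr1.
    rewrite /= E addr0 /flat ltxx subr0; case: ifP => _; last exact: mulr0.
    by rewrite hornerM hornerX -mulrA.
  apply: le_trans (HC h) _.
  have hC : `|h| < e / (C + 1).
    near: h; apply: dnbhs0_lt; rewrite divr_gt0// ltr_wpDl//.
  have C1 : 0 < C + 1 by rewrite ltr_wpDl.
  rewrite (@le_trans _ _ ((C + 1) * `|h|))//; first by rewrite ler_wpM2r// lerDl.
  by rewrite -ler_pdivlMl// mulrC ltW.
by apply: DeriveDef; [apply/cvg_ex; exists 0|exact: cvg_lim H].
Unshelve. all: by end_near. Qed.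

Lemma flat1E t : flat 1 t = if 0 < t then expR (- t^-1) else 0.
Proof. by rewrite /flat hornerE mul1r. Qed.

Lemma flat1_gt0 t : (0 < flat 1 t) = (0 < t).
Proof. by rewrite flat1E; case: ifP; rewrite ?expR_gt0 ?ltxx. Qed.

Lemma flat1_ge0 t : 0 <= flat 1 t.
Proof. by rewrite flat1E; case: ifP; rewrite ?expR_ge0. Qed.

Lemma flat1_le1 t : flat 1 t <= 1.
Proof.
by rewrite flat1E; case: ifP => // t0; rewrite expR_le1 oppr_le0 invr_ge0 ltW.
Qed.

(** Smooth approximation of the indicator of the positive half-line; with the bound by 1 it allows
    dominated convergence onto half-spaces. *)
Lemma flat1_cvg t : flat 1 (k.+1%:R * t) @[k --> \oo] --> (if 0 < t then 1 else 0 : R).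
Proof.
have [t0|t0] := ltP 0 t; last first.
  rewrite (_ : (fun k : nat => _) = cst 0); first exact: cvg_cst.
  by apply/funext => k; rewrite flat1E ltNge mulr_ge0_le0.
rewrite (_ : (fun k : nat => _) = (fun k => expR (- (t^-1 * harmonic k)))); last first.
  by apply/funext => k; rewrite flat1E pmulr_rgt0// t0 invfM mulrC.
rewrite -expR0 -oppr0 -(mulr0 t^-1).
apply: (@cvg_comp _ _ _ _ expR); last exact: continuous_expR.
apply: cvgN; apply: cvgMr; exact: cvg_harmonic.
Qed.

End flat_function.

(** * Closure properties of smooth functions *)

Section smooth.
Context {R : realType} {n : nat}.
Local Notation E := 'rV[R]_n.
Implicit Types (f g phi psi : E -> R) (x : E) (i k : 'I_n) (m : nat).

(** Peels off the innermost derivative, so that the sum and product rules propagate by induction on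
    the order; [smooth] applies derivatives on the outside instead. *)
Fixpoint Ck m f : Prop :=
  if m is m'.+1 then continuous f /\
    forall i, (forall x, derivable f x (delta_mx ord0 i)) /\ Ck m' (partial i f)
  else continuous f.

Lemma partials_rcons s i f : partials (rcons s i) f = partials s (partial i f).
Proof. by rewrite /partials foldr_rcons. Qed.

Lemma smooth_partial i f : smooth f -> smooth (partial i f).
Proof. by move=> sf s; rewrite -partials_rcons; exact: sf. Qed.

Lemma smooth_continuous f : smooth f -> continuous f.
Proof. by move=> sf; have [] := sf [::]. Qed.

Lemma smooth_derivable f x i : smooth f -> derivable f x (delta_mx ord0 i).
Proof. by move=> sf; have [_] := sf [::]; exact. Qed.

Lemma smoothP f : smooth f <-> forall m, Ck m f.
Proof.
split=> [sf m|].
  elim: m f sf => [|m IH] f sf /=; first exact: smooth_continuous.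
  split=> [|i]; first exact: smooth_continuous.
  split=> [x|]; first exact: smooth_derivable.
  by apply: IH; exact: smooth_partial.
move=> + s; elim/last_ind: s f => [|s i IH] f Cf.
  by split=> [|i x]; [exact: (Cf 0%N)|exact: ((Cf 1%N).2 i).1].
by rewrite partials_rcons; apply: IH => m; exact: ((Cf m.+1).2 i).2.
Qed.

Lemma CkS m f : Ck m.+1 f -> Ck m f.
Proof.
elim: m f => [|m IH] f; first by case.
by move=> [cf df]; split=> // i; have [? /IH] := df i.
Qed.

Lemma continuous_add f g : continuous f -> continuous g -> continuous (f + g).
Proof. by move=> cf cg x; exact: (cvgD (cf x) (cg x)). Qed.

Lemma continuous_mul f g : continuous f -> continuous g -> continuous (f * g).
Proof. by move=> cf cg x; exact: (cvgM (cf x) (cg x)). Qed.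

Lemma continuous_scale (a : R) f : continuous f -> continuous (a *: f).
Proof. by move=> cf x; exact: (cvgM (cvg_cst a) (cf x)). Qed.

Lemma CkD m f g : Ck m f -> Ck m g -> Ck m (f + g).
Proof.
elim: m f g => [|m IH] f g /=; first exact: continuous_add.
move=> [cf df] [cg dg]; split=> [|i]; first exact: continuous_add.
have [[df1 df2] [dg1 dg2]] := (df i, dg i); split=> [x|]; first exact: derivableD.
rewrite (_ : partial i _ = partial i f + partial i g); first exact: IH.
by apply/funext => x; rewrite /partial deriveD.
Qed.

Lemma CkZ m (a : R) f : Ck m f -> Ck m (a *: f).
Proof.
elim: m f => [|m IH] f /=; first exact: continuous_scale.
move=> [cf df]; split=> [|i]; first exact: continuous_scale.
have [df1 df2] := df i; split=> [x|]; first exact: derivableZ.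
rewrite (_ : partial i _ = a *: partial i f); first exact: IH.
by apply/funext => x; rewrite /partial deriveZ.
Qed.

Lemma partialM f g i x : derivable f x (delta_mx ord0 i) ->
  derivable g x (delta_mx ord0 i) ->
  partial i (f * g) x = f x * partial i g x + g x * partial i f x.
Proof. by move=> df dg; exact: (deriveM df dg). Qed.

Lemma CkM m f g : Ck m f -> Ck m g -> Ck m (f * g).
Proof.
elim: m f g => [|m IH] f g; first exact: continuous_mul.
move=> Cf Cg; have [cf df] := Cf; have [cg dg] := Cg.
split=> [|i]; first exact: continuous_mul.
have [[df1 df2] [dg1 dg2]] := (df i, dg i); split=> [x|]; first exact: derivableM.
rewrite (_ : partial i _ = f * partial i g + g * partial i f).
  by apply: CkD; apply: IH => //; exact: CkS.
by apply/funext => x; rewrite partialM.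
Qed.

Lemma Ck_cst m (a : R) : Ck m (cst a : E -> R).
Proof.
elim: m a => [|m IH] a; first exact: cst_continuous.
split=> [|i]; first exact: cst_continuous.
split=> [x|]; first exact: derivable_cst.
rewrite (_ : partial i _ = cst 0); first exact: IH.
by apply/funext => x; rewrite /partial derive_cst.
Qed.

Lemma is_derive_line f x (v : E) (l : R) :
  is_derive (0 : R) 1 (fun s : R => f (s *: v + x)) l -> is_derive x v f l.
Proof.
have E : (fun h : R => h^-1 *: (((fun s : R => f (s *: v + x)) \o shift 0) (h *: 1) - f (0 *: v + x))) =
    (fun h : R => h^-1 *: ((f \o shift x) (h *: v) - f x)).
  apply/funext => h; have E : h *: (1 : R) = h by exact: mulr1.
  by rewrite /= E addr0 scale0r add0r.
move=> [d dl]; move: d dl; rewrite /derivable /derive E => d dl.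
exact: DeriveDef.
Qed.

Lemma is_derive_affine_coord (d : R -> R) (dd a b : R) i k x :
  is_derive (a * x ord0 i + b) 1 d dd ->
  is_derive x (delta_mx ord0 k) (fun y => d (a * y ord0 i + b)) (dd * (a * (i == k)%:R)).
Proof.
move=> dH; apply: is_derive_line.
pose u : R -> R := (a * (i == k)%:R) *: id + cst (a * x ord0 i + b).
have du : is_derive (0 : R) 1 u (a * (i == k)%:R).
  by apply: is_derive_eq; rewrite addr0 [LHS]mulr1.
rewrite (_ : (fun _ => _) = d \o u); last first.
  apply/funext => s; rewrite /u /= !fctE /GRing.scale/= !mxE eqxx/=; congr d.
  by ring.
by apply: is_derive_comp1 => //; rewrite /u !fctE scaler0 add0r.
Qed.

(** The induction covers all polynomials at once: each partial derivative is a multiple of [flat]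
    for another polynomial. *)
Lemma Ck_flat m (p : {poly R}) (a b : R) i :
  Ck m (fun x => flat p (a * x ord0 i + b)).
Proof.
have cflat q : continuous (flat q).
  move=> t; have [d _] := is_derive_flat q t.
  exact/differentiable_continuous/derivable1_diffP.
have cont q : continuous (fun x : E => flat q (a * x ord0 i + b)).
  move=> x; apply: (@continuous_comp _ _ _ (fun x : E => a * x ord0 i + b) (flat q)); last exact: cflat.
  exact: (cvgD (cvgM (cvg_cst a) (@coord_continuous _ _ _ ord0 i x)) (cvg_cst b)).
elim: m p => [|m IH] p; first exact: cont.
split=> [|k]; first exact: cont.
have dk x := @is_derive_affine_coord _ _ a b i k x (is_derive_flat p _).
split=> [x|]; first by have [] := dk x.
rewrite (_ : partial k _ = (a * (i == k)%:R) *: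
    (fun x => flat ('X^2 * (p - p^`())) (a * x ord0 i + b))); first exact: CkZ.
by apply/funext => x; have [_ dkx] := dk x; rewrite /partial dkx mulrC.
Qed.

Lemma Ck_coord m i : Ck m (fun x => x ord0 i).
Proof.
have cont : continuous (fun x : E => x ord0 i) by exact: coord_continuous.
case: m => [//|m]; split=> // k.
have dk x : is_derive x (delta_mx ord0 k) (fun y : E => y ord0 i) (i == k)%:R.
  have := @is_derive_affine_coord id 1 1 0 i k x (is_derive_id _ _).
  rewrite !mul1r; congr (is_derive _ _ _ _).
  by apply/funext => y /=; rewrite mul1r addr0.
split=> [x|]; first by have [] := dk x.
rewrite (_ : partial k _ = cst (i == k)%:R); first exact: Ck_cst.
by apply/funext => x; have [_ <-] := dk x.
Qed.

Lemma partial_coord i x : partial i (fun y => y ord0 i) x = 1.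
Proof.
have := @is_derive_affine_coord id 1 1 0 i i x (is_derive_id _ _).
rewrite !mul1r eqxx; rewrite (_ : (fun _ => _) = (fun y : E => y ord0 i)).
  by move=> [_]; rewrite /partial => ->.
by apply/funext => y /=; rewrite mul1r addr0.
Qed.

Lemma smoothD f g : smooth f -> smooth g -> smooth (f + g).
Proof. by move=> /smoothP Cf /smoothP Cg; apply/smoothP => m; exact: CkD. Qed.

Lemma smoothZ (a : R) f : smooth f -> smooth (a *: f).
Proof. by move=> /smoothP Cf; apply/smoothP => m; exact: CkZ. Qed.

Lemma smoothM f g : smooth f -> smooth g -> smooth (f * g).
Proof. by move=> /smoothP Cf /smoothP Cg; apply/smoothP => m; exact: CkM. Qed.

Lemma partialDZ (a : R) f g i x : smooth f -> smooth g ->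
  partial i (a *: f + g) x = a * partial i f x + partial i g x.
Proof.
move=> sf sg; rewrite /partial deriveD; last exact: smooth_derivable.
  by rewrite deriveZ//; exact: smooth_derivable.
by apply: derivableZ; exact: smooth_derivable.
Qed.

End smooth.

(** * Test functions and integration by parts *)

Section test_functions.
Context {R : realType} {n : nat}.
Local Notation E := 'rV[R]_n.
Local Notation mu := (lebesgue_rV n : {sigma_finite_measure set E -> \bar R}).
Implicit Types (Om : set E) (f g phi psi : E -> R) (x : E) (i : 'I_n).

Lemma supp_out phi x : ~ supp phi x -> phi x = 0.
Proof.
by move=> nx; apply: contrapT => px; apply/nx/subset_closure/eqP.
Qed.

Lemma supp_subset f g : (forall x, ~ supp g x -> f x = 0) -> supp f `<=` supp g.
Proof.
move=> fg; have cg : closed (supp g) by exact: closed_closure.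
rewrite ((closure_id _).1 cg); apply: closure_subset => x /= fx; apply: contrapT => /fg fx0.
by rewrite fx0 eqxx in fx.
Qed.

Lemma partial_out i phi x : ~ supp phi x -> partial i phi x = 0.
Proof.
move=> nx; rewrite /partial (@near_eq_derive _ _ _ _ (cst 0)) ?derive_cst//.
have : nbhs x (~` supp phi).
  by apply: open_nbhs_nbhs; split=> //; apply: closed_openC; exact: closed_closure.
by apply: filterS => y /supp_out ->.
Qed.

Lemma test_function_supp Om phi psi : test_function Om phi -> smooth psi ->
  supp psi `<=` supp phi -> test_function Om psi.
Proof.
move=> [sphi cphi phiO] spsi sub; split => //; last exact: subset_trans phiO.
by apply: (subclosed_compact _ cphi) => //; exact: closed_closure.
Qed.

Lemma test_function_partial Om phi i : test_function Om phi ->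
  test_function Om (partial i phi).
Proof.
move=> tphi; apply: (test_function_supp tphi); first by apply: smooth_partial; case: tphi.
by apply: supp_subset => x; exact: partial_out.
Qed.

Lemma test_functionM Om phi psi : test_function Om phi -> smooth psi ->
  test_function Om (psi * phi).
Proof.
move=> tphi spsi; apply: (test_function_supp tphi).
  by apply: (smoothM spsi); case: tphi.
by apply: supp_subset => x /supp_out phi0; rewrite fctE phi0 mulr0.
Qed.

Lemma test_function0 Om : test_function Om 0.
Proof.
have supp0 : supp (0 : E -> R) = set0.
  rewrite /supp (_ : mkset _ = set0) ?closure0//.
  by apply/seteqP; split=> // x /=; rewrite eqxx.
split; rewrite ?supp0//; last exact: compact0.
by apply/smoothP => m; exact: Ck_cst.
Qed.

Lemma test_function_subspace Om : subspace (test_function Om).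
Proof.
split; first exact: test_function0.
move=> a u v [su cu uO] [sv cv vO].
have sub : supp (a *: u + v) `<=` supp u `|` supp v.
  rewrite /supp -closureU; apply: closure_subset => x /= uv.
  apply/orP; apply: contraT; rewrite negb_or !negbK => /andP[/eqP ux /eqP vx].
  by move: uv; rewrite !fctE ux vx scaler0 addr0 eqxx.
split.
- exact: (smoothD (smoothZ a su) sv).
- apply: (subclosed_compact _ (compactU cu cv)) => //; exact: closed_closure.
- by apply: subset_trans sub _; rewrite subUset.
Qed.

Lemma test_function_subset Om1 Om2 phi : Om1 `<=` Om2 ->
  test_function Om1 phi -> test_function Om2 phi.
Proof. by move=> O12 [sp cp pO]; split=> //; exact: subset_trans O12. Qed.

(** One box serves [phi], its derivatives and its products alike. *)
Lemma test_function_box Om phi : test_function Om phi ->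
  exists2 M, 0 < M & forall psi, supp psi `<=` supp phi ->
    forall x, ~ box 0 M x -> psi x = 0.
Proof.
move=> [_ /compact_bounded/bounded_set_box[M M0 HM] _]; exists M => // psi sub x.
by apply: contra_notP => px; apply/HM/sub; apply/subset_closure/eqP.
Qed.

Lemma test_function_continuous Om phi : test_function Om phi -> continuous phi.
Proof. by move=> [sphi _ _]; exact: smooth_continuous. Qed.

Lemma test_function_bounded Om phi : test_function Om phi ->
  exists2 C, 0 <= C & forall x, `|phi x| <= C.
Proof.
move=> tphi; have [M M0 HM] := test_function_box tphi.
by apply: (@continuous_bounded_box _ _ _ M); [exact: test_function_continuous tphi|exact: HM].
Qed.

Lemma test_function_sqint Om phi : test_function Om phi -> sqint mu phi.
Proof.
move=> tphi; have [M M0 HM] := test_function_box tphi.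
have [C _ HC] := test_function_bounded tphi.
apply: (@sqint_box _ _ _ M C) => //; last exact: HM.
by apply: continuous_measurable_rV; exact: test_function_continuous tphi.
Qed.

(** The sum of the two sides is the integral of a partial derivative of [psi * phi]. Only [phi]
    needs compact support, so [psi] may be a coordinate. *)
Lemma test_function_ibp Om phi psi i : test_function Om phi -> smooth psi ->
  ip mu (partial i phi) psi = - ip mu phi (partial i psi).
Proof.
move=> tphi spsi; have t1 := test_functionM tphi spsi.
have sphi : smooth phi by case: tphi.
have [M M0 HM] := test_function_box tphi.
have [C C0 HC] := test_function_bounded t1.
have int chi (u : E -> R) : smooth u -> test_function Om chi -> supp chi `<=` supp phi ->
    mu.-integrable [set: E] (EFin \o (fun x => chi x * u x)).
  move=> su tchi sub; have tm := test_functionM tchi su.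
  have [C' _ HC'] := test_function_bounded tm.
  rewrite (_ : (fun x => _) = u * chi); last by apply/funext => x; rewrite fctE mulrC.
  apply: (@integrable_box _ _ _ M C') => //.
    by apply: continuous_measurable_rV; exact: test_function_continuous tm.
  by apply: HM; apply: subset_trans sub; apply: supp_subset => x /supp_out h; rewrite fctE h mulr0.
have subp : supp (partial i phi) `<=` supp phi.
  by apply: supp_subset => x; exact: partial_out.
apply/eqP; rewrite -addr_eq0 -RintegralD//; last 2 first.
- exact: (int _ _ spsi (test_function_partial i tphi) subp).
- exact: (int _ _ (smooth_partial i spsi) tphi (fun x px => px)).
rewrite (_ : \int[mu]_x _ = \int[mu]_x (partial i (psi * phi) x)).
  rewrite /Rintegral (@integral_partial0 _ _ _ _ M)//.
  - by move=> x; apply: smooth_derivable; case: t1.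
  - by apply: smooth_continuous; apply: smooth_partial; case: t1.
  - by apply: HM; apply: supp_subset => x /supp_out h; rewrite fctE h mulr0.
  - apply: HM; apply: subset_trans (supp_subset _); first by move=> x; exact.
    move=> x nx; apply: partial_out; apply: contra_not nx; apply: supp_subset.
    by move=> y /supp_out h; rewrite fctE h mulr0.
apply: eq_Rintegral => x _; rewrite partialM; [ring|exact: smooth_derivable..].
Qed.

End test_functions.

(** * The fundamental lemma of the calculus of variations *)

Section fundamental_lemma.
Context {R : realType} {n : nat}.
Local Notation E := 'rV[R]_n.
Local Notation mu := (lebesgue_rV n : {sigma_finite_measure set E -> \bar R}).

Lemma ae_forall_countable (I : countType) (P : I -> E -> Prop) :
  (forall i, {ae mu, forall x, P i x}) -> {ae mu, forall x i, P i x}.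
Proof.
move=> aeP; have : {ae mu, forall x k, if unpickle k is Some i then P i x else True}.
  by apply: ae_foralln => k; case: (unpickle k) => [i|]; [exact: aeP|exact: nearW].
by apply: filterS => x Px i; have := Px (pickle i); rewrite pickleK.
Qed.

(* Smooth cutoffs in one coordinate show that the sets B such that restricting
   to B preserves a null integral form a sigma-algebra containing the
   half-spaces, i.e. all measurable sets. *)
Section localization.
Variables (K : set (E -> R)) (g : E -> R).
Hypothesis Kint : forall phi, K phi ->
  mu.-integrable [set: E] (EFin \o (fun x => g x * phi x)).
Hypothesis Kmul : forall phi (a b : R) i, K phi ->
  K (fun x => phi x * flat 1 (a * x ord0 i + b)).

Let null (A : set E) := forall phi, K phi ->
  (\int[mu]_(x in A) (g x * phi x)%:E = 0)%E.

Let stab (B : set E) := measurable B /\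
  forall A, measurable A -> null A -> null (A `&` B).

Let KintS A phi : measurable A -> K phi ->
  mu.-integrable A (EFin \o (fun x => g x * phi x)).
Proof. by move=> mA Kphi; apply: integrableS (Kint Kphi). Qed.

Let stabC B : stab B -> stab (~` B).
Proof.
move=> [mB sB]; split=> [|A mA nA phi Kphi]; first exact: measurableC.
have mAB : measurable (A `&` B) by exact: measurableI.
have mAC : measurable (A `&` ~` B) by apply: measurableI => //; exact: measurableC.
have AE : A = (A `&` B) `|` (A `&` ~` B) by rewrite -setIUr setUv setIT.
have := nA phi Kphi; rewrite [in LHS]AE integral_setU_EFin//.
- by rewrite (sB A mA nA phi Kphi) add0e.
- rewrite -AE; have /integrableP[+ _] := KintS mA Kphi.
  by move/measurable_EFinP.
- by apply/disj_setPS => x [[_ Bx] [_ /(_ Bx)]].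
Qed.

Let stabI B C : stab B -> stab C -> stab (B `&` C).
Proof.
move=> [mB sB] [mC sC]; split=> [|A mA nA]; first exact: measurableI.
by rewrite setIA; apply: sC; [exact: measurableI|exact: sB].
Qed.

Let stab_trivIset (F : (set E)^nat) : trivIset setT F -> (forall k, stab (F k)) ->
  stab (\bigcup_k F k).
Proof.
move=> tF sF; have mF k : measurable (F k) by case: (sF k).
split=> [|A mA nA phi Kphi]; first exact: bigcup_measurable.
have mAF k : measurable (A `&` F k) by exact: measurableI.
rewrite setI_bigcupr integral_bigcup//.
- by apply: eseries0 => k _ _; exact: (sF k).2.
- exact: trivIset_setIl.
- by apply: KintS => //; exact: bigcup_measurable.
Qed.

Let stab0 : stab set0.
Proof. by split=> // A mA nA phi _; rewrite setI0 integral_set0. Qed.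

Let stab_bigsetU (F : (set E)^nat) k : (forall k, stab (F k)) ->
  stab (\big[setU/set0]_(i < k) F i).
Proof.
move=> sF; elim: k => [|k IH]; first by rewrite big_ord0; exact: stab0.
rewrite big_ord_recr/= -[X in stab X]setCK setCU.
by apply/stabC/stabI; exact: stabC.
Qed.

Let stab_bigcup (F : (set E)^nat) : (forall k, stab (F k)) ->
  stab (\bigcup_k F k).
Proof.
move=> sF; rewrite seqDU_bigcup_eq; apply: stab_trivIset; first exact: trivIset_seqDU.
move=> k; rewrite /seqDU setDE; apply: stabI => //; apply: stabC.
exact: stab_bigsetU.
Qed.

Let stab_half i (a : R) : stab ((@rV_coord R n i) @^-1` `]a, +oo[%classic).
Proof.
have mH : measurable ((@rV_coord R n i) @^-1` `]a, +oo[%classic).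
  by rewrite -[X in measurable X]setTI; apply: measurable_rV_coord.
split=> // A mA nA phi Kphi.
(* These cutoffs, [flat 1] of (k+1)(x_i - a), tend to the indicator of the half-space x_i > a as k
   grows. *)
have Hk k : (\int[mu]_(x in A) (g x * (phi x * flat 1 (k.+1%:R * x ord0 i + - (k.+1%:R * a))))%:E = 0)%E.
  exact/nA/Kmul.
pose F k x := (g x * (phi x * flat 1 (k.+1%:R * x ord0 i + - (k.+1%:R * a))))%:E.
pose G x := ((g x * phi x) * (if a < x ord0 i then 1 else 0))%:E.
have FE k x : F k x = ((g x * phi x) * flat 1 (k.+1%:R * (x ord0 i - a)))%:E.
  by rewrite /F mulrA mulrBr.
have cFG x : F ^~ x @ \oo --> G x.
  under eq_fun do rewrite FE; apply: cvg_EFin; first exact: nearW.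
  by have := @flat1_cvg R (x ord0 i - a); rewrite subr_gt0 => h; exact: (cvgM (cvg_cst _) h).
have mF k : measurable_fun A (F k).
  by have /integrableP[] := KintS mA (@Kmul phi k.+1%:R (- (k.+1%:R * a)) i Kphi).
have mG : measurable_fun A G.
  by apply: (@emeasurable_fun_cvg _ _ _ A F G mF) => x _; exact: cFG.
have absI : mu.-integrable A (fun x => `|g x * phi x|%:E).
  by have := integrable_abse (KintS mA Kphi).
have bnd x k : (`|F k x| <= `|g x * phi x|%:E)%E.
  rewrite FE /= lee_fin (normrM _ (flat _ _)) ler_piMr//.
  by rewrite ger0_norm ?flat1_ge0 ?flat1_le1.
have [_ _] := @dominated_convergence _ _ _ mu A mA F G (fun x => `|g x * phi x|%:E) mF mG
  (aeW _ (fun x _ => cFG x)) absI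
  (aeW _ (fun x k _ => bnd x k)).
under eq_fun do rewrite Hk.
move=> c0; have G0 : (\int[mu]_(x in A) G x = 0)%E.
  by have /cvg_lim <- := c0 => //; rewrite lim_cst.
rewrite -[RHS]G0 setIC integral_mkcondl; apply: eq_integral => x _.
rewrite /G patchE /=; case: ifPn => [|].
  by rewrite inE /= in_itv/= andbT => ->; rewrite mulr1.
by rewrite notin_setE /= in_itv/= andbT => /negP/negbTE ->; rewrite mulr0.
Qed.

Lemma integral_localize B : measurable B -> null [set: E] -> null B.
Proof.
move=> mB nT; suff [_ sB] : stab B by rewrite -[B]setTI; exact: sB.
move: mB; apply: smallest_sub.
  split=> [|A sA|F sF]; [exact: stab0|by rewrite setTD; exact: stabC|exact: stab_bigcup].
rewrite -bigcup_seq => A [i _] [Y mY <-]; rewrite setTI.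
move: mY; rewrite RGenOInfty.measurableE; move: Y; apply: smallest_sub.
  split=> [|Y sY|F sF].
  - by rewrite preimage_set0; exact: stab0.
  - by rewrite setTD preimage_setC; exact: stabC.
  - by rewrite preimage_bigcup; exact: stab_bigcup.
by move=> _ [a ->]; exact: stab_half.
Qed.

End localization.

(** A product over the coordinates of one-dimensional bumps: the i-th factor is positive exactly for
    x_i between c_i - r and c_i + r. *)
Lemma rat_box_bump (Om : set E) p : closed_rat_box p `<=` Om ->
  exists phi, [/\ test_function Om phi, (forall x, 0 <= phi x)
    & forall x, rat_box p x -> 0 < phi x].
Proof.
move=> pO; pose r : R := p.2.+1%:R^-1; pose c i : R := ratr (p.1 ord0 i).
pose f i (x : E) := flat 1 (1 * x ord0 i + (r - c i)) * flat 1 (-1 * x ord0 i + (r + c i)).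
have f0 i x : 0 <= f i x by rewrite mulr_ge0 ?flat1_ge0.
exists (\prod_(i < n) f i); split; last first.
- move=> x px; rewrite fct_prodE; apply: prodr_gt0 => i _; rewrite mulr_gt0// flat1_gt0.
    by have := px i; rewrite mxE -/(c i) -/r ltr_norml => /andP[? ?]; lra.
  by have := px i; rewrite mxE -/(c i) -/r ltr_norml => /andP[? ?]; lra.
- by move=> x; rewrite fct_prodE; apply: prodr_ge0.
have cpt : compact (@closed_rat_box R n p).
  pose J i := `[c i - r, c i + r]%classic.
  rewrite (_ : closed_rat_box p = [set x : E | forall i, J i (x ord0 i)]).
    by apply: rV_compact => i; exact: segment_compact.
  by apply/seteqP; split => x px i; have := px i; rewrite /J /= in_itv/= ler_distlC.
have clo := compact_closed (@norm_hausdorff _ E) cpt.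
have sub : supp (\prod_(i < n) f i) `<=` closed_rat_box p.
  rewrite ((closure_id _).1 clo); apply: closure_subset => x /= fx i.
  apply: contrapT => /negP; rewrite -ltNge => ri; move: fx.
  rewrite fct_prodE (bigD1 i)//= (_ : f i x = 0) ?mul0r ?eqxx//.
  move: ri; rewrite /f !flat1E -/(c i) -/r lter_normr => ri.
  case: ifPn => [h1|_]; last by rewrite mul0r.
  case: ifPn => [h2|_]; last by rewrite mulr0.
  by exfalso; move: ri h1 h2 => /orP[]; lra.
split; last exact: subset_trans pO.
- apply/smoothP => m; apply: (big_ind (Ck m)) => [|u v|i _]; first exact: Ck_cst.
    exact: CkM.
  by apply: (@CkM _ _ m (fun x => flat 1 _) (fun x => flat 1 _)); exact: Ck_flat.
- exact: (subclosed_compact (@closed_closure _ _) cpt sub).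
Qed.

(** Localized to the set where g > 0, the null integral of [g * phi] against a nonnegative bump has
    a nonnegative integrand, which thus vanishes almost everywhere. This rules out g > 0 on the box
    where the bump is positive, and countably many such boxes cover [Om]. *)
Lemma fundamental_le0 (Om : set E) (g : E -> R) : open Om -> measurable_fun [set: E] g ->
  (forall phi, test_function Om phi ->
    mu.-integrable [set: E] (EFin \o (fun x => g x * phi x))) ->
  (forall phi, test_function Om phi -> \int[mu]_x (g x * phi x) = 0) ->
  {ae mu, forall x, Om x -> g x <= 0}.
Proof.
move=> oO mg Ig g0; pose P : set E := [set x | 0 < g x].
have mP : measurable P.
  rewrite (_ : P = [set: E] `&` g @^-1` `]0, +oo[); last first.
    by apply/seteqP; split => x /=; rewrite in_itv/= andbT => // -[].
  by apply: mg => //; exact: measurable_itv.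
have nP phi : test_function Om phi -> (\int[mu]_(x in P) (g x * phi x)%:E = 0)%E.
  apply: (@integral_localize (test_function Om) g) => //.
    move=> psi a b i tpsi; rewrite (_ : (fun _ => _) = (fun x : E => flat 1 (a * x ord0 i + b)) * psi).
      by apply: test_functionM => //; apply/smoothP => m; exact: Ck_flat.
    by apply/funext => x; rewrite fctE mulrC.
  move=> psi tpsi; have := g0 _ tpsi; rewrite /Rintegral => h.
  by rewrite -[LHS]fineK ?h//; apply: integrable_fin_num => //; exact: Ig.
have key p : {ae mu, forall x, closed_rat_box p `<=` Om -> rat_box p x -> g x <= 0}.
  have [pO|npO] := pselect (closed_rat_box p `<=` Om); last exact: nearW.
  have [phi [tphi phi0 phip]] := rat_box_bump pO.
  have mgp : measurable_fun P (EFin \o (fun x => g x * phi x)).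
    by have /integrableP[+ _] := Ig _ tphi; exact: measurable_funS.
  have /(ae_eq_integral_abs mu mP mgp) : (\int[mu]_(x in P) `|(g x * phi x)%:E| = 0)%E.
    rewrite -[RHS](nP _ tphi); apply: eq_integral => x; rewrite inE => Px.
    by rewrite gee0_abs// lee_fin mulr_ge0// ltW.
  apply: filterS => x /= H _ px; rewrite leNgt; apply/negP => gx.
  have /eqP := H gx; rewrite eqe mulf_eq0 => /orP[/eqP g0x|/eqP p0x].
    by rewrite g0x ltxx in gx.
  by have := phip x px; rewrite p0x ltxx.
apply: filterS (ae_forall_countable key) => x H Ox.
by have [p px pO] := open_rat_box oO Ox; exact: H pO px.
Qed.

Lemma fundamental_lemma (Om : set E) (g : E -> R) : open Om -> sqint mu g ->
  (forall phi, test_function Om phi -> ip mu g phi = 0) ->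
  {ae mu, forall x, Om x -> g x = 0}.
Proof.
move=> oO sg g0; have mg := sqint_measurable sg.
have h1 : {ae mu, forall x, Om x -> g x <= 0}.
  apply: fundamental_le0 => // phi tphi.
  by apply: sqint_integrableM => //; exact: test_function_sqint tphi.
have h2 : {ae mu, forall x, Om x -> - g x <= 0}.
  have sNg : sqint mu (- g) by rewrite -[- g]sub0r; apply: subspaceB (sqint_subspace mu) _ sg; case: (sqint_subspace mu).
  apply: fundamental_le0 => //.
  - exact: (sqint_measurable sNg).
  - move=> phi tphi; apply: (sqint_integrableM sNg); exact: test_function_sqint tphi.
  - move=> phi tphi; rewrite -[RHS](mulr0 (-1)) -(g0 _ tphi) /ip -RintegralZl//.
      by apply: eq_Rintegral => x _; rewrite mulN1r mulNr.
    by apply: sqint_integrableM => //; exact: test_function_sqint tphi.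
apply: filterS2 h1 h2 => x h1 h2 Ox; apply/eqP; rewrite eq_le h1//=.
by rewrite -oppr_le0 h2.
Qed.

End fundamental_lemma.

(** * Square-integrable vector fields *)

Section vector_fields.
Context {d : measure_display} {T : measurableType d} {R : realType} {n : nat}.
Variable mu : {measure set T -> \bar R}.
Implicit Types G H : T -> 'rV[R]_n.

Definition comp (i : 'I_n) G : T -> R := fun x => G x ord0 i.

Definition sqintv : set (T -> 'rV[R]_n) := [set G | forall i, sqint mu (comp i G)].

(** Summed over components rather than integrating [dot], so that each fact on [ip] lifts term by
    term. *)
Definition vip G H : R := \sum_(i < n) ip mu (comp i G) (comp i H).

Definition nrmv : (T -> 'rV[R]_n) -> R := semi_norm vip.

Lemma compD i G H : comp i (G + H) = comp i G + comp i H.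
Proof. by apply/funext => x; rewrite /comp !fctE mxE. Qed.

Lemma compZ i (a : R) G : comp i (a *: G) = a *: comp i G.
Proof. by apply/funext => x; rewrite /comp !fctE mxE. Qed.

Lemma compB i G H : comp i (G - H) = comp i G - comp i H.
Proof. by apply/funext => x; rewrite /comp !fctE !mxE. Qed.

Lemma sqintv_subspace : subspace sqintv.
Proof.
have [s0 sD] := sqint_subspace mu; split=> [i|a G H sG sH i].
  by rewrite (_ : comp i 0 = 0)//; apply/funext => x; rewrite /comp mxE.
by rewrite compD compZ; exact: sD.
Qed.

Lemma semi_inner_vip : semi_inner sqintv vip.
Proof.
have [_ sym lin ge0] := semi_inner_ip mu.
split; first exact: sqintv_subspace.
- by move=> G H sG sH; apply: eq_bigr => i _; exact: sym.
- move=> a G H K sG sH sK; rewrite mulr_sumr -big_split; apply: eq_bigr => i _ /=.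
  by rewrite compD compZ lin.
- by move=> G sG; apply: sumr_ge0 => i _; exact: ge0.
Qed.

Lemma nrmv_ge0 G : 0 <= nrmv G. Proof. exact: semi_norm_ge0. Qed.

Lemma sqr_nrmv G : sqintv G -> nrmv G ^+ 2 = \sum_(i < n) nrm2 mu (comp i G) ^+ 2.
Proof.
move=> sG; rewrite (sqr_semi_norm semi_inner_vip)//; apply: eq_bigr => i _.
by rewrite (sqr_semi_norm (semi_inner_ip mu)).
Qed.

Lemma nrm2_comp_le i G : sqintv G -> nrm2 mu (comp i G) <= nrmv G.
Proof.
move=> sG; rewrite -ler_sqr ?nnegrE ?nrmv_ge0 ?nrm2_ge0// sqr_nrmv//.
by rewrite (bigD1 i)//= lerDl sumr_ge0// => j _; exact: sqr_ge0.
Qed.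

(** The denominator n + 1 is never 0, and n / (n+1)^2 < 1. *)
Lemma nrmv_lt e G : 0 < e -> sqintv G ->
  (forall i, nrm2 mu (comp i G) < e / n.+1%:R) -> nrmv G < e.
Proof.
move=> e0 sG H; rewrite -ltr_sqr ?nnegrE ?nrmv_ge0 ?(ltW e0)// sqr_nrmv//.
apply: (@le_lt_trans _ _ (\sum_(i < n) (e / n.+1%:R) ^+ 2)).
  apply: ler_sum => i _; rewrite lerXn2r ?nnegrE ?nrm2_ge0 ?divr_ge0 ?ltW//.
rewrite sumr_const card_ord expr_div_n -[_ *+ n]mulr_natr mulrAC.
rewrite ltr_pdivrMr ?exprn_gt0// ltr_pM2l ?exprn_gt0// expr2 -natrM ltr_nat.
by rewrite mulSn leq_addr.
Qed.

Lemma sqintv_complete (G : nat -> T -> 'rV[R]_n) : (forall k, sqintv (G k)) ->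
  (forall e, 0 < e -> exists K, forall j k, (K <= j)%N -> (K <= k)%N ->
    nrmv (G j - G k) < e) ->
  exists2 H, sqintv H & forall e, 0 < e -> exists K, forall k, (K <= k)%N ->
    nrmv (G k - H) < e.
Proof.
move=> sG cG; have sB := subspaceB sqintv_subspace.
have /boolp.choice[h Hh] : forall i : 'I_n, exists h, sqint mu h /\
    forall e, 0 < e -> exists K, forall k, (K <= k)%N -> nrm2 mu (comp i (G k) - h) < e.
  move=> i; have [||h sh Hh] := @sqint_complete _ _ _ mu (fun k => comp i (G k)).
  - by move=> k; exact: sG.
  - move=> e /cG[K HK]; exists K => j k Kj Kk; rewrite -compB.
    by apply: le_lt_trans (HK j k Kj Kk); apply: nrm2_comp_le; exact: sB.
  - by exists h.
pose H x : 'rV[R]_n := \row_i h i x.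
have cH i : comp i H = h i by apply/funext => x; rewrite /comp mxE.
have sH : sqintv H by move=> i; rewrite cH; case: (Hh i).
exists H => // e e0; have en0 : 0 < e / n.+1%:R by rewrite divr_gt0.
have /boolp.choice[K HK] : forall i, exists K, forall k, (K <= k)%N ->
    nrm2 mu (comp i (G k) - h i) < e / n.+1%:R by move=> i; apply: (Hh i).2.
exists (\max_(i < n) K i)%N => k Kk; apply: nrmv_lt => // [|i]; first exact: sB.
by rewrite compB cH; apply: HK; apply: leq_trans Kk; exact: leq_bigmax.
Qed.

Lemma ae_eq_nrmv G H : sqintv G -> sqintv H -> {ae mu, forall x, G x = H x} ->
  nrmv G = nrmv H.
Proof.
move=> sG sH GH; rewrite /nrmv /semi_norm; congr Num.sqrt; apply: eq_bigr => i _.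
by apply: ae_eq_ip => //; apply: filterS GH => x; rewrite /comp => ->.
Qed.

Lemma le_nrmv G H : (forall i, measurable_fun [set: T] (comp i G)) -> sqintv H ->
  (forall i x, `|comp i G x| <= `|comp i H x|) -> nrmv G <= nrmv H.
Proof.
move=> mG sH GH; have sG : sqintv G.
  by move=> i; apply: sqint_le (mG i) (sH i) _; exact: GH.
rewrite -ler_sqr ?nnegrE ?nrmv_ge0// !sqr_nrmv//; apply: ler_sum => i _.
by rewrite lerXn2r ?nnegrE ?nrm2_ge0//; apply: le_nrm2 => //; exact: GH.
Qed.

End vector_fields.

(** * The Dirichlet form and the Poincare inequality *)

Section dirichlet_form.
Context {R : realType} {n : nat}.
Local Notation E := 'rV[R]_n.
Local Notation mu := (lebesgue_rV n : {sigma_finite_measure set E -> \bar R}).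
Implicit Types (Om : set E) (phi psi : E -> R).

Definition dirform phi psi : R := vip mu (grad phi) (grad psi).

Definition nrmd : (E -> R) -> R := semi_norm dirform.

Lemma comp_grad i phi : comp i (grad phi) = partial i phi.
Proof. by apply/funext => x; rewrite /comp mxE. Qed.

Lemma sqintv_grad Om phi : test_function Om phi -> sqintv mu (grad phi).
Proof.
by move=> tphi i; rewrite comp_grad; apply: (@test_function_sqint _ _ Om); exact: test_function_partial.
Qed.

Lemma gradDZ (a : R) phi psi : smooth phi -> smooth psi ->
  grad (a *: phi + psi) = a *: grad phi + grad psi.
Proof.
by move=> sphi spsi; apply/funext => x; apply/rowP => i; rewrite !fctE !mxE partialDZ.
Qed.

Lemma gradB phi psi : smooth phi -> smooth psi -> grad (phi - psi) = grad phi - grad psi.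
Proof.
by move=> sphi spsi; rewrite addrC -scaleN1r gradDZ// scaleN1r addrC.
Qed.

Lemma semi_inner_dirform Om : semi_inner (test_function Om) dirform.
Proof.
have [_ sym lin ge0] := @semi_inner_vip _ _ _ n mu.
have sg := @sqintv_grad Om.
split; first exact: test_function_subspace.
- by move=> u v tu tv; apply: sym; exact: sg.
- move=> a u v w tu tv tw; rewrite /dirform gradDZ; [|by case: tu|by case: tv].
  by apply: lin; exact: sg.
- by move=> u tu; apply: ge0; exact: sg.
Qed.

Lemma nrmdE phi : nrmd phi = nrmv mu (grad phi). Proof. by []. Qed.

(* Integrate phi^2 * d x_0 / d x_0 by parts. *)
Lemma poincare M (n0 : (0 < n)%N) phi : 0 < M -> test_function (box 0 M) phi ->
  nrm2 mu phi <= 2 * M * nrmd phi.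
Proof.
move=> M0 tphi; pose i0 := Ordinal n0; pose X : E -> R := fun x => x ord0 i0.
have sX : smooth X by apply/smoothP => m; exact: Ck_coord.
have sphi : smooth phi by case: tphi.
have tXphi : test_function (box 0 M) (X * phi) by exact: test_functionM.
have tdphi : test_function (box 0 M) (partial i0 phi) by exact: test_function_partial.
have qphi := test_function_sqint tphi; have qX := test_function_sqint tXphi.
have qd := test_function_sqint tdphi.
have ibp := test_function_ibp i0 tXphi sphi.
have pX : partial i0 (X * phi) = X * partial i0 phi + phi.
  apply/funext => x; rewrite partialM; [|exact: smooth_derivable..].
  by rewrite partial_coord mulr1.
have qXd : sqint mu (X * partial i0 phi).
  by apply: (@test_function_sqint _ _ (box 0 M)); exact: test_functionM.
(* Writing d for the first partial derivative, d (X phi) = X d phi + phi, and the term with X d phi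
   occurs on both sides of the integration by parts. *)
have key : ip mu phi phi = - (2 * ip mu (X * phi) (partial i0 phi)).
  move: ibp; rewrite pX (semi_innerDl (semi_inner_ip mu))// => h.
  have e2 : ip mu (X * partial i0 phi) phi = ip mu (X * phi) (partial i0 phi).
    by apply: eq_Rintegral => x _; rewrite !fctE mulrAC.
  by move: h; rewrite e2 => h; lra.
have [nphi0|nphi0] := eqVneq (nrm2 mu phi) 0.
  by rewrite nphi0 mulr_ge0 ?semi_norm_ge0// mulr_ge0// ltW.
have np : 0 < nrm2 mu phi by rewrite lt_neqAle eq_sym nphi0 nrm2_ge0.
rewrite -(ler_pM2l np) -expr2 (sqr_semi_norm (semi_inner_ip mu))// key.
have cs := cauchy_schwarz (semi_inner_ip mu) qX qd.
have dle : nrm2 mu (partial i0 phi) <= nrmd phi.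
  by rewrite nrmdE -comp_grad; apply: nrm2_comp_le; exact: sqintv_grad tphi.
(* |x_0| < M on the box that carries [phi]; this is the origin of the constant 2 M. *)
have Xle : nrm2 mu (X * phi) <= M * nrm2 mu phi.
  rewrite -(gtr0_norm M0) -(semi_normZ (semi_inner_ip mu))//.
  apply: le_nrm2; first exact: (sqint_measurable qX).
    exact: subspaceZ (sqint_subspace mu) _.
  move=> x; rewrite !fctE !normrM; have [bx|nbx] := pselect (box 0 M x).
    rewrite ler_wpM2r// (gtr0_norm M0); have := bx i0.
    by rewrite mxE sub0r normrN => /ltW.
  by rewrite (@supp_out _ _ phi x) ?normr0 ?mulr0//; case: tphi => _ _ sub /sub.
have := le_trans (ler_norm _) cs; have := ler_norm (- ip mu (X * phi) (partial i0 phi)).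
rewrite normrN => h1 h2; apply: (@le_trans _ _ (2 * (nrm2 mu (X * phi) * nrm2 mu (partial i0 phi)))).
  by move: h1 cs; rewrite /nrm2; lra.
apply: (@le_trans _ _ (2 * ((M * nrm2 mu phi) * nrmd phi))).
  by rewrite ler_pM2l// ler_pM ?nrm2_ge0.
by rewrite le_eqVlt; apply/orP; left; apply/eqP; ring.
Qed.

(** Poincare makes the functions Cauchy as soon as their gradients are. The limits [v] and [G] are
    tied together by being approximated by the same test function and its gradient. *)
Lemma grad_limit M (n0 : (0 < n)%N) (phi : nat -> E -> R) : 0 < M ->
  (forall k, test_function (box 0 M) (phi k)) ->
  (forall e, 0 < e -> exists K, forall j k, (K <= j)%N -> (K <= k)%N ->
    nrmd (phi j - phi k) < e) ->
  exists v G, [/\ sqint mu v, sqintv mu G &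
    forall e, 0 < e -> exists K, forall k, (K <= k)%N ->
      nrm2 mu (phi k - v) < e /\ nrmv mu (grad (phi k) - G) < e].
Proof.
move=> M0 tphi cphi; have sphi k : smooth (phi k) by case: (tphi k).
have [||v sv Hv] := @sqint_complete _ _ _ mu phi.
- by move=> k; exact: test_function_sqint (tphi k).
- move=> e e0; have M20 : 0 < 2 * M by rewrite mulr_gt0.
  have [K HK] := cphi _ (divr_gt0 e0 M20); exists K => j k Kj Kk.
  apply: le_lt_trans (poincare n0 M0 _) _.
    exact: subspaceB (test_function_subspace _) _ _.
  by rewrite mulrC -ltr_pdivlMr//; exact: HK.
have [||G sG HG] := @sqintv_complete _ _ _ n mu (fun k => grad (phi k)).
- by move=> k; exact: sqintv_grad (tphi k).
- move=> e /cphi[K HK]; exists K => j k Kj Kk.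
  by rewrite -gradB//; exact: HK.
exists v, G; split => // e e0; have [K1 HK1] := Hv e e0; have [K2 HK2] := HG e e0.
exists (maxn K1 K2) => k; rewrite geq_max => /andP[h1 h2].
by split; [exact: HK1|exact: HK2].
Qed.

End dirichlet_form.

(** * Weak gradients on the whole space and the Dirichlet problem *)

Section weak_gradient.
Context {R : realType} {n : nat}.
Local Notation E := 'rV[R]_n.
Local Notation mu := (lebesgue_rV n : {sigma_finite_measure set E -> \bar R}).
Implicit Types (Om A : set E) (u v f g phi psi : E -> R) (G H P : E -> E).
Local Notation si := (semi_inner_ip mu).
Local Notation siv := (@semi_inner_vip _ _ _ n mu).
Local Notation ss := (sqint_subspace mu).
Local Notation ssv := (@sqintv_subspace _ _ _ n mu).

(* u is in H10 Om with gradient G, both given by functions on the whole space. *)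
Definition W10 Om u G : Prop := [/\ sqint mu u, sqintv mu G &
  forall e : R, 0 < e -> exists phi, [/\ test_function Om phi,
    nrm2 mu (u - phi) < e & nrmv mu (G - grad phi) < e]].

(** Test functions vanish off [Om], so integrating over the whole space changes nothing and turns
    the identity into one between values of [ip]. *)
Definition wgrad Om u G : Prop := [/\ sqint mu u, sqintv mu G &
  forall phi, test_function Om phi -> forall i,
    ip mu u (partial i phi) = - ip mu (comp i G) phi].

Lemma eq_small (a b X : R) : (forall e, 0 < e -> `|a - b| <= e * X) -> a = b.
Proof.
move=> H; apply/eqP; rewrite -subr_eq0 -normr_le0; apply/ler_addgt0Pr => e e0.
rewrite add0r; have X0 : 0 <= X.
  by have := H 1 ltr01; rewrite mul1r; apply: le_trans.
apply: le_trans (H (e / (X + 1)) _) _; first by rewrite divr_gt0// ltr_wpDl.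
by rewrite -mulrA ler_piMr ?(ltW e0)// mulrC ler_pdivrMr ?mul1r ?lerDl// ltr_wpDl.
Qed.

Lemma small_le0 (a c : R) : (forall e, 0 < e -> a <= c * e) -> a <= 0.
Proof.
move=> H; apply/ler_addgt0Pr => e e0; rewrite add0r.
apply: le_trans (H (e / (`|c| + 1)) _) _; first by rewrite divr_gt0// ltr_wpDl.
rewrite mulrCA ler_piMr ?(ltW e0)// ler_pdivrMr ?ltr_wpDl// mul1r.
by rewrite (le_trans (ler_norm _))// lerDl.
Qed.

Lemma sqint_restrict A f : measurable A -> sqint mu f -> sqint mu (f \_ A).
Proof.
move=> mA sf; have mfA : measurable_fun [set: E] (f \_ A).
  apply/(measurable_restrictT _ mA).
  by apply: measurable_funS (sqint_measurable sf).
apply: sqint_le mfA sf _ => x; rewrite patchE; case: ifP => //.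
by rewrite normr0.
Qed.

Lemma ip_restrict A f g : (forall x, ~ A x -> g x = 0) -> ip mu (f \_ A) g = ip mu f g.
Proof.
move=> g0; apply: eq_Rintegral => x _; rewrite patchE; case: ifPn => //.
by rewrite notin_setE => /g0 ->; rewrite !mulr0.
Qed.

Lemma nrm2_restrict A f : measurable A -> sqint mu f -> nrm2 mu (f \_ A) <= nrm2 mu f.
Proof.
move=> mA sf; apply: le_nrm2 => //; first exact: sqint_measurable (sqint_restrict mA sf).
by move=> x; rewrite patchE; case: ifP => // _; rewrite normr0.
Qed.

(** On [A] the function [v] coincides with v - phi, so its norm there is arbitrarily small. *)
Lemma limit_out A v : measurable A -> sqint mu v ->
  (forall e, 0 < e -> exists phi, [/\ sqint mu phi, (forall x, A x -> phi x = 0) &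
    nrm2 mu (v - phi) < e]) ->
  {ae mu, forall x, A x -> v x = 0}.
Proof.
move=> mA sv H; have sA := sqint_restrict mA sv.
have : {ae mu, forall x, (v \_ A) x = 0}.
  apply: nrm2_eq0 => //; apply/eqP; rewrite eq_le nrm2_ge0 andbT.
  apply: (@small_le0 _ 1) => e e0; have [phi [sphi phi0 small]] := H e e0.
  rewrite mul1r (le_trans _ (ltW small))//.
  apply: le_nrm2; [exact: sqint_measurable sA|exact: subspaceB ss sv sphi|].
  move=> x; rewrite patchE; case: ifPn => [|_]; last by rewrite normr0.
  by rewrite inE !fctE => /phi0 ->; rewrite subr0.
by apply: filterS => x + Ax; rewrite patchE mem_set.
Qed.

(** Extension by 0 keeps H10 inside H^1(R^n): the approximants have compact support in [Om], so
    integration by parts against them holds for every test function of R^n and passes to the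
    limit. *)
Lemma W10_wgrad Om u G : W10 Om u G -> wgrad [set: E] u G.
Proof.
move=> [su sG H]; split => // psi tpsi i.
have qpsi := test_function_sqint tpsi.
have qd := test_function_sqint (test_function_partial i tpsi).
apply: (@eq_small _ _ (nrm2 mu (partial i psi) + nrm2 mu psi)) => e e0.
have [phi [tphi h1 h2]] := H e e0; have qphi := test_function_sqint tphi.
have qdphi := test_function_sqint (test_function_partial i tphi).
have ibp : ip mu (partial i phi) psi = - ip mu phi (partial i psi).
  by apply: test_function_ibp tphi _; case: tpsi.
have -> : ip mu u (partial i psi) - - ip mu (comp i G) psi =
    ip mu (u - phi) (partial i psi) + ip mu (comp i (G - grad phi)) psi.
  rewrite compB comp_grad (semi_innerBl si su qphi qd) (semi_innerBl si (sG i) qdphi qpsi).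
  by rewrite ibp; ring.
rewrite mulrDr (le_trans (ler_normD _ _))// lerD//.
  apply: (le_trans (cauchy_schwarz si (subspaceB ss su qphi) qd)).
  by rewrite ler_wpM2r ?semi_norm_ge0// ltW.
have sGg : sqintv mu (G - grad phi) by exact: subspaceB ssv sG (sqintv_grad tphi).
apply: (le_trans (cauchy_schwarz si (sGg i) qpsi)).
rewrite ler_wpM2r ?semi_norm_ge0// (le_trans _ (ltW h2))//.
exact: nrm2_comp_le.
Qed.

Lemma wgrad_subset Om1 Om2 u G : Om1 `<=` Om2 -> wgrad Om2 u G -> wgrad Om1 u G.
Proof.
move=> O12 [su sG H]; split => // phi tphi i; apply: H.
exact: test_function_subset tphi.
Qed.

Lemma wgrad_unique Om u G H : open Om -> wgrad Om u G -> wgrad Om u H ->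
  {ae mu, forall x, Om x -> G x = H x}.
Proof.
move=> oO [su sG hG] [_ sH hH].
have : {ae mu, forall x (i : 'I_n), Om x -> (comp i G - comp i H) x = 0}.
  apply: ae_forall_countable => i; apply: fundamental_lemma => //.
    exact: subspaceB ss (sG i) (sH i).
  move=> phi tphi; have qphi := test_function_sqint tphi.
  rewrite (semi_innerBl si (sG i) (sH i) qphi).
  by have := hG phi tphi i; rewrite hH// => /oppr_inj ->; rewrite subrr.
apply: filterS => x h Ox; apply/rowP => i; apply/eqP; rewrite -subr_eq0.
by have := h i Ox; rewrite !fctE /comp => ->.
Qed.

(** Both sides are continuous in the pair of [u] and [G], so the identity extends from test
    functions to their limits. *)
Lemma W10_density Om u G P f : W10 Om u G -> sqintv mu P -> sqint mu f ->
  (forall psi, test_function Om psi -> vip mu P (grad psi) = ip mu f psi) ->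
  vip mu P G = ip mu f u.
Proof.
move=> [su sG H] sP sf HP; apply: (@eq_small _ _ (nrmv mu P + nrm2 mu f)) => e e0.
have [phi [tphi h1 h2]] := H e e0; have qphi := test_function_sqint tphi.
have sg := sqintv_grad tphi.
have -> : vip mu P G - ip mu f u = vip mu P (G - grad phi) - ip mu f (u - phi).
  by rewrite (semi_innerBr siv)// (semi_innerBr si)// HP//; ring.
rewrite mulrDr (le_trans (ler_normB _ _))// lerD//.
  apply: (le_trans (cauchy_schwarz siv sP (subspaceB ssv sG sg))).
  by rewrite mulrC ler_wpM2r ?semi_norm_ge0// ltW.
apply: (le_trans (cauchy_schwarz si sf (subspaceB ss su qphi))).
by rewrite mulrC ler_wpM2r ?semi_norm_ge0// ltW.
Qed.

(** Riesz representation with all the spaces [W k] equal to the test functions of [Om]. *)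
Lemma dirichlet_exists M (n0 : (0 < n)%N) Om (L : (E -> R) -> R) (C : R) :
  0 < M -> open Om -> Om `<=` box 0 M ->
  (forall a phi psi, test_function Om phi -> test_function Om psi ->
    L (a *: phi + psi) = a * L phi + L psi) ->
  (forall phi, test_function Om phi -> `|L phi| <= C * nrmd phi) ->
  exists v G, [/\ W10 Om v G, (forall x, ~ Om x -> v x = 0) &
    forall psi, test_function Om psi -> vip mu G (grad psi) = L psi].
Proof.
move=> M0 oO OM Llin Lbnd; have mO := open_measurable_rV oO.
have [phi [tphi rphi cphi]] := riesz_decreasing (semi_inner_dirform Om)
  (fun _ => test_function_subspace Om) (fun _ _ => id) (fun _ _ => id) Llin Lbnd.
have [k|v [G [sv sG lim]]] := grad_limit n0 M0 _ cphi.
  exact: test_function_subset OM (tphi k).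
have svO := sqint_restrict mO sv.
(* Cutting off makes the solution vanish everywhere outside [Om]; the distance to a test function of
   [Om] does not grow. *)
exists (v \_ Om), G; split.
- split => // e e0; have [K HK] := lim e e0; have [h1 h2] := HK K (leqnn K).
  have qphi := test_function_sqint (tphi K); have sg := sqintv_grad (tphi K).
  exists (phi K); split => //; last first.
    by rewrite /nrmv (semi_norm_distC siv).
  apply: le_lt_trans h1; apply: le_nrm2.
  + exact: (sqint_measurable (subspaceB ss svO qphi)).
  + exact: subspaceB ss qphi sv.
  + move=> x; rewrite !fctE patchE distrC; case: ifPn => //.
    rewrite notin_setE => nx; rewrite (@supp_out _ _ (phi K) x) ?subrr ?normr0//.
    by case: (tphi K) => _ _ sub /sub.
- by move=> x nx; rewrite patchE memNset.
- move=> psi tpsi; have sg := sqintv_grad tpsi.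
  apply: (@eq_small _ _ (nrmd psi + nrmd psi)) => e e0.
  have [K HK] := lim e e0.
  have [N _ HN] : \forall k \near \oo, k.+1%:R^-1 < e.
    exact: near_infty_natSinv_lt (PosNum e0).
  have [_ h2] := HK (maxn K N) (leq_maxl _ _).
  have := rphi (maxn K N) psi tpsi; have := HN (maxn K N) (leq_maxr K N).
  set k := maxn K N => /= kN.
  have sgk := sqintv_grad (tphi k).
  have -> : vip mu G (grad psi) - L psi =
      (dirform (phi k) psi - L psi) - vip mu (grad (phi k) - G) (grad psi).
    by rewrite (semi_innerBl siv)// /dirform; ring.
  move=> hk; rewrite mulrDr (le_trans (ler_normB _ _))// lerD//.
    by rewrite (le_trans hk)// ler_wpM2r ?semi_norm_ge0// ltW.
  apply: (le_trans (cauchy_schwarz siv (subspaceB ssv sgk sG) sg)).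
  by rewrite ler_wpM2r ?semi_norm_ge0// ltW.
Qed.

End weak_gradient.

(** * Translation between H10 and pairs of functions on the whole space *)

Section sobolev_representatives.
Context {R : realType} {n : nat}.
Local Notation E := 'rV[R]_n.
Local Notation mu := (lebesgue_rV n : {sigma_finite_measure set E -> \bar R}).
Implicit Types (Om : set E) (u v f g phi psi : E -> R) (G H P : E -> E).
Local Notation si := (semi_inner_ip mu).
Local Notation siv := (@semi_inner_vip _ _ _ n mu).
Local Notation ss := (sqint_subspace mu).
Local Notation ssv := (@sqintv_subspace _ _ _ n mu).

Lemma ext0_in (V : zmodType) Om (h : E -> V) x : Om x -> ext0 Om h x = h x.
Proof. by move=> Ox; rewrite /ext0 patchE mem_set. Qed.

Lemma ext0_out (V : zmodType) Om (h : E -> V) x : ~ Om x -> ext0 Om h x = 0.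
Proof. by move=> Ox; rewrite /ext0 patchE memNset. Qed.

Lemma comp_ext0 Om G i : comp i (ext0 Om G) = ext0 Om (comp i G).
Proof.
apply/funext => x; have [Ox|Ox] := pselect (Om x).
  by rewrite /comp !ext0_in.
by rewrite /comp !ext0_out// mxE.
Qed.

Lemma L2_vecP Om G : L2_vec Om G <-> sqintv mu (ext0 Om G).
Proof. by split=> H i; have := H i; rewrite /= comp_ext0. Qed.

Lemma L2norm_nrm2 Om u : sqint mu (ext0 Om u) ->
  L2norm Om u = (nrm2 mu (ext0 Om u))%:E.
Proof. exact: Lnorm2_nrm2. Qed.

(** The square of either side is the integral of the sum of the squared components. *)
Lemma L2norm_vec_nrmv Om G : sqintv mu (ext0 Om G) ->
  L2norm_vec Om G = (nrmv mu (ext0 Om G))%:E.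
Proof.
move=> sG; pose h := ext0 Om (fun x => Num.sqrt (dot (G x) (G x))).
have h2 x : h x ^+ 2 = \sum_(i < n) comp i (ext0 Om G) x ^+ 2.
  have [Ox|Ox] := pselect (Om x).
    rewrite /h ext0_in// sqr_sqrtr; last by apply: sumr_ge0 => i _; rewrite -expr2 sqr_ge0.
    by apply: eq_bigr => i _; rewrite /comp ext0_in// expr2.
  by rewrite /h ext0_out// expr0n/= big1// => i _; rewrite /comp ext0_out// mxE expr0n.
have mG i := sqint_measurable (sG i).
have mh : measurable_fun [set: E] h.
  rewrite (_ : h = Num.sqrt \o (fun x => \sum_(i < n) comp i (ext0 Om G) x ^+ 2)).
    apply: measurableT_comp; first exact: continuous_measurable_fun (@sqrt_continuous R).
    by apply: measurable_sum => i; exact: measurable_funX.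
  apply/funext => x; rewrite /= -h2 sqrtr_sqr ger0_norm// /h.
  have [Ox|Ox] := pselect (Om x); last by rewrite ext0_out.
  by rewrite ext0_in// sqrtr_ge0.
have Ih : (\int[mu]_x (h x ^+ 2)%:E = (nrmv mu (ext0 Om G) ^+ 2)%:E)%E.
  rewrite sqr_nrmv// -sumEFin; under eq_bigr do rewrite EFin_nrm2//.
  rewrite -ge0_integral_sum//.
  - by apply: eq_integral => x _; rewrite h2 sumEFin.
  - by move=> i; apply/measurable_EFinP; exact: measurable_funX.
  - by move=> i x _; rewrite lee_fin sqr_ge0.
have sh : sqint mu h.
  apply/sqintP; split => //; apply/integrableP; split.
    by apply/measurable_EFinP; exact: measurable_funX.
  rewrite (eq_integral (fun x => (h x ^+ 2)%:E)) ?Ih ?ltry// => x _ /=.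
  by rewrite ger0_norm// sqr_ge0.
rewrite /L2norm_vec L2norm_nrm2//; congr EFin; apply/eqP.
rewrite -(@eqrXn2 _ 2) ?nrm2_ge0 ?nrmv_ge0//; apply/eqP.
by have := Ih; rewrite -EFin_nrm2// => -[].
Qed.

Lemma H1_wgrad Om f : H1 Om f -> wgrad Om (ext0 Om f) (ext0 Om (weak_grad Om f)).
Proof.
move=> [sf exG]; have [sG HG] := xgetPex (fun=> 0) exG.
split=> [//||phi tphi i]; first exact/L2_vecP.
have := HG phi tphi i; rewrite Rintegral_mkcond [in RHS]Rintegral_mkcond => h.
transitivity (\int[mu]_x ((fun x => f x * partial i phi x) \_ Om) x).
  apply: eq_Rintegral => x _; rewrite /ext0 !patchE; case: ifP => //.
  by rewrite mul0r.
rewrite h; congr (- _); apply: eq_Rintegral => x _.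
rewrite comp_ext0 /ext0 !patchE; case: ifP => //.
by rewrite mul0r.
Qed.

Lemma wgrad_H1 Om u G : open Om -> wgrad Om u G -> H1 Om u /\ L2_vec Om G /\ is_weak_grad Om u G.
Proof.
move=> oO [su sG H]; have mO := open_measurable_rV oO.
suff wG : L2_vec Om G /\ is_weak_grad Om u G.
  by split => //; split; [exact: sqint_restrict|exists G].
split; first by move=> i; apply: sqint_restrict mO (sG i).
move=> phi tphi i; have out f : (forall x, ~ supp phi x -> f x = 0) ->
    forall x, ~ Om x -> f x = 0.
  by move=> f0 x nx; apply: f0; case: tphi => _ _ sub /sub.
have := H phi tphi i => h; rewrite Rintegral_mkcond [in RHS]Rintegral_mkcond.
transitivity (ip mu u (partial i phi)).
  apply: eq_Rintegral => x _; rewrite patchE; case: ifPn => //; rewrite notin_setE => nx.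
  by rewrite (out (partial i phi)) ?mulr0// => y; exact: partial_out.
rewrite h; congr (- _); apply: eq_Rintegral => x _.
rewrite patchE; case: ifPn => //; rewrite notin_setE => nx.
by rewrite (out phi) ?mulr0// => y; exact: supp_out.
Qed.

Lemma ext0B_test (V : zmodType) Om (h k : E -> V) : (forall x, ~ Om x -> k x = 0) ->
  ext0 Om (h - k) = ext0 Om h - k.
Proof.
move=> k0; apply/funext => x; have [Ox|Ox] := pselect (Om x).
  by rewrite !fctE !ext0_in.
by rewrite !fctE !ext0_out// k0// subrr.
Qed.

Lemma grad_out Om phi x : test_function Om phi -> ~ Om x -> grad phi x = 0.
Proof.
move=> [_ _ sub] nx; apply/rowP => i; rewrite !mxE; apply: partial_out.
by move=> /sub.
Qed.

Lemma test_out Om phi x : test_function Om phi -> ~ Om x -> phi x = 0.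
Proof. by move=> [_ _ sub] nx; apply: supp_out => /sub. Qed.

Lemma H10_W10 Om u : H10 Om u -> W10 Om (ext0 Om u) (ext0 Om (weak_grad Om u)).
Proof.
move=> [H1u H]; have [su sG _] := H1_wgrad H1u; split => // e /H[phi [tphi h1 h2]].
exists phi; split => //.
  move: h1; rewrite (_ : (u \- phi) = u - phi)//.
  have E1 := ext0B_test u (fun x => @test_out _ _ x tphi).
  rewrite L2norm_nrm2 E1 ?lte_fin//.
  exact: subspaceB ss su (test_function_sqint tphi).
move: h2; rewrite (_ : (weak_grad Om u \- grad phi) = weak_grad Om u - grad phi)//.
have E2 := ext0B_test (weak_grad Om u) (fun x => @grad_out _ _ x tphi).
rewrite L2norm_vec_nrmv E2 ?lte_fin//.
exact: subspaceB ssv sG (sqintv_grad tphi).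
Qed.

Lemma sqintv_restrict Om G : measurable Om -> sqintv mu G -> sqintv mu (ext0 Om G).
Proof. by move=> mO sG i; rewrite comp_ext0; exact: sqint_restrict. Qed.

Lemma nrmv_restrict Om G : measurable Om -> sqintv mu G -> nrmv mu (ext0 Om G) <= nrmv mu G.
Proof.
move=> mO sG; apply: le_nrmv => //.
  by move=> i; apply: sqint_measurable; exact: sqintv_restrict.
move=> i x; have [Ox|Ox] := pselect (Om x); first by rewrite /comp ext0_in.
by rewrite /comp ext0_out// mxE normr0.
Qed.

(** [weak_grad] is a chosen representative, so it meets [G] only through uniqueness, almost
    everywhere on [Om]. *)
Lemma W10_weak_grad Om u G : open Om -> W10 Om u G ->
  {ae mu, forall x, Om x -> weak_grad Om u x = G x}.
Proof.
move=> oO uG; have wG := wgrad_subset (@subsetT _ Om) (W10_wgrad uG).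
have [H1u _] := wgrad_H1 oO wG; have w2 := H1_wgrad H1u.
have [su' sG' h'] := w2; have [su sG h] := wG.
have w3 : wgrad Om u (ext0 Om (weak_grad Om u)).
  split => // phi tphi i; rewrite -h' //.
  by apply/esym/ip_restrict => x; exact: test_out (test_function_partial i tphi).
by apply: filterS (wgrad_unique oO w3 wG) => x h1 Ox; rewrite -h1// ext0_in.
Qed.

Lemma W10_H10 Om u G : open Om -> W10 Om u G -> H10 Om u.
Proof.
move=> oO uG; have mO := open_measurable_rV oO.
have wG := wgrad_subset (@subsetT _ Om) (W10_wgrad uG).
have [H1u _] := wgrad_H1 oO wG; split => // e e0.
have [su sG H] := uG; have [_ sG' _] := H1_wgrad H1u.
have [phi [tphi h1 h2]] := H e e0; have qphi := test_function_sqint tphi.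
have sg := sqintv_grad tphi; exists phi; split => //.
  rewrite (_ : (u \- phi) = u - phi)// L2norm_nrm2; last first.
    exact: sqint_restrict mO (subspaceB ss su qphi).
  rewrite lte_fin (le_lt_trans _ h1)//; apply: nrm2_restrict => //.
  exact: subspaceB ss su qphi.
have E2 := ext0B_test (weak_grad Om u) (fun x => @grad_out _ _ x tphi).
have s2 : sqintv mu (ext0 Om (weak_grad Om u - grad phi)).
  by rewrite E2; exact: subspaceB ssv sG' sg.
have sGg : sqintv mu (G - grad phi) by exact: subspaceB ssv sG sg.
rewrite (_ : (weak_grad Om u \- grad phi) = weak_grad Om u - grad phi)// L2norm_vec_nrmv// lte_fin.
apply: le_lt_trans h2.
rewrite (@ae_eq_nrmv _ _ _ _ _ _ (ext0 Om (G - grad phi)))//; last 2 first.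
- exact: sqintv_restrict.
- apply: filterS (W10_weak_grad oO uG) => x h.
  have [Ox|Ox] := pselect (Om x); last by rewrite !ext0_out.
  by rewrite !ext0_in// !fctE h.
exact: nrmv_restrict.
Qed.

Lemma W10_ae_eq Om u u' G G' : sqint mu u' -> sqintv mu G' ->
  {ae mu, forall x, u x = u' x} -> {ae mu, forall x, G x = G' x} ->
  W10 Om u G -> W10 Om u' G'.
Proof.
move=> su' sG' uu GG [su sG H]; split => // e /H[phi [tphi h1 h2]].
have qphi := test_function_sqint tphi; have sg := sqintv_grad tphi.
exists phi; split => //.
  rewrite (@ae_eq_nrm2 _ _ _ _ _ (u - phi))//.
  - exact: subspaceB ss su' qphi.
  - exact: subspaceB ss su qphi.
  - by apply: filterS uu => x; rewrite !fctE => ->.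
rewrite (@ae_eq_nrmv _ _ _ _ _ _ (G - grad phi))//.
- exact: subspaceB ssv sG' sg.
- exact: subspaceB ssv sG sg.
- by apply: filterS GG => x; rewrite !fctE => ->.
Qed.

(** Stability returns some [w] in H10 equal to [v] almost everywhere and says nothing of [G];
    uniqueness of weak gradients on R^n identifies [G] with the gradient of [w]. *)
Lemma stable_W10 Om v G : stable Om -> wgrad [set: E] v G ->
  {ae mu, forall x, ~ closure Om x -> v x = 0} -> W10 Om v G.
Proof.
move=> stab wvG v0; have [sv sG hv] := wvG.
have [H1v _] := wgrad_H1 openT wvG.
have [w H10w vw] := stab v H1v v0.
have WW := H10_W10 H10w; have ww := W10_wgrad WW; have [sw sGw hw] := ww.
have wG : wgrad [set: E] (ext0 Om w) G.
  split => // phi tphi i; rewrite -hv//.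
  have qd := test_function_sqint (test_function_partial i tphi).
  by apply: ae_eq_ip => //; [apply: filterS vw => x -> //|exact: nearW].
apply: W10_ae_eq WW => //; first by apply: filterS vw => x ->.
by apply: filterS (wgrad_unique openT ww wG) => x; exact.
Qed.

End sobolev_representatives.

(** * Dirichlet solutions under perturbation of the domain *)

Section domain_perturbation.
Context {R : realType} {n : nat}.
Local Notation E := 'rV[R]_n.
Local Notation mu := (lebesgue_rV n : {sigma_finite_measure set E -> \bar R}).
Implicit Types (u v f g phi psi : E -> R) (G H P : E -> E).
Local Notation si := (semi_inner_ip mu).
Local Notation siv := (@semi_inner_vip _ _ _ n mu).
Local Notation ss := (sqint_subspace mu).
Local Notation ssv := (@sqintv_subspace _ _ _ n mu).

Definition nbhd (A : set E) (k : nat) : set E :=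
  \bigcup_(y in A) ball y k.+1%:R^-1.

Lemma open_nbhd A k : open (nbhd A k).
Proof.
by apply: bigcup_open => y _; apply: ball_open; rewrite invr_gt0.
Qed.

Lemma closure_nbhd A k : closure A `<=` nbhd A k.
Proof.
move=> x clx; have k0 : 0 < k.+1%:R^-1 :> R by rewrite invr_gt0.
have [y [Ay xy]] := clx _ (nbhsx_ballx x _ k0).
by exists y => //; exact: ball_sym.
Qed.

Lemma nbhd_closure A x : (forall k, nbhd A k x) -> closure A x.
Proof.
move=> H B /nbhs_ballP[e e0 eB].
have [k _ Hk] : \forall k \near \oo, k.+1%:R^-1 < e.
  exact: near_infty_natSinv_lt (PosNum e0).
have [y Ay xy] := H k; exists y; split => //; apply/eB/ball_sym.
by apply: le_ball xy; exact: ltW (Hk k (leqnn k)).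
Qed.

Lemma nbhdS A j k : (j <= k)%N -> nbhd A k `<=` nbhd A j.
Proof.
move=> jk x [y Ay xy]; exists y => //; apply: le_ball xy.
by rewrite lef_pV2 ?posrE// ler_nat.
Qed.

Section continuity.
Lemma sum4_le (x1 x2 x3 x4 z : R) : `|x1| <= z -> `|x2| <= z -> `|x3| <= z ->
  `|x4| <= z -> - x1 + x3 + x4 + x2 <= 4 * z.
Proof.
by rewrite !ler_norml => /andP[? ?] /andP[? ?] /andP[? ?] /andP[? ?]; lra.
Qed.

(** Final arithmetic for both norms: two approximation errors below [t], and a middle term of at
    most 4 t for gradients and 8 m t for functions after Poincare. *)
Lemma chain_lt (m t y a b c e : R) : 0 < t -> y <= a + b -> b <= c + e ->
  a < t -> c <= (4 + 8 * m) * t -> e < t -> y < t * (6 + 8 * m).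
Proof. by move=> *; lra. Qed.

Variables (n0 : (0 < n)%N) (M : R) (Om : set E).
Hypotheses (M0 : 0 < M) (OM : Om `<=` box 0 M) (stab : stable Om).

(** The box keeps the Poincare constant common to all [k]. *)
Let O k := nbhd Om k `&` box 0 M.
Let S := test_function (box (0 : E) M).
Let sd := @semi_inner_dirform R n (box 0 M).

Lemma vanishing_functional (L : (E -> R) -> R) (C : R) :
  (forall a phi psi, S phi -> S psi -> L (a *: phi + psi) = a * L phi + L psi) ->
  (forall phi, S phi -> `|L phi| <= C * nrmd phi) ->
  (forall phi, test_function Om phi -> L phi = 0) ->
  forall e, 0 < e -> exists k, forall psi, test_function (O k) psi ->
    `|L psi| <= e * nrmd psi.
Proof.
move=> Llin Lbnd L0.
have OS k : test_function (O k) `<=` S.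
  by move=> phi; apply: test_function_subset => x [].
have Odec k : test_function (O k.+1) `<=` test_function (O k).
  by move=> phi; apply: test_function_subset => x [h1 h2]; split => //; exact: nbhdS h1.
have [phi [tphi rphi cphi]] := riesz_decreasing sd
  (fun k => test_function_subspace (O k)) OS Odec Llin Lbnd.
have Sphi k : S (phi k) := OS k _ (tphi k).
have [v [G [sv sG lim]]] := grad_limit n0 M0 Sphi cphi.
have vG : W10 [set: E] v G.
  split => // e /lim[K HK]; have [h1 h2] := HK K (leqnn K).
  exists (phi K); split; first exact: test_function_subset (tphi K).
    by rewrite /nrm2 (semi_norm_distC si)//; exact: test_function_sqint (tphi K).
  by rewrite /nrmv (semi_norm_distC siv)//; exact: sqintv_grad (tphi K).
(* For fixed k all later [phi] vanish off [nbhd Om k], hence so does the limit; the closure of [Om]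
   is the intersection of these neighbourhoods. *)
have vout : {ae mu, forall x, ~ closure Om x -> v x = 0}.
  have : {ae mu, forall x (k : nat), ~ nbhd Om k x -> v x = 0}.
    apply: ae_foralln => k; apply: (@limit_out _ _ (~` nbhd Om k)) => //.
      by apply: measurableC; apply: open_measurable_rV; exact: open_nbhd.
    move=> e /lim[K HK]; have [h1 _] := HK _ (leq_maxl K k).
    have q := test_function_sqint (tphi (maxn K k)).
    exists (phi (maxn K k)); split => //; last by rewrite /nrm2 (semi_norm_distC si).
    move=> x nx; apply: (test_out (tphi _)) => -[h _]; apply: nx.
    by apply: nbhdS h; rewrite leq_maxr.
  apply: filterS => x h nx; apply: contrapT => vx; apply: nx; apply: nbhd_closure => k.
  by apply: contrapT => /h.
have WvG := stable_W10 stab (W10_wgrad vG) vout.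
have Lbnd' psi : S psi -> `|L psi| <= `|C| * nrmd psi.
  by move=> /Lbnd h; rewrite (le_trans h)// ler_wpM2r ?semi_norm_ge0// ler_norm.
(* A test function [chi] of [Om] close to the limit satisfies L chi = 0, so L (phi k) = L (phi k -
   chi) is small. *)
have Llim e : 0 < e -> exists K, forall k, (K <= k)%N -> `|L (phi k)| <= `|C| * e.
  move=> e0; have e20 : 0 < e / 2 by rewrite divr_gt0.
  have [K HK] := lim _ e20; have [_ _ /(_ _ e20)[chi [tchi _ h3]]] := WvG.
  have Schi : S chi by exact: test_function_subset OM tchi.
  exists K => k /HK[_ h2]; have Sd := subspaceB (test_function_subspace (box 0 M)) (Sphi k) Schi.
  have -> : L (phi k) = L (phi k - chi).
    have := Llin (-1) chi (phi k) Schi (Sphi k).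
    by rewrite (L0 _ tchi) mulr0 add0r scaleN1r addrC.
  apply: (le_trans (Lbnd' _ Sd)); rewrite ler_wpM2l//.
  rewrite nrmdE gradB; [|by case: (Sphi k)|by case: Schi].
  have := semi_norm_triangle siv (sqintv_grad (Sphi k)) (sqintv_grad Schi) sG.
  by move=> /le_trans; apply; move: h2 h3; rewrite /nrmv; lra.
(* Testing with [phi k] itself: |phi k|^2 <= |L (phi k)| + |phi k| / (k+1). *)
have nbnd k : nrmd (phi k) <= `|C| + 1.
  have r := rphi k (phi k) (tphi k); have l := Lbnd' _ (Sphi k).
  rewrite -(sqr_semi_norm sd (Sphi k)) -/nrmd in r.
  have [->|nz] := eqVneq (nrmd (phi k)) 0; first by rewrite addr_ge0.
  have np : 0 < nrmd (phi k) by rewrite lt_neqAle eq_sym nz semi_norm_ge0.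
  have k1 : k.+1%:R^-1 <= 1 :> R by rewrite invf_le1// ler1n.
  rewrite -(ler_pM2l np); move: (nrmd _) np k.+1%:R^-1 k1 r l => y y0 z z1.
  rewrite !ler_norml => /andP[a1 a2] /andP[b1 b2].
  by have : z * y <= 1 * y; [rewrite ler_wpM2r// ltW|lra].
have small e : 0 < e -> exists K, forall k, (K <= k)%N -> nrmd (phi k) <= e.
  move=> e0; pose D := `|C| + 1; have D0 : 0 < D by rewrite ltr_wpDl.
  (* With t = e^2 / (2 D), |phi k|^2 <= L (phi k) + |phi k| / (k+1) is at most |C| t + D t <= 2 D t
     = e^2. *)
  have e20 : 0 < e ^+ 2 / (2 * D) by rewrite divr_gt0 ?exprn_gt0 ?mulr_gt0.
  have [K HK] := Llim _ e20.
  have [N _ HN] : \forall k \near \oo, k.+1%:R^-1 < e ^+ 2 / (2 * D).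
    exact: near_infty_natSinv_lt (PosNum e20).
  exists (maxn K N) => k; rewrite geq_max => /andP[/HK h1 /HN/= h2].
  rewrite -ler_sqr ?nnegrE ?semi_norm_ge0 ?(ltW e0)//.
  have r := rphi k (phi k) (tphi k); have := nbnd k; have nn : 0 <= nrmd (phi k) := semi_norm_ge0 _ _.
  rewrite -(sqr_semi_norm sd (Sphi k)) -/nrmd in r.
  have dE : e ^+ 2 = 2 * D * (e ^+ 2 / (2 * D)) by field; rewrite gt_eqF.
  rewrite dE; move: (nrmd _) nn k.+1%:R^-1 (e ^+ 2 / (2 * D)) e20 h1 h2 r => y y0 z t t0 h1 h2.
  rewrite ler_norml => /andP[_ h3]; rewrite -/D => yD.
  have h4 : L (phi k) <= `|C| * t by exact: le_trans (ler_norm _) h1.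
  have h5 := le_trans (ler_wpM2r y0 (ltW h2)) (ler_wpM2l (ltW t0) yD).
  have h6 : `|C| * t <= D * t by rewrite ler_wpM2r ?(ltW t0)// lerDl.
  by move: h3 h4 h5 h6; rewrite [t * D]mulrC; lra.
move=> e e0; have e20 : 0 < e / 2 by rewrite divr_gt0.
have [K HK] := small _ e20.
have [N _ HN] : \forall k \near \oo, k.+1%:R^-1 < e / 2.
  exact: near_infty_natSinv_lt (PosNum e20).
exists (maxn K N) => psi tpsi; set k := maxn K N in tpsi *.
have h1 := HK k (leq_maxl _ _); have h2 := HN k (leq_maxr _ _).
have cs := cauchy_schwarz sd (Sphi k) (OS _ _ tpsi); have r := rphi k psi tpsi.
rewrite -[L psi](subKr (dirform (phi k) psi)) (le_trans (ler_normB _ _))//.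
rewrite [e]splitr mulrDl lerD//.
  by apply: (le_trans cs); rewrite ler_wpM2r ?semi_norm_ge0.
by apply: (le_trans r); rewrite ler_wpM2r ?semi_norm_ge0// ltW.
Qed.

Variable Om_ : R -> set E.
Hypothesis OM_ : forall e, 0 < e -> Om_ e `<=` box 0 M.
Hypothesis cc : compactly_converge Om_ Om.

(** The closed box minus the neighbourhood is a compact set disjoint from the closure of [Om]; the
    exterior half of compact convergence makes [Om_ e] avoid it. *)
Lemma near_subset_nbhd k : \forall e \near 0^'+, Om_ e `<=` O k.
Proof.
pose B : set E := [set x | forall i, `[- M, M]%classic (x ord0 i)].
have cB : compact B.
  by apply: (@rV_compact _ _ (fun=> `[- M, M]%classic)) => i; exact: segment_compact.
pose K := B `&` ~` nbhd Om k.
have cK : compact K by apply: compact_closedI => //; exact/open_closedC/open_nbhd.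
have Kout : K `<=` ~` closure Om by move=> x [_ nx] /(@closure_nbhd _ k).
have [_ /(_ K cK Kout) H] := cc.
near=> e; have He : K `<=` ~` closure (Om_ e) by near: e.
have e0 : 0 < e by near: e; exact: nbhs_right_gt.
move=> x Ox; have bx := OM_ e0 Ox; split => //; apply: contrapT => nx.
have /He : K x.
  split => // i; have := bx i.
  by rewrite mxE sub0r normrN /= in_itv/= => /ltW; rewrite ler_norml.
by apply; exact: subset_closure.
Unshelve. all: by end_near. Qed.

Lemma dirichlet_continuity (L : (E -> R) -> R) (L_ : R -> (E -> R) -> R) (C : R)
    (delta : R -> R) (p : E -> R) P (p_ : R -> E -> R) (P_ : R -> E -> E) :
  (forall a phi psi, S phi -> S psi -> L (a *: phi + psi) = a * L phi + L psi) ->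
  (forall phi, S phi -> `|L phi| <= C * nrmd phi) ->
  W10 Om p P ->
  (forall psi, test_function Om psi -> vip mu P (grad psi) = L psi) ->
  (forall e, 0 < e -> W10 (Om_ e) (p_ e) (P_ e)) ->
  (forall e, 0 < e -> forall psi, test_function (Om_ e) psi ->
    vip mu (P_ e) (grad psi) = L_ e psi) ->
  (forall e, 0 < e -> forall psi, test_function (Om_ e) psi ->
    `|L_ e psi - L psi| <= delta e * nrmd psi) ->
  (forall eta, 0 < eta -> \forall e \near 0^'+, delta e < eta) ->
  forall eta, 0 < eta -> \forall e \near 0^'+,
    nrm2 mu (p_ e - p) < eta /\ nrmv mu (P_ e - P) < eta.
Proof.
move=> Llin Lbnd pP HP pP_ HP_ Ldelta delta0 eta eta0.
have [sp sP appr] := pP.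
(* The factor of [chain_lt], so that t * X = eta. *)
pose X := 6 + 8 * M; have X0 : 0 < X by rewrite addr_gt0// mulr_gt0.
pose t := eta / X; have t0 : 0 < t by rewrite divr_gt0.
pose M0' phi := L phi - vip mu P (grad phi).
have [|||k Hk] := @vanishing_functional M0' (`|C| + nrmv mu P) _ _ _ t t0.
- move=> a phi psi Sphi Spsi; rewrite /M0' Llin//.
  rewrite gradDZ; [|by case: Sphi|by case: Spsi].
  have sg := sqintv_grad Sphi; have sg' := sqintv_grad Spsi.
  rewrite (semi_innerDr siv (subspaceZ a ssv sg))//.
  have [_ sym lin _] := siv.
  have -> : vip mu P (a *: grad phi) = a * vip mu P (grad phi).
    rewrite (sym _ _ sP (subspaceZ a ssv sg)) (semi_innerZl siv)//.
    by rewrite (sym _ _ sg).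
  by move: (L phi) (L psi) (vip mu P (grad phi)) (vip mu P (grad psi)) => *; ring.
- move=> phi Sphi; rewrite (le_trans (ler_normB _ _))// mulrDl lerD//.
    by rewrite (le_trans (Lbnd _ Sphi))// ler_wpM2r ?semi_norm_ge0// ler_norm.
  exact: (cauchy_schwarz siv sP (sqintv_grad Sphi)).
- by move=> phi tphi; rewrite /M0' HP// subrr.
(* [pt] is fixed before [e], so its compact support eventually lies in [Om_ e]; the approximant [q]
   of [p_ e] chosen below depends on [e]. *)
have [pt [tpt h1 h2]] := appr t t0.
have [cin _] := cc; have cpt : \forall e \near 0^'+, supp pt `<=` Om_ e.
  by case: tpt => _ cs sub; exact: cin.
near=> e.
have e0 : 0 < e by near: e; exact: nbhs_right_gt.
have Oe : Om_ e `<=` O k by near: e; exact: near_subset_nbhd.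
have se : supp pt `<=` Om_ e by near: e.
have de : delta e < t by near: e; exact: delta0.
have [spe sPe appre] := pP_ e e0; have [q [tq g1 g2]] := appre t t0.
have tpe : test_function (Om_ e) pt by case: tpt.
have tpsi := subspaceB (test_function_subspace (Om_ e)) tq tpe.
have Spsi : S (q - pt) by exact: test_function_subset (OM_ e0) tpsi.
have qq := test_function_sqint tq; have qpt := test_function_sqint tpt.
have sgq := sqintv_grad tq; have sgpt := sqintv_grad tpt; have sgpsi := sqintv_grad tpsi.
have gE : grad (q - pt) = grad q - grad pt by rewrite gradB//; [case: tq|case: tpt].
have npsi : nrmd (q - pt) <= 4 * t.
  have [->|nz] := eqVneq (nrmd (q - pt)) 0; first by rewrite mulr_ge0// ltW.
  have np : 0 < nrmd (q - pt) by rewrite lt_neqAle eq_sym nz semi_norm_ge0.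
  rewrite -(ler_pM2r np) -expr2 (sqr_semi_norm sd Spsi).
  (* Four errors, each at most [t * nrmd (q - pt)]: [q] against [p_ e], [L_ e] against [L], the
     functional [M0'] on [O k], and [pt] against [p]. *)
  have -> : dirform (q - pt) (q - pt) =
     - vip mu (P_ e - grad q) (grad (q - pt)) + (L_ e (q - pt) - L (q - pt))
     + M0' (q - pt) + vip mu (P - grad pt) (grad (q - pt)).
    rewrite -HP_// /M0' (semi_innerBl siv sPe sgq sgpsi) (semi_innerBl siv sP sgpt sgpsi).
    rewrite /dirform {1}gE (semi_innerBl siv sgq sgpt sgpsi).
    move: (vip mu (grad q) _) (vip mu (grad pt) _) (vip mu P _) (vip mu (P_ e) _) (L _) => *.
    by ring.
  have c1 := cauchy_schwarz siv (subspaceB ssv sPe sgq) sgpsi.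
  have c2 := cauchy_schwarz siv (subspaceB ssv sP sgpt) sgpsi.
  have c3 := Ldelta e e0 _ tpsi; have c4 := Hk _ (test_function_subset Oe tpsi).
  have b1 : `|vip mu (P_ e - grad q) (grad (q - pt))| <= t * nrmd (q - pt).
    exact: (le_trans c1 (ler_wpM2r (semi_norm_ge0 _ _) (ltW g2))).
  have b2 : `|vip mu (P - grad pt) (grad (q - pt))| <= t * nrmd (q - pt).
    exact: (le_trans c2 (ler_wpM2r (semi_norm_ge0 _ _) (ltW h2))).
  have b3 : `|L_ e (q - pt) - L (q - pt)| <= t * nrmd (q - pt).
    exact: (le_trans c3 (ler_wpM2r (semi_norm_ge0 _ _) (ltW de))).
  by rewrite -mulrA; exact: sum4_le b1 b2 b3 c4.
have eX : t * X = eta by rewrite /t divfK// gt_eqF.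
split.
  have pn := poincare n0 M0 Spsi.
  have t1 := semi_norm_triangle si spe sp qq; have t2 := semi_norm_triangle si qq sp qpt.
  have h1' : semi_norm (ip mu) (pt - p) < t by rewrite (semi_norm_distC si qpt sp).
  have pn' : nrm2 mu (q - pt) <= 2 * M * (4 * t).
    by apply: (le_trans pn); rewrite ler_wpM2l// mulr_ge0// ltW.
  rewrite -eX; apply: (chain_lt t0 t1 t2 g1 _ h1').
  apply: (le_trans pn'); rewrite (_ : 2 * M * (4 * t) = 8 * M * t); last by ring.
  by rewrite ler_wpM2r ?(ltW t0)// lerDr.
have t1 := semi_norm_triangle siv sPe sP sgq; have t2 := semi_norm_triangle siv sgq sP sgpt.
rewrite /nrmv (semi_norm_distC siv sP sgpt) in h2; rewrite nrmdE gE in npsi.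
rewrite -eX; apply: (chain_lt t0 t1 t2 g2 _ h2); apply: (le_trans npsi).
by rewrite ler_wpM2r ?(ltW t0)// lerDl mulr_ge0// ltW.
Unshelve. all: by end_near. Qed.

End continuity.
End domain_perturbation.

(** * From the Navier problem to two Dirichlet problems *)

Section navier.
Context {R : realType} {n : nat}.
Local Notation E := 'rV[R]_n.
Local Notation mu := (lebesgue_rV n : {sigma_finite_measure set E -> \bar R}).
Implicit Types (Om : set E) (u v f g phi psi : E -> R) (G H P : E -> E).
Local Notation si := (semi_inner_ip mu).
Local Notation siv := (@semi_inner_vip _ _ _ n mu).
Local Notation ss := (sqint_subspace mu).
Local Notation ssv := (@sqintv_subspace _ _ _ n mu).

Lemma Rintegral_sum (h : 'I_n -> E -> R) :
  (forall i, mu.-integrable [set: E] (EFin \o h i)) ->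
  mu.-integrable [set: E] (EFin \o (fun x => \sum_(i < n) h i x)) /\
  \int[mu]_x (\sum_(i < n) h i x) = \sum_(i < n) \int[mu]_x (h i x).
Proof.
move=> Ih; have -> : (fun x => \sum_(i < n) h i x) = \sum_(i < n) h i.
  by apply/funext => x; rewrite fct_sumE.
rewrite /Rintegral; apply: (big_ind2 (fun (g : E -> R) r =>
    mu.-integrable [set: E] (EFin \o g) /\ \int[mu]_x g x = r)).
- split; last by rewrite /Rintegral integral0.
  exact: (@integrable0 _ _ _ mu [set: E]).
- move=> g1 r1 g2 r2 [I1 <-] [I2 <-]; split; last exact: RintegralD.
  exact: (integrableD measurableT I1 I2).
- by [].
Qed.

Lemma ip0f g : ip mu 0 g = 0.
Proof.
rewrite /ip (_ : (fun x => _) = cst 0) /Rintegral ?integral0//.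
by apply/funext => x; exact: mul0r.
Qed.

(** The weak gradient is tested with the test functions [partial i psi]; this moves between
    distributional Laplacians and the weak form of the Dirichlet problem. *)
Lemma ip_laplacian Om u G psi : wgrad Om u G -> test_function Om psi ->
  ip mu u (laplacian psi) = - vip mu G (grad psi).
Proof.
move=> [su sG HG] tpsi; have td i := test_function_partial i tpsi.
have tdd i := test_function_partial i (td i).
transitivity (\int[mu]_x (\sum_(i < n) u x * partial i (partial i psi) x)).
  by apply: eq_Rintegral => x _; rewrite /laplacian mulr_sumr.
have [|_ ->] := @Rintegral_sum (fun i x => u x * partial i (partial i psi) x).
  by move=> i; apply: sqint_integrableM => //; exact: test_function_sqint (tdd i).
rewrite /vip -sumrN; apply: eq_bigr => i _.
by have := HG _ (td i) i; rewrite comp_grad.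
Qed.

Lemma laplacian_out Om psi x : test_function Om psi -> ~ Om x -> laplacian psi x = 0.
Proof.
move=> tpsi nx; apply: big1 => i _.
exact: test_out (test_function_partial i (test_function_partial i tpsi)) nx.
Qed.

Lemma Rintegral_ext0 Om u g : (forall x, ~ Om x -> g x = 0) ->
  \int[mu]_(x in Om) (u x * g x) = ip mu u g.
Proof.
move=> g0; rewrite Rintegral_mkcond; apply: eq_Rintegral => x _.
rewrite patchE; case: ifPn => //; rewrite notin_setE => /g0 ->.
by rewrite mulr0.
Qed.

Lemma ip_ext0 Om u g : (forall x, ~ Om x -> g x = 0) -> ip mu (ext0 Om u) g = ip mu u g.
Proof. exact: ip_restrict. Qed.

Lemma distr_lap_vip Om u g G : wgrad Om (ext0 Om u) G -> is_distr_lap Om u g ->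
  forall psi, test_function Om psi -> vip mu G (grad psi) = - ip mu (ext0 Om g) psi.
Proof.
move=> wG Hg psi tpsi; have := Hg psi tpsi.
have l0 x : ~ Om x -> laplacian psi x = 0 by exact: laplacian_out.
have p0 x : ~ Om x -> psi x = 0 by exact: test_out.
rewrite (Rintegral_ext0 _ l0) (Rintegral_ext0 _ p0) -(ip_ext0 _ l0) -(ip_ext0 _ p0).
by rewrite (ip_laplacian wG tpsi) => <-; rewrite opprK.
Qed.

Lemma vip_distr_lap Om u g G : wgrad Om u G ->
  (forall psi, test_function Om psi -> vip mu G (grad psi) = - ip mu g psi) ->
  is_distr_lap Om u g.
Proof.
move=> wG Hg psi tpsi.
have l0 x : ~ Om x -> laplacian psi x = 0 by exact: laplacian_out.
have p0 x : ~ Om x -> psi x = 0 by exact: test_out.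
by rewrite (Rintegral_ext0 _ l0) (Rintegral_ext0 _ p0) (ip_laplacian wG tpsi) Hg// opprK.
Qed.

Lemma distr_lapP Om u : HDelta Om u ->
  sqint mu (ext0 Om (distr_lap Om u)) /\ is_distr_lap Om u (distr_lap Om u).
Proof. by move=> [_ exg]; exact: (xgetPex (fun=> 0) exg). Qed.

Lemma distr_lap_unique Om u g h : open Om -> sqint mu (ext0 Om g) ->
  sqint mu (ext0 Om h) -> is_distr_lap Om u g -> is_distr_lap Om u h ->
  {ae mu, forall x, ext0 Om g x = ext0 Om h x}.
Proof.
move=> oO sg sh Hg Hh.
have : {ae mu, forall x, Om x -> (ext0 Om g - ext0 Om h) x = 0}.
  apply: fundamental_lemma => //; first exact: subspaceB ss sg sh.
  move=> psi tpsi; have qpsi := test_function_sqint tpsi.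
  have p0 x : ~ Om x -> psi x = 0 by exact: test_out.
  rewrite (semi_innerBl si sg sh qpsi) !ip_ext0//.
  by have := Hg _ tpsi; rewrite Hh// !Rintegral_ext0// => ->; rewrite subrr.
apply: filterS => x H; have [Ox|nx] := pselect (Om x); last by rewrite !ext0_out.
by apply/eqP; rewrite -subr_eq0; have := H Ox; rewrite !fctE => ->.
Qed.

Lemma ip_linear_r f (a : R) g h : sqint mu f -> sqint mu g -> sqint mu h ->
  ip mu f (a *: g + h) = a * ip mu f g + ip mu f h.
Proof.
move=> sf sg sh; have [_ sym lin _] := si.
rewrite (sym _ _ sf (subspaceD ss (subspaceZ a ss sg) sh)) lin//.
by rewrite (sym _ _ sg sf) (sym _ _ sh sf).
Qed.

Lemma vip_linear_r P (a : R) G H : sqintv mu P -> sqintv mu G -> sqintv mu H ->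
  vip mu P (a *: G + H) = a * vip mu P G + vip mu P H.
Proof.
move=> sP sG sH; have [_ sym lin _] := siv.
rewrite (sym _ _ sP (subspaceD ssv (subspaceZ a ssv sG) sH)) lin//.
by rewrite (sym _ _ sG sP) (sym _ _ sH sP).
Qed.

Lemma vip_ext0 Om P G : (forall x, ~ Om x -> G x = 0) ->
  vip mu (ext0 Om P) G = vip mu P G.
Proof.
move=> G0; apply: eq_bigr => i _; rewrite comp_ext0; apply: ip_ext0 => x /G0.
by rewrite /comp => ->; rewrite mxE.
Qed.

(* Lap u = f - w, where w in H10 is the Dirichlet projection of f. *)
Lemma navier_structure M (n0 : (0 < n)%N) Om f u : 0 < M -> open Om ->
  Om `<=` box 0 M -> H1 Om f -> navier_solution Om f u ->
  exists w Gw, [/\ W10 Om w Gw,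
    forall psi, test_function Om psi ->
      vip mu Gw (grad psi) = vip mu (ext0 Om (weak_grad Om f)) (grad psi),
    forall psi, test_function Om psi ->
      vip mu (ext0 Om (weak_grad Om u)) (grad psi) = - ip mu (ext0 Om f - w) psi
    & {ae mu, forall x, ext0 Om (distr_lap Om u) x = (ext0 Om f - w) x}].
Proof.
move=> M0 oO OM H1f [HDu H10u nav]; have mO := open_measurable_rV oO.
have [sF sGf _] := H1_wgrad H1f; have [sL HL] := distr_lapP HDu.
have WU := H10_W10 H10u; have wU := wgrad_subset (@subsetT _ Om) (W10_wgrad WU).
set F := ext0 Om f in sF *; set Gf := ext0 Om (weak_grad Om f) in sGf *.
set L := ext0 Om (distr_lap Om u) in sL *.
have [||w [Gw [Ww w0 Hw]]] := @dirichlet_exists _ _ M n0 Om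
    (fun psi => vip mu Gf (grad psi)) (nrmv mu Gf) M0 oO OM.
- move=> a phi psi tphi tpsi; rewrite gradDZ; [|by case: tphi|by case: tpsi].
  exact: (vip_linear_r a sGf (sqintv_grad tphi) (sqintv_grad tpsi)).
- move=> phi tphi; exact: (cauchy_schwarz siv sGf (sqintv_grad tphi)).
(* [lam] is the defect to be shown null; the Dirichlet solution [v] of Lap v = lam will be the test
   function. *)
have [sw sGw _] := Ww; pose lam := L - F + w.
have slam : sqint mu lam by apply: (subspaceD ss) => //; exact: subspaceB ss sL sF.
have lam0 x : ~ Om x -> lam x = 0.
  by move=> nx; rewrite /lam !fctE /L /F !ext0_out// w0// subrr addr0.
have [||v [Gv [Wv v0 Hv]]] := @dirichlet_exists _ _ M n0 Om
    (fun psi => - ip mu lam psi) (nrm2 mu lam * (2 * M)) M0 oO OM.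
- move=> a phi psi tphi tpsi; have q := test_function_sqint tphi; have q' := test_function_sqint tpsi.
  rewrite (ip_linear_r a slam q q').
  by move: (ip mu lam phi) (ip mu lam psi) => *; ring.
- move=> phi tphi; rewrite normrN.
  apply: (le_trans (cauchy_schwarz si slam (test_function_sqint tphi))).
  rewrite -mulrA; apply: ler_wpM2l; first exact: semi_norm_ge0.
  exact: (poincare n0 M0 (test_function_subset OM tphi)).
have H10v := W10_H10 oO Wv; have wv := wgrad_subset (@subsetT _ Om) (W10_wgrad Wv).
have lapv : is_distr_lap Om v lam by exact: vip_distr_lap wv Hv.
have slam' : sqint mu (ext0 Om lam) by exact: sqint_restrict.
have HDv : HDelta Om v.
  by split; [have [sv _ _] := Wv; exact: sqint_restrict|exists lam].
have [sLv HLv] := distr_lapP HDv; have WV := H10_W10 H10v.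
have [sV sGV _] := WV; have wV := wgrad_subset (@subsetT _ Om) (W10_wgrad WV).
have := nav v HDv H10v.
set Lv := ext0 Om (distr_lap Om v) in sLv; set GV := ext0 Om (weak_grad Om v) in WV sGV wV.
have -> : \int[mu]_(x in Om) (distr_lap Om u x * distr_lap Om v x) = ip mu L Lv.
  rewrite Rintegral_mkcond; apply: eq_Rintegral => x _.
  by rewrite /L /Lv /ext0 !patchE; case: ifP => //; rewrite mulr0.
have -> : \int[mu]_(x in Om) (f x * distr_lap Om v x + dot (weak_grad Om f x) (weak_grad Om v x)) =
    ip mu F Lv + vip mu Gf GV.
  have [|Is Es] := @Rintegral_sum (fun i x => comp i Gf x * comp i GV x).
    by move=> i; exact: sqint_integrableM.
  rewrite /vip -Es -RintegralD//; last exact: sqint_integrableM.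
  rewrite Rintegral_mkcond; apply: eq_Rintegral => x _.
  rewrite patchE; case: ifPn => [|]; first by rewrite inE => Ox;
    rewrite /F /Lv /comp !ext0_in// /dot; congr (_ + _); apply: eq_bigr => i _;
    rewrite /Gf /GV !ext0_in.
  rewrite notin_setE => nx; rewrite /F ext0_out// mul0r add0r big1// => i _.
  by rewrite /comp /Gf ext0_out// mxE mul0r.
(* By density: the gradient of f - w is orthogonal to all of H10, and in [e2] the Laplacian of [v]
   may be tested with [w]. *)
have e1 : vip mu (Gf - Gw) GV = 0.
  have s0 : sqint mu 0 by case: ss.
  rewrite (W10_density WV (subspaceB ssv sGf sGw) s0) ?ip0f// => psi tpsi.
  by rewrite ip0f (semi_innerBl siv sGf sGw (sqintv_grad tpsi)) Hw// subrr.
have e2 : vip mu GV Gw = - ip mu Lv w.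
  have sN : sqint mu (- Lv) by rewrite -scaleN1r; exact: subspaceZ ss sLv.
  rewrite (W10_density Ww sGV sN).
    by rewrite -scaleN1r (semi_innerZl si (-1) sLv sw) mulN1r.
  move=> psi tpsi; rewrite (distr_lap_vip wV HLv tpsi).
  by rewrite -[X in _ = ip mu X _]scaleN1r (semi_innerZl si (-1) sLv (test_function_sqint tpsi)) mulN1r.
have [_ symv _ _] := siv; have [_ sym _ _] := si.
rewrite -[vip mu Gf GV](subrK (vip mu Gw GV)) -(semi_innerBl siv sGf sGw sGV) e1 add0r.
rewrite (symv _ _ sGw sGV) e2 => nav'.
(* The problem now reads (L, Lv) = (F, Lv) - (w, Lv), and the chosen representative [Lv] equals
   [lam] almost everywhere. *)
have lamlam : ip mu lam lam = 0.
  have ae : {ae mu, forall x, lam x = Lv x}.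
    apply: filterS (distr_lap_unique oO slam' sLv lapv HLv) => x.
    have [Ox|nx] := pselect (Om x); first by rewrite ext0_in.
    by rewrite (lam0 x nx) ext0_out.
  have aer : {ae mu, forall x, lam x = lam x} by exact: nearW.
  rewrite (ae_eq_ip slam slam slam sLv aer ae) /lam.
  rewrite (semi_innerDl si (subspaceB ss sL sF) sw sLv) (semi_innerBl si sL sF sLv).
  by rewrite nav' (sym _ _ sw sLv); move: (ip mu F _) (ip mu Lv _) => *; ring.
have lamae : {ae mu, forall x, lam x = 0}.
  apply: nrm2_eq0 => //; rewrite /nrm2 /semi_norm lamlam.
  exact: sqrtr0.
have Lae : {ae mu, forall x, L x = (F - w) x}.
  apply: filterS lamae => x; rewrite /lam !fctE => h.
  by apply/eqP; rewrite -subr_eq0 -h; apply/eqP; move: (L x) (F x) (w x) => *; ring.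
exists w, Gw; split => //.
move=> psi tpsi; rewrite (distr_lap_vip wU HL tpsi); congr (- _).
have q := test_function_sqint tpsi.
by apply: ae_eq_ip => //; [exact: subspaceB ss sF sw|exact: nearW].
Qed.

End navier.

(** * Extended-real limits in terms of real norms *)

Section convergence_to_zero.
Context {R : realType}.

(** Agreement of [h] and [r] at positive parameters suffices for a limit from the right. *)
Lemma cvg0_near (h : R -> \bar R) (r : R -> R) :
  (forall e, 0 < e -> h e = (r e)%:E) -> (forall e, 0 <= r e) ->
  h e @[e --> 0^'+] --> 0%E <->
  (forall eta, 0 < eta -> \forall e \near 0^'+, r e < eta).
Proof.
move=> hr r0; have hE : \forall e \near (0 : R)^'+, h e = (r e)%:E.
  by near=> e; apply: hr; near: e; exact: nbhs_right_gt.
split=> [h0 eta eta0|rlt].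
  have /fine_cvgP[_ /cvgrPdist_lt/(_ _ eta0)] : (r e)%:E @[e --> 0^'+] --> 0%E.
    by apply: cvg_trans h0; exact: near_eq_cvg.
  by apply: filterS => e; rewrite /= sub0r normrN ger0_norm.
have rE : (r e)%:E @[e --> 0^'+] --> 0%E.
  apply/fine_cvgP; split; first exact: nearW.
  apply/cvgrPdist_lt => eta /rlt; apply: filterS => e.
  by rewrite /= sub0r normrN ger0_norm.
apply: cvg_trans rE; apply: near_eq_cvg.
by apply: filterS hE => e ->.
Unshelve. all: by end_near. Qed.

End convergence_to_zero.

(** * Two successive Dirichlet limits: for [w_], then for [u_] *)

Theorem theorem5p3 (R : realType) (N : nat) (D : set 'rV[R]_N)
    (Om_ : R -> set 'rV[R]_N) (Om : set 'rV[R]_N)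
    (f_ u_ : R -> 'rV[R]_N -> R) (f u : 'rV[R]_N -> R) :
  (0 < N)%N ->
  bounded_set D ->
  (forall eps : R, 0 < eps -> domain (Om_ eps) /\ Om_ eps `<=` D) ->
  domain Om -> Om `<=` D ->
  compactly_converge Om_ Om ->
  stable Om ->
  (forall eps : R, 0 < eps -> H1 (Om_ eps) (f_ eps)) ->
  H1 Om f ->
  L2norm (Om_ eps) (f_ eps \- ext0 Om f) @[eps --> 0^'+] --> 0%E ->
  L2norm_vec (Om_ eps)
    (weak_grad (Om_ eps) (f_ eps) \- ext0 Om (weak_grad Om f))
    @[eps --> 0^'+] --> 0%E ->
  (forall eps : R, 0 < eps -> navier_solution (Om_ eps) (f_ eps) (u_ eps)) ->
  navier_solution Om f u ->
  [/\ L2norm (Om_ eps) (u_ eps \- ext0 Om u) @[eps --> 0^'+] --> 0%E,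
      L2norm_vec (Om_ eps)
        (weak_grad (Om_ eps) (u_ eps) \- ext0 Om (weak_grad Om u))
        @[eps --> 0^'+] --> 0%E
    & L2norm (Om_ eps)
        (distr_lap (Om_ eps) (u_ eps) \- ext0 Om (distr_lap Om u))
        @[eps --> 0^'+] --> 0%E].
Proof.
move=> n0 bD dOm_ [oO _] OD cc stab H1f_ H1f cf cGf nav_ nav.
pose mu := @lebesgue_rV R N; have si := semi_inner_ip mu; have siv := @semi_inner_vip _ _ _ N mu.
have ss := sqint_subspace mu; have ssv := @sqintv_subspace _ _ _ N mu.
have [M M0 DM] := bounded_set_box bD.
have oOm_ e : 0 < e -> open (Om_ e) by move=> /dOm_[[]].
have OM_ e : 0 < e -> Om_ e `<=` box 0 M by move=> /dOm_[_ OeD] x /OeD /DM.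
have OM : Om `<=` box 0 M by move=> x /OD /DM.
have mO_ e : 0 < e -> measurable (Om_ e) by move=> /oOm_; exact: open_measurable_rV.
have [w [Gw [Ww Hw Hu Hlap]]] := navier_structure n0 M0 oO OM H1f nav.
(* Choice ranges over all reals; e <= 0 receives (0, 0), about which nothing is claimed. *)
have /boolp.choice[W_ HW_] : forall e, exists p : ('rV[R]_N -> R) * ('rV[R]_N -> 'rV[R]_N), 0 < e ->
  [/\ W10 (Om_ e) p.1 p.2,
    forall psi, test_function (Om_ e) psi ->
      vip mu p.2 (grad psi) = vip mu (ext0 (Om_ e) (weak_grad (Om_ e) (f_ e))) (grad psi),
    forall psi, test_function (Om_ e) psi ->
      vip mu (ext0 (Om_ e) (weak_grad (Om_ e) (u_ e))) (grad psi) =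
      - ip mu (ext0 (Om_ e) (f_ e) - p.1) psi
    & {ae mu, forall x, ext0 (Om_ e) (distr_lap (Om_ e) (u_ e)) x =
        (ext0 (Om_ e) (f_ e) - p.1) x}].
  move=> e; have [e0|] := ltP 0 e; last by exists (0, 0).
  have [v [Gv H]] := navier_structure n0 M0 (oOm_ e e0) (OM_ e e0) (H1f_ e e0) (nav_ e e0).
  by exists (v, Gv).
pose w_ e := (W_ e).1; pose Gw_ e := (W_ e).2.
have [sF sGf _] := H1_wgrad H1f; have [sw sGw _] := Ww.
have [_ H10u _] := nav; have WU := H10_W10 H10u; have [sU sGU _] := WU.
have [HDu _ _] := nav; have [sL _] := distr_lapP HDu.
set F := ext0 Om f in sF Hlap Hu cf *; set Gf := ext0 Om (weak_grad Om f) in sGf Hw cGf *.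
pose rf e := nrm2 mu (ext0 (Om_ e) (f_ e - F)).
pose rg e := nrmv mu (ext0 (Om_ e) (weak_grad (Om_ e) (f_ e) - Gf)).
have extB (V : zmodType) A (h k : 'rV[R]_N -> V) : ext0 A (h - k) = ext0 A h - ext0 A k.
  apply/funext => x; have [Ax|Ax] := pselect (A x); first by rewrite !fctE !ext0_in.
  by rewrite !fctE !ext0_out// subrr.
have sF_ e (e0 : 0 < e) : sqint mu (ext0 (Om_ e) (f_ e)) by have [] := H1_wgrad (H1f_ e e0).
have sGf_ e (e0 : 0 < e) : sqintv mu (ext0 (Om_ e) (weak_grad (Om_ e) (f_ e))).
  by have [] := H1_wgrad (H1f_ e e0).
have sdF e (e0 : 0 < e) : sqint mu (ext0 (Om_ e) (f_ e - F)).
  by rewrite extB; apply: subspaceB ss (sF_ e e0) _; exact: sqint_restrict (mO_ e e0) sF.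
have sdG e (e0 : 0 < e) : sqintv mu (ext0 (Om_ e) (weak_grad (Om_ e) (f_ e) - Gf)).
  by rewrite extB; apply: subspaceB ssv (sGf_ e e0) _; exact: sqintv_restrict (mO_ e e0) sGf.
have rf0 : forall eta, 0 < eta -> \forall e \near 0^'+, rf e < eta.
  apply: (cvg0_near _ _).1 cf => e; last exact: nrm2_ge0.
  by move=> e0; apply: L2norm_nrm2; exact: sdF.
have rg0 : forall eta, 0 < eta -> \forall e \near 0^'+, rg e < eta.
  apply: (cvg0_near _ _).1 cGf => e; last exact: nrmv_ge0.
  by move=> e0; apply: L2norm_vec_nrmv; exact: sdG.
have HW e (e0 : 0 < e) : W10 (Om_ e) (w_ e) (Gw_ e) by have [] := HW_ e e0.
have cw : forall eta, 0 < eta -> \forall e \near 0^'+,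
    nrm2 mu (w_ e - w) < eta /\ nrmv mu (Gw_ e - Gw) < eta.
  apply: (@dirichlet_continuity _ _ n0 M Om M0 OM stab Om_ OM_ cc
    (fun psi => vip mu Gf (grad psi))
    (fun e psi => vip mu (ext0 (Om_ e) (weak_grad (Om_ e) (f_ e))) (grad psi))
    (nrmv mu Gf) rg w Gw w_ Gw_ _ _ Ww Hw HW _ _ rg0).
  - move=> a phi psi tphi tpsi; rewrite gradDZ; [|by case: tphi|by case: tpsi].
    exact: (vip_linear_r a sGf (sqintv_grad tphi) (sqintv_grad tpsi)).
  - by move=> phi tphi; exact: (cauchy_schwarz siv sGf (sqintv_grad tphi)).
  - by move=> e e0 psi tpsi; have [_ h _ _] := HW_ e e0; exact: h.
  - move=> e e0 psi tpsi; have sg := sqintv_grad tpsi.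
    (* [psi] lives on [Om_ e], so [Gf] may be cut to it, and only the distance [rg e] of the data on
       [Om_ e] enters. *)
    rewrite -[vip mu Gf _](@vip_ext0 _ _ (Om_ e)); last first.
      by move=> x; exact: grad_out tpsi.
    have sGr := sqintv_restrict (mO_ e e0) sGf.
    rewrite -(semi_innerBl siv (sGf_ e e0) sGr sg) -extB.
    exact: (cauchy_schwarz siv (sdG e e0) sg).
have HWU e (e0 : 0 < e) : W10 (Om_ e) (ext0 (Om_ e) (u_ e)) (ext0 (Om_ e) (weak_grad (Om_ e) (u_ e))).
  by have [_ h _] := nav_ e e0; exact: H10_W10.
pose rw e := nrm2 mu (w_ e - w).
have sFw : sqint mu (F - w) by exact: subspaceB ss sF sw.
have sw_ e (e0 : 0 < e) : sqint mu (w_ e) by have [] := HW e e0.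
have cu : forall eta, 0 < eta -> \forall e \near 0^'+,
    nrm2 mu (ext0 (Om_ e) (u_ e) - ext0 Om u) < eta /\
    nrmv mu (ext0 (Om_ e) (weak_grad (Om_ e) (u_ e)) - ext0 Om (weak_grad Om u)) < eta.
  have M20 : 0 < 2 * M by rewrite mulr_gt0.
  (* Poincare turns the L^2 distances [rf e] and [rw e] into bounds by [nrmd psi], whence the factor
     2 M. *)
  apply: (@dirichlet_continuity _ _ n0 M Om M0 OM stab Om_ OM_ cc
    (fun psi => - ip mu (F - w) psi)
    (fun e psi => - ip mu (ext0 (Om_ e) (f_ e) - w_ e) psi)
    (nrm2 mu (F - w) * (2 * M)) (fun e => (rf e + rw e) * (2 * M)) _ _
    (fun e => ext0 (Om_ e) (u_ e)) (fun e => ext0 (Om_ e) (weak_grad (Om_ e) (u_ e)))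
    _ _ WU Hu HWU _ _ _).
  - move=> a phi psi tphi tpsi.
    have q := test_function_sqint tphi; have q' := test_function_sqint tpsi.
    rewrite (ip_linear_r a sFw q q').
    by move: (ip mu _ phi) (ip mu _ psi) => *; ring.
  - move=> phi tphi; rewrite normrN.
    apply: (le_trans (cauchy_schwarz si sFw (test_function_sqint tphi))).
    rewrite -mulrA; apply: ler_wpM2l; first exact: semi_norm_ge0.
    exact: (poincare n0 M0 tphi).
  - by move=> e e0 psi tpsi; have [_ _ h _] := HW_ e e0; exact: h.
  - move=> e e0 psi tpsi; have q := test_function_sqint tpsi.
    have p0 x : ~ Om_ e x -> psi x = 0 by exact: test_out.
    have sFr := sqint_restrict (mO_ e e0) sF.
    have dw := subspaceB ss (sw_ e e0) sw.
    have -> : - ip mu (ext0 (Om_ e) (f_ e) - w_ e) psi - - ip mu (F - w) psi =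
        ip mu (w_ e - w) psi - ip mu (ext0 (Om_ e) (f_ e - F)) psi.
      rewrite extB (semi_innerBl si (sF_ e e0) (sw_ e e0) q) (semi_innerBl si sF sw q).
      rewrite (semi_innerBl si (sw_ e e0) sw q) (semi_innerBl si (sF_ e e0) sFr q).
      rewrite (ip_ext0 F p0).
      move: (ip mu (ext0 _ _) _) (ip mu F _) (ip mu w _) (ip mu (w_ e) _) => *.
      by ring.
    rewrite (le_trans (ler_normB _ _))// mulrDl mulrDl addrC.
    have pc : nrm2 mu psi <= 2 * M * nrmd psi.
      exact: (poincare n0 M0 (test_function_subset (OM_ e e0) tpsi)).
    apply: lerD; rewrite -mulrA.
      apply: (le_trans (cauchy_schwarz si (sdF e e0) q)).
      by apply: ler_wpM2l; [exact: nrm2_ge0|exact: pc].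
    apply: (le_trans (cauchy_schwarz si dw q)).
    by apply: ler_wpM2l; [exact: nrm2_ge0|exact: pc].
  - move=> eta eta0; have t0 : 0 < eta / (2 * M) / 2 by rewrite !divr_gt0.
    apply: filterS2 (rf0 _ t0) (cw _ t0) => e h1 [h2 _].
    rewrite -ltr_pdivlMr// [ltRHS]splitr; exact: ltrD.
have sUr e (e0 : 0 < e) : sqint mu (ext0 (Om_ e) (u_ e)) by have [] := HWU e e0.
have sGUr e (e0 : 0 < e) : sqintv mu (ext0 (Om_ e) (weak_grad (Om_ e) (u_ e))) by have [] := HWU e e0.
have ext0K (V : zmodType) A (h : 'rV[R]_N -> V) : ext0 A (ext0 A h) = ext0 A h.
  by apply/funext => x; have [Ax|Ax] := pselect (A x); [rewrite !ext0_in|rewrite !ext0_out].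
split.
- apply: (cvg0_near (r := fun e => nrm2 mu (ext0 (Om_ e) (u_ e - ext0 Om u))) _ _).2.
  + move=> e e0; apply: L2norm_nrm2.
    by rewrite extB; apply: subspaceB ss (sUr e e0) _; exact: sqint_restrict (mO_ e e0) sU.
  + by move=> e; exact: nrm2_ge0.
  move=> eta eta0; near=> e; have e0 : 0 < e by near: e; exact: nbhs_right_gt.
  have [h _] : nrm2 mu (ext0 (Om_ e) (u_ e) - ext0 Om u) < eta /\
      nrmv mu (ext0 (Om_ e) (weak_grad (Om_ e) (u_ e)) - ext0 Om (weak_grad Om u)) < eta.
    by near: e; exact: cu.
  (* The estimate holds on the whole space, and cutting to [Om_ e] does not increase the norm. *)
  apply: le_lt_trans h; have sd := subspaceB ss (sUr e e0) sU.
  by have := nrm2_restrict (mO_ e e0) sd; rewrite -/(ext0 _ _) extB ext0K -extB.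
- apply: (cvg0_near (r := fun e => nrmv mu (ext0 (Om_ e) (weak_grad (Om_ e) (u_ e) - ext0 Om (weak_grad Om u)))) _ _).2.
  + move=> e e0; apply: L2norm_vec_nrmv.
    by rewrite extB; apply: subspaceB ssv (sGUr e e0) _; exact: sqintv_restrict (mO_ e e0) sGU.
  + by move=> e; exact: nrmv_ge0.
  move=> eta eta0; near=> e; have e0 : 0 < e by near: e; exact: nbhs_right_gt.
  have [_ h] : nrm2 mu (ext0 (Om_ e) (u_ e) - ext0 Om u) < eta /\
      nrmv mu (ext0 (Om_ e) (weak_grad (Om_ e) (u_ e)) - ext0 Om (weak_grad Om u)) < eta.
    by near: e; exact: cu.
  apply: le_lt_trans h; have sd := subspaceB ssv (sGUr e e0) sGU.
  by have := nrmv_restrict (mO_ e e0) sd; rewrite extB ext0K -extB.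
have sL_ e (e0 : 0 < e) : sqint mu (ext0 (Om_ e) (distr_lap (Om_ e) (u_ e))).
  by have [HDe _ _] := nav_ e e0; have [] := distr_lapP HDe.
set L := ext0 Om (distr_lap Om u) in sL Hlap *.
have sdL e (e0 : 0 < e) : sqint mu (ext0 (Om_ e) (distr_lap (Om_ e) (u_ e) - L)).
  by rewrite extB; apply: subspaceB ss (sL_ e e0) _; exact: sqint_restrict (mO_ e e0) sL.
apply: (cvg0_near (r := fun e => nrm2 mu (ext0 (Om_ e) (distr_lap (Om_ e) (u_ e) - L))) _ _).2.
- by move=> e e0; apply: L2norm_nrm2; exact: sdL.
- by move=> e; exact: nrm2_ge0.
move=> eta eta0; have t0 : 0 < eta / 2 by rewrite divr_gt0.
near=> e; have e0 : 0 < e by near: e; exact: nbhs_right_gt.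
have h1 : rf e < eta / 2 by near: e; exact: rf0.
have [h2 _] : nrm2 mu (w_ e - w) < eta / 2 /\ nrmv mu (Gw_ e - Gw) < eta / 2.
  by near: e; exact: cw.
have dw := subspaceB ss (sw_ e e0) sw.
have sdwr := sqint_restrict (mO_ e e0) dw.
(* Almost everywhere on [Om_ e], Lap u_e = f_e - w_e and (Lap u)_0 = f_0 - w, the latter also
   outside [Om]; so the Laplacians converge because the data and [w_] do. *)
have -> : nrm2 mu (ext0 (Om_ e) (distr_lap (Om_ e) (u_ e) - L)) =
    nrm2 mu (ext0 (Om_ e) (f_ e - F) - ext0 (Om_ e) (w_ e - w)).
  apply: ae_eq_nrm2; [exact: sdL|exact: subspaceB ss (sdF e e0) sdwr|].
  have [_ _ _ Hlap_] := HW_ e e0.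
  apply: filterS2 Hlap Hlap_ => x lx lx_; rewrite !fctE.
  have [Ox|nx] := pselect (Om_ e x); last by rewrite !ext0_out// subrr.
  move: lx_; rewrite !ext0_in// !fctE lx => ->; rewrite !fctE ext0_in//.
  by rewrite /w_; move: (f_ e x) (F x) (w x) ((W_ e).1 x) => *; ring.
have tri := semi_normD si (sdF e e0) (subspaceZ (-1) ss sdwr).
rewrite scaleN1r in tri; apply: (le_lt_trans tri).
rewrite [ltRHS]splitr; apply: ltrD; first exact: h1.
rewrite -scaleN1r (semi_normZ si (-1) sdwr) normrN1 mul1r.
exact: (le_lt_trans (nrm2_restrict (mO_ e e0) dw) h2).
Unshelve. all: by end_near. Qed.
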